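(* Let $R_\infty$ be a complete local noetherian $\mathcal O$-algebra and $\lambda\colon R_\infty\to\mathcal O$ a surjective map of $\mathcal O$-algebras with kernel $\mathfrak p$, such that $(R_\infty)_{\mathfrak p}$ is regular of dimension $c$. Let $M_\infty$ be a finitely generated $R_\infty$-module with $\operatorname{depth}_{R_\infty}M_\infty\ge c+1$ and $(M_\infty)_{\mathfrak p}\ne0$. For a sequence $\boldsymbol y=y_1,\dots,y_c$ in $\mathfrak p$ such that $(\boldsymbol y,\varpi)$ is an $M_\infty$-regular sequence, set $R_{\boldsymbol y}=R_\infty/(\boldsymbol y)$, $M_{\boldsymbol y}=M_\infty/(\boldsymbol y)M_\infty$ and $\mathfrak p_{\boldsymbol y}=\mathfrak p/(\boldsymbol y)\subseteq R_{\boldsymbol y}$, so $M_{\boldsymbol y}$ is flat over $\mathcal O$. Provided that $\mathfrak p_{\boldsymbol y}/\mathfrak p_{\boldsymbol y}^2$ has finite length, the Wiles defect $\delta_{R_{\boldsymbol y}}(M_{\boldsymbol y})$ depends only on $R_\infty$, $M_\infty$ and $\lambda$, and not on the choice of $\boldsymbol y$; that is, it takes the same value for any two sequences $\boldsymbol y$ satisfying these conditions.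
   Context: $\mathcal O$ is the ring of integers of a finite extension of $\mathbb Q_\ell$, with uniformizer $\varpi$. For a finitely generated $\mathcal O$-module $U$, $U^{\mathrm{tf}}$ denotes its torsion-free quotient. For a complete noetherian local $\mathcal O$-algebra $A$ with surjective augmentation $\lambda_A\colon A\to\mathcal O$, kernel $\mathfrak p_A$, such that $\mathfrak p_A/\mathfrak p_A^2$ has finite length over $\mathcal O$ (equivalently $A_{\mathfrak p_A}$ is a field), and a finitely generated $A$-module $M$, the congruence module $\Psi_A(M)$ is the cokernel of the map $\operatorname{Hom}_A(\mathcal O,M)^{\mathrm{tf}}\to\operatorname{Hom}_A(\mathcal O,M/\mathfrak p_AM)^{\mathrm{tf}}$ induced by $M\to M/\mathfrak p_AM$, and the Wiles defect is $$\delta_A(M)=(\operatorname{rank}_{A_{\mathfrak p_A}}M_{\mathfrak p_A})\cdot\operatorname{length}_{\mathcal O}(\mathfrak p_A/\mathfrak p_A^2)-\operatorname{length}_{\mathcal O}\Psi_A(M).$$ This is applied with $A=R_{\boldsymbol y}$ and the augmentation induced by $\lambda$. *)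

(* Defs.v *)
From HB Require Import structures.
From mathcomp Require Import all_boot all_order all_algebra ring_quotient.
From mathcomp Require Import all_field ring.
From mathcomp Require Import boolp classical_sets functions.

Set Implicit Arguments.
Unset Strict Implicit.
Unset Printing Implicit Defensive.

Import Order.TTheory GRing.Theory Num.Theory.
Local Open Scope classical_set_scope.
Local Open Scope ring_scope.
Local Open Scope quotient_scope.

(* Submodules and ideals are boolean predicates, Prop-valued conditions being
   turned into booleans classically by `[< _ >]. The type idealr of the library
   consists of the *proper* ideals. *)
Section SubQuotient.
Variables (R : comNzRingType) (M : lmodType R) (N : submodClosed M).

Definition submod : Type := {x : M | x \in N}.
HB.instance Definition _ := SubChoice.on submod.
HB.instance Definition _ := [SubChoice_isSubLmodule of submod by <:].

Fact submod_oppr_closed : oppr_closed N.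
Proof. by move=> x xN; rewrite -scaleN1r rpredZ. Qed.

Definition submod_zmodClosed : zmodClosed M :=
  HB.pack (N : {pred M}) (GRing.isOppClosed.Build M N submod_oppr_closed) N.

Definition quotmod : Type := {ideal_quot submod_zmodClosed}.
HB.instance Definition _ := GRing.Zmodule.on quotmod.

Definition qproj (x : M) : quotmod := \pi_({ideal_quot submod_zmodClosed}) x.
Definition qrepr (u : quotmod) : M := repr (u : {ideal_quot submod_zmodClosed}).

Lemma qreprK u : qproj (qrepr u) = u. Proof. exact: reprK. Qed.

Lemma qproj_eq x y : (qproj x = qproj y) <-> (x - y \in N).
Proof.
rewrite /qproj; split=> [/eqP|xy]; last apply/eqP;
  by rewrite -Quotient.idealrBE.
Qed.

Lemma qprojD x y : qproj (x + y) = qproj x + qproj y.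
Proof. exact: (raddfD (\pi_({ideal_quot submod_zmodClosed}))). Qed.

Definition qscale (a : R) (u : quotmod) : quotmod := qproj (a *: qrepr u).

Lemma qscaleE a x : qscale a (qproj x) = qproj (a *: x).
Proof.
apply/qproj_eq; rewrite -scalerBr; apply: rpredZ; apply/qproj_eq.
by rewrite qreprK.
Qed.

Fact qscaleA a b u : qscale a (qscale b u) = qscale (a * b) u.
Proof. by rewrite -[u]qreprK !qscaleE scalerA. Qed.
Fact qscale1 : left_id 1 qscale.
Proof. by move=> u; rewrite -[u]qreprK !qscaleE scale1r. Qed.
Fact qscaleDr : right_distributive qscale +%R.
Proof.
move=> a u v; rewrite -[u]qreprK -[v]qreprK -qprojD !qscaleE -qprojD.
by rewrite scalerDr.
Qed.
Fact qscaleDl u : {morph qscale^~ u : a b / a + b}.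
Proof. by move=> a b; rewrite -[u]qreprK !qscaleE -qprojD scalerDl. Qed.

HB.instance Definition _ :=
  GRing.Zmodule_isLmodule.Build R quotmod qscaleA qscale1 qscaleDr qscaleDl.

Fact qproj_is_linear : linear qproj.
Proof. by move=> a x y; rewrite qprojD -qscaleE. Qed.
HB.instance Definition _ :=
  GRing.isLinear.Build R M quotmod _ qproj qproj_is_linear.

End SubQuotient.
Arguments submod {R M} N.
Arguments quotmod {R M} N.
Arguments qproj {R M} N x.

Section Span.
Variables (R : comNzRingType) (M : lmodType R).

Definition mod_span (X : set M) : {pred M} := fun x =>
  `[< exists n (a : 'I_n -> R) (u : 'I_n -> M),
        (forall i, X (u i)) /\ x = \sum_(i < n) a i *: u i >].

Fact mod_span_closed X : submod_closed (mod_span X).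
Proof.
split=> [|b x y /asboolP[n [a [u [uX ->]]]] /asboolP[k [a' [u' [u'X ->]]]]].
  apply/asboolP; exists 0, (fun=> 0), (fun=> 0); split=> [[]//|].
  by rewrite big_ord0.
apply/asboolP; exists (n + k)%N,
  (fun i : 'I_(n + k) => match fintype.split i with inl j => b * a j | inr j => a' j end),
  (fun i : 'I_(n + k) => match fintype.split i with inl j => u j | inr j => u' j end); split.
  by move=> i; case: (fintype.split i).
rewrite big_split_ord /= scaler_sumr; congr (_ + _); apply: eq_bigr => i _.
  by have := unsplitK (inl i : 'I_n + 'I_k) => /= ->; rewrite scalerA.
by have := unsplitK (inr i : 'I_n + 'I_k) => /= ->.
Qed.
HB.instance Definition _ X :=
  GRing.isSubmodClosed.Build R M (mod_span X) (mod_span_closed X).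

Definition finitely_generated :=
  exists s : seq M, forall x, x \in mod_span [set` s].

End Span.
Arguments finitely_generated {R} M.

Definition ideal_smul (R : comNzRingType) (I : {pred R}) (M : lmodType R) :
  {pred M} := mod_span [set a *: x | a in [set` I] & x in [set: M]].
Arguments ideal_smul {R} I M.
HB.instance Definition _ R I M := GRing.SubmodClosed.on (@ideal_smul R I M).

Definition gen_ideal (R : comNzRingType) (s : seq R) : {pred R} :=
  mod_span (M := R^o) [set` s].

(* I ^ 0 is the unit ideal. *)
Fixpoint ideal_pow (R : comNzRingType) (I : {pred R}) (n : nat) : {pred R} :=
  if n is k.+1 then
    mod_span (M := R^o) [set a * b | a in [set` I] & b in [set` ideal_pow I k]]
  else predT.

Section Localization.
Variables (R : comNzRingType) (P : prime_idealr R).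

Definition denominator : Type := {s : R | s \notin P}.
HB.instance Definition _ := SubChoice.on denominator.

Definition den (s : denominator) : R := val s.

Fact den1_subproof : 1 \notin P. Proof. by rewrite idealr1. Qed.
Definition den1 : denominator := exist (fun s : R => s \notin P) 1 den1_subproof.

Fact denM_subproof (s t : denominator) : den s * den t \notin P.
Proof. by rewrite prime_idealrM negb_or (valP s) (valP t). Qed.
Definition denM s t : denominator :=
  exist (fun s : R => s \notin P) _ (denM_subproof s t).

Lemma denME s t : den (denM s t) = den s * den t. Proof. by []. Qed.
Lemma den1E : den den1 = 1. Proof. by []. Qed.

Section LocalizedModule.
Variable M : lmodType R.

Fact scale_via (a b : R) (x y : M) (k c d : R) :
  a *: x = b *: y -> c = k * a -> d = k * b -> c *: x = d *: y.
Proof. by move=> e -> ->; rewrite -!scalerA e. Qed.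

(* (x, s) and (y, t) are identified when u * (t * x - s * y) = 0 for some u
   outside P, as the complement of P may contain zero divisors. *)
Definition loc_equiv : rel (M * denominator) := fun x y =>
  `[< exists u : denominator,
        den u *: (den y.2 *: x.1 - den x.2 *: y.1) = 0 >].

Fact loc_equiv_is_equiv : equiv_class_of loc_equiv.
Proof.
have sym x y : loc_equiv x y -> loc_equiv y x.
  move=> /asboolP[u e]; apply/asboolP; exists u.
  by rewrite -opprB scalerN e oppr0.
split=> [x|x y|y x z].
- by apply/asboolP; exists den1; rewrite subrr scaler0.
- by apply/idP/idP; apply: sym.
move=> /asboolP[u /eqP e] /asboolP[v /eqP e']; apply/asboolP.
exists (denM y.2 (denM u v)); rewrite !denME.
move: e e'; rewrite !scalerBr !subr_eq0 !scalerA => /eqP e /eqP e'.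
apply/eqP; rewrite subr_eq0; apply/eqP.
transitivity ((den u * den x.2 * (den v * den z.2)) *: y.1).
  by apply: (scale_via (k := den v * den z.2) e); ring.
by apply: (scale_via (k := den u * den x.2) e'); ring.
Qed.
Canonical loc_equiv_equiv := EquivRelPack loc_equiv_is_equiv.
Canonical loc_equiv_encModRel := defaultEncModRel loc_equiv.

Definition locmod : Type := {eq_quot loc_equiv}.
HB.instance Definition _ := Choice.on locmod.

Definition frac (x : M) (s : denominator) : locmod :=
  \pi_({eq_quot loc_equiv}) (x, s).
Definition numer (z : locmod) : M := (repr (z : {eq_quot loc_equiv})).1.
Definition denom (z : locmod) : denominator :=
  (repr (z : {eq_quot loc_equiv})).2.

Lemma fracK z : frac (numer z) (denom z) = z.
Proof. by rewrite /frac /numer /denom -surjective_pairing; exact: reprK. Qed.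

Lemma frac_eq x s y t : (frac x s = frac y t) <->
  exists u : denominator, den u *: (den t *: x - den s *: y) = 0.
Proof.
rewrite /frac; split=> [/eqP|e]; last apply/eqP.
  by rewrite piE => /asboolP.
by rewrite piE; apply/asboolP.
Qed.

Lemma fracP z : exists x s, z = frac x s.
Proof. by exists (numer z), (denom z); rewrite fracK. Qed.

Definition loc_add (z w : locmod) : locmod :=
  frac (den (denom w) *: numer z + den (denom z) *: numer w)
       (denM (denom z) (denom w)).
Definition loc_opp (z : locmod) : locmod := frac (- numer z) (denom z).
Definition loc_zero : locmod := frac 0 den1.

Lemma loc_addE x s y t : loc_add (frac x s) (frac y t) =
  frac (den t *: x + den s *: y) (denM s t).
Proof.
rewrite /loc_add.
have /frac_eq[u e] := fracK (frac x s); have /frac_eq[v e'] := fracK (frac y t).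
move: (numer (frac x s)) (denom (frac x s)) (numer (frac y t)) (denom (frac y t))
  e e' => x' s' y' t'.
move=> /eqP + /eqP; rewrite !scalerBr !subr_eq0 !scalerA => /eqP e /eqP e'.
apply/frac_eq; exists (denM u v); rewrite !denME; apply/eqP.
rewrite scalerBr !scalerDr !scalerA subr_eq0; apply/eqP; congr (_ + _).
  by apply: (scale_via (k := den v * den t' * den t) e); ring.
by apply: (scale_via (k := den u * den s' * den s) e'); ring.
Qed.

Lemma loc_oppE x s : loc_opp (frac x s) = frac (- x) s.
Proof.
rewrite /loc_opp; have /frac_eq[u e] := fracK (frac x s).
apply/frac_eq; exists u.
by rewrite ![_ *: - _]scalerN -opprD scalerN e oppr0.
Qed.

Fact loc_addA : associative loc_add.
Proof.
move=> z w v; have [x [s ->]] := fracP z; have [y [t ->]] := fracP w.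
have [a [r ->]] := fracP v; rewrite !loc_addE; apply/frac_eq; exists den1.
rewrite !denME scale1r !scalerDr !scalerA; apply/eqP; rewrite subr_eq0; apply/eqP.
by rewrite addrA; congr (_ + _ + _); congr (_ *: _); ring.
Qed.

Fact loc_addC : commutative loc_add.
Proof.
move=> z w; rewrite /loc_add addrC; congr frac; apply: val_inj.
exact: mulrC.
Qed.

Fact loc_add0 : left_id loc_zero loc_add.
Proof.
move=> z; have [x [s ->]] := fracP z; rewrite loc_addE scaler0 add0r scale1r.
by apply/frac_eq; exists den1; rewrite denME mul1r subrr scaler0.
Qed.

Fact loc_addN : left_inverse loc_zero loc_opp loc_add.
Proof.
move=> z; have [x [s ->]] := fracP z; rewrite loc_oppE loc_addE scalerN addNr.
by apply/frac_eq; exists den1; rewrite !scaler0 subrr scaler0.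
Qed.

HB.instance Definition _ :=
  GRing.isZmodule.Build locmod loc_addA loc_addC loc_add0 loc_addN.

Lemma fracD x s y t :
  frac x s + frac y t = frac (den t *: x + den s *: y) (denM s t).
Proof. exact: loc_addE. Qed.
End LocalizedModule.

Section Scale.
Variable M : lmodType R.

Fact loc_scale_subproof (u v s s' t t' a a' : R) (x x' : M) :
  u * (s * a' - s' * a) = 0 -> v *: (t *: x' - t' *: x) = 0 ->
  (u * v) *: ((s * t) *: (a' *: x') - (s' * t') *: (a *: x)) = 0.
Proof.
move=> /eqP + /eqP; rewrite mulrBr !scalerBr !subr_eq0 !scalerA.
move=> /eqP e /eqP e'; apply/eqP; rewrite subr_eq0; apply/eqP.
transitivity ((u * (s * a') * (v * t')) *: x).
  by apply: (scale_via (k := u * (s * a')) e'); ring.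
by rewrite e; congr (_ *: _); ring.
Qed.

(* For M = R^o this is the multiplication of the localized ring. *)
Definition loc_scale (z : locmod R^o) (w : locmod M) : locmod M :=
  frac ((numer z : R) *: numer w) (denM (denom z) (denom w)).

Lemma loc_scaleE (a : R^o) s (x : M) t :
  loc_scale (frac a s) (frac x t) = frac ((a : R) *: x) (denM s t).
Proof.
rewrite /loc_scale.
have /frac_eq[u e] := fracK (frac a s); have /frac_eq[v e'] := fracK (frac x t).
apply/frac_eq; exists (denM u v); rewrite !denME.
exact: loc_scale_subproof e e'.
Qed.

Fact loc_scale1 : left_id (frac (1 : R^o) den1) loc_scale.
Proof.
move=> w; have [x [s ->]] := fracP w; rewrite loc_scaleE scale1r.
by congr frac; apply: val_inj; rewrite /= mul1r.
Qed.

Fact loc_scaleDr : right_distributive loc_scale +%R.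
Proof.
move=> z w v; have [a [r ->]] := fracP z; have [x [s ->]] := fracP w.
have [y [t ->]] := fracP v.
rewrite fracD (loc_scaleE a r x) (loc_scaleE a r y) (loc_scaleE a r) fracD.
apply/frac_eq; exists den1; rewrite scale1r !denME !scalerDr !scalerA.
apply/eqP; rewrite subr_eq0; apply/eqP.
by congr (_ + _); congr (_ *: _); ring.
Qed.

Fact loc_scaleDl v : {morph loc_scale^~ v : a b / a + b}.
Proof.
move=> z w; have [a [r ->]] := fracP z; have [b [s ->]] := fracP w.
have [x [t ->]] := fracP v.
rewrite fracD (loc_scaleE a) (loc_scaleE b) (loc_scaleE _ _ x) fracD.
apply/frac_eq; exists den1; rewrite scale1r !denME !scalerDl !scalerDr !scalerA.
apply/eqP; rewrite subr_eq0; apply/eqP.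
change (den s *: a) with (den s * (a : R)).
change (den r *: b) with (den r * (b : R)).
by congr (_ + _); congr (_ *: _); ring.
Qed.
End Scale.

Fact loc_scaleA (M : lmodType R) a b (w : locmod M) :
  loc_scale a (loc_scale b w) = loc_scale (loc_scale a b) w.
Proof.
have [a' [r ->]] := fracP a; have [b' [s ->]] := fracP b.
have [x [t ->]] := fracP w.
rewrite (loc_scaleE b' s) (loc_scaleE a' r (b' *: x)) (loc_scaleE a' r b').
rewrite (loc_scaleE _ _ x) scalerA; congr frac.
by apply: val_inj; rewrite /= mulrA.
Qed.

Definition locring : Type := locmod R^o.
HB.instance Definition _ := GRing.Zmodule.on locring.

Fact loc_mulA : associative (@loc_scale R^o : locring -> locring -> locring).
Proof. by move=> a b c; exact: loc_scaleA. Qed.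
Fact loc_mulC : commutative (@loc_scale R^o : locring -> locring -> locring).
Proof.
move=> a b; rewrite /loc_scale; congr frac; first exact: mulrC.
by apply: val_inj; exact: mulrC.
Qed.
Fact loc_one_neq0 : (frac (1 : R^o) den1 : locring) != 0.
Proof.
apply/eqP => /frac_eq[u]; rewrite scaler0 subr0 scale1r /GRing.scale /= mulr1.
by move=> u0; move: (valP u); rewrite [val u]u0 idealr0.
Qed.
HB.instance Definition _ := GRing.Zmodule_isComNzRing.Build locring
  loc_mulA loc_mulC (@loc_scale1 R^o)
  (fun a b c => @loc_scaleDl R^o c a b) loc_one_neq0.

HB.instance Definition _ (M : lmodType R) :=
  GRing.Zmodule_isLmodule.Build locring (locmod M)
    (@loc_scaleA M) (@loc_scale1 M) (@loc_scaleDr M) (@loc_scaleDl M).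

End Localization.

(* An alias of M mentioning f, so that the S-module structure can be inferred. *)
Definition restr (S R : comNzRingType) (f : {rmorphism S -> R})
  (M : lmodType R) : Type := M.

Section Restriction.
Variables (S R : comNzRingType) (f : {rmorphism S -> R}).
Local Notation restr := (restr f).
HB.instance Definition _ M := GRing.Zmodule.on (restr M).

Section RestrModule.
Variable M : lmodType R.
Definition restr_scale (a : S) (x : restr M) : restr M := f a *: (x : M).
Fact restr_scaleA a b x :
  restr_scale a (restr_scale b x) = restr_scale (a * b) x.
Proof. by rewrite /restr_scale scalerA rmorphM. Qed.
Fact restr_scale1 : left_id 1 restr_scale.
Proof. by move=> x; rewrite /restr_scale rmorph1 scale1r. Qed.
Fact restr_scaleDr : right_distributive restr_scale +%R.
Proof. by move=> a x y; rewrite /restr_scale scalerDr. Qed.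
Fact restr_scaleDl x : {morph restr_scale^~ x : a b / a + b}.
Proof. by move=> a b; rewrite /restr_scale rmorphD scalerDl. Qed.
HB.instance Definition _ := GRing.Zmodule_isLmodule.Build S (restr M)
  restr_scaleA restr_scale1 restr_scaleDr restr_scaleDl.
End RestrModule.

Section RestrMap.
Variables (M N : lmodType R) (g : {linear M -> N}).
Definition restr_map : restr M -> restr N := g.
Fact restr_map_is_linear : linear restr_map.
Proof. by move=> a x y; exact: (linearP g (f a)). Qed.
HB.instance Definition _ := GRing.isLinear.Build S (restr M) (restr N) _
  restr_map restr_map_is_linear.
End RestrMap.
End Restriction.
Arguments restr_map {S R} f {M N} g.

Section Hom.
Variable R : comNzRingType.

Section HomDef.
Variables U V : lmodType R.
Definition is_linear : {pred (U -> V)} := fun f => `[< linear f >].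
Fact is_linear_closed : submod_closed is_linear.
Proof.
split=> [|b f g /asboolP lf /asboolP lg].
  by apply/asboolP => a x y; rewrite scaler0 addr0.
apply/asboolP => a x y.
rewrite [LHS]/= !fctE lf lg !scalerDr !scalerA [b * a]mulrC.
by rewrite addrACA.
Qed.
HB.instance Definition _ :=
  GRing.isSubmodClosed.Build R (U -> V) is_linear is_linear_closed.
Definition Hom : Type := submod is_linear.
HB.instance Definition _ := GRing.Lmodule.on Hom.
End HomDef.
Arguments is_linear : clear implicits.

Section HomMap.
Variables (U V W : lmodType R) (p : {linear V -> W}).
Fact hom_map_subproof (f : Hom U V) : p \o val f \in is_linear U W.
Proof.
apply/asboolP => a x y; have /asboolP lf := valP f.
by rewrite /= lf linearP.
Qed.
Definition hom_map (f : Hom U V) : Hom U W :=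
  exist (fun h => h \in is_linear U W) _ (hom_map_subproof f).
Fact hom_map_is_linear : linear hom_map.
Proof.
by move=> a f g; apply: val_inj; apply/funext => x; exact: linearP.
Qed.
HB.instance Definition _ :=
  GRing.isLinear.Build R (Hom U V) (Hom U W) _ hom_map hom_map_is_linear.
End HomMap.
Arguments hom_map U {V W} p.

Definition mod_image (U V : lmodType R) (f : {linear U -> V}) : {pred V} :=
  fun y => `[< exists x, f x = y >].
Fact mod_image_closed U V f : submod_closed (@mod_image U V f).
Proof.
split=> [|a _ _ /asboolP[x <-] /asboolP[y <-]]; apply/asboolP.
  by exists 0; rewrite linear0.
by exists (a *: x + y); rewrite linearP.
Qed.
HB.instance Definition _ U V f :=
  GRing.isSubmodClosed.Build R V (@mod_image U V f) (@mod_image_closed U V f).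

Definition coker (U V : lmodType R) (f : {linear U -> V}) : Type :=
  quotmod (mod_image f).
HB.instance Definition _ U V f := GRing.Lmodule.on (@coker U V f).
End Hom.
Arguments is_linear {R} U V.
Arguments Hom {R} U V.
Arguments hom_map {R} U {V W} p.

Section TorsionFree.
Variable D : idomainType.

Section TorsionFreeQuotient.
Variable U : lmodType D.
Definition torsion : {pred U} :=
  fun x => `[< exists2 a : D, a != 0 & a *: x = 0 >].
Fact torsion_closed : submod_closed torsion.
Proof.
split=> [|a x y /asboolP[b b0 bx] /asboolP[d d0 dy]]; apply/asboolP.
  by exists 1; rewrite ?oner_neq0 ?scaler0.
exists (b * d); first by rewrite mulf_neq0.
rewrite scalerDr -[X in _ + X]scalerA dy scaler0 addr0 scalerA.
rewrite (_ : b * d * a = a * d * b); last by ring.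
by rewrite -scalerA bx scaler0.
Qed.
HB.instance Definition _ :=
  GRing.isSubmodClosed.Build D U torsion torsion_closed.
Definition tf : Type := quotmod torsion.
HB.instance Definition _ := GRing.Lmodule.on tf.
End TorsionFreeQuotient.
Arguments torsion U : clear implicits.

Section TorsionFreeMap.
Variables (U V : lmodType D) (f : {linear U -> V}).
Definition tf_map (x : tf U) : tf V := qproj (torsion V) (f (qrepr x)).
Lemma tf_mapE x : tf_map (qproj (torsion U) x) = qproj (torsion V) (f x).
Proof.
apply/qproj_eq; rewrite -linearB.
have /qproj_eq/asboolP[a a0 ax] := qreprK (qproj (torsion U) x).
by apply/asboolP; exists a; rewrite // -linearZ ax linear0.
Qed.
Fact tf_map_is_linear : linear tf_map.
Proof.
move=> a x y; rewrite -[x]qreprK -[y]qreprK.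
rewrite -[a *: _ + _](linearP (qproj (torsion U))) !tf_mapE.
by rewrite !linearP.
Qed.
HB.instance Definition _ :=
  GRing.isLinear.Build D (tf U) (tf V) _ tf_map tf_map_is_linear.
End TorsionFreeMap.
End TorsionFree.
Arguments torsion {D} U.

(* n = max P; lengths and dimensions are suprema of lengths of strict chains,
   a chain of length n having n + 1 terms. *)
Definition max_nat (P : set nat) (n : nat) :=
  P n /\ forall k, P k -> (k <= n)%N.

Section Length.
Variables (R : comNzRingType) (M : lmodType R).

Definition submod_chain (n : nat) :=
  exists N : nat -> submodClosed M, forall i, (i < n)%N ->
    {subset N i <= N i.+1} /\ exists2 x, x \in N i.+1 & x \notin N i.

Definition finite_length := exists n, max_nat submod_chain n.
(* Junk value 0 when the length is infinite. *)
Definition mod_length : nat := xget 0%N (max_nat submod_chain).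

Definition is_basis n (e : 'I_n -> M) :=
  forall x, exists! a : {ffun 'I_n -> R}, x = \sum_i a i *: e i.
(* Junk value 0 when M has no finite basis; over a field this is the dimension
   of a finite-dimensional space. *)
Definition free_rank : nat := xget 0%N [set n | exists e : 'I_n -> M, is_basis e].
End Length.
Arguments finite_length {R} M.
Arguments mod_length {R} M.
Arguments free_rank {R} M.

Section Rings.
Variable R : comNzRingType.

Definition prime_chain (n : nat) :=
  exists p : nat -> prime_idealr R, forall i, (i < n)%N ->
    {subset p i <= p i.+1} /\ exists2 x, x \in p i.+1 & x \notin p i.
Definition krull_dim := max_nat prime_chain.

(* It suffices to consider proper ideals, the unit ideal being generated by 1. *)
Definition noetherian :=
  forall I : idealr R, exists s : seq R, I =i gen_ideal s.

Definition maximal_ideal (m : idealr R) :=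
  forall J : idealr R, {subset m <= J} -> {subset J <= m}.
Definition local_ring (m : idealr R) :=
  maximal_ideal m /\ forall n : idealr R, maximal_ideal n -> n =i m.

Definition adically_complete (I : {pred R}) :=
  (forall x, (forall n, x \in ideal_pow I n) -> x = 0) /\
  (forall u : nat -> R, (forall n, u n.+1 - u n \in ideal_pow I n) ->
     exists l, forall n, u n - l \in ideal_pow I n).

Definition regular_local_ring (d : nat) :=
  exists m : idealr R, [/\ local_ring m, noetherian, krull_dim d &
    exists s : d.-tuple R, m =i gen_ideal s].

Variable M : lmodType R.
Definition regular_seq (s : seq R) :=
  (forall i, (i < size s)%N ->
     forall u : quotmod (ideal_smul (gen_ideal (take i s)) M),
       s`_i *: u = 0 -> u = 0) /\
  exists u : quotmod (ideal_smul (gen_ideal s) M), u != 0.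
(* The depth is the supremum of the lengths of M-regular sequences in I. *)
Definition depth_ge (I : {pred R}) (n : nat) :=
  exists s : seq R, [/\ (n <= size s)%N, {subset s <= I} & regular_seq s].
End Rings.

Section Flat.
Variable R : comNzRingType.

Definition bilinear_map (U V W : lmodType R) (b : U -> V -> W) :=
  (forall u, linear (b u)) /\ (forall v, linear (b^~ v)).

(* T, with t, is a tensor product of U and V: t is the universal bilinear map. *)
Definition is_tensor (U V T : lmodType R) (t : U -> V -> T) :=
  bilinear_map t /\ forall (W : lmodType R) (b : U -> V -> W), bilinear_map b ->
    exists! f : T -> W, linear f /\ forall u v, f (t u v) = b u v.

(* Injectivity of f implies injectivity of f (x) id_M, for any choice T, T' of
   the tensor products U (x) M and V (x) M. *)
Definition flat (M : lmodType R) :=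
  forall (U V T T' : lmodType R) (f : {linear U -> V})
    (t : U -> M -> T) (t' : V -> M -> T') (g : {linear T -> T'}),
    injective f -> is_tensor t -> is_tensor t' ->
    (forall u m, g (t u m) = t' (f u) m) -> injective g.
End Flat.

Section Reduction.
Variables (R : comNzRingType) (I : idealr R) (M : lmodType R).

(* M / I M, as a module over R / I. *)
Definition redmod : Type := quotmod (ideal_smul I M).
HB.instance Definition _ := GRing.Zmodule.on redmod.

Definition red_scale (a : {ideal_quot I}) (u : redmod) : redmod :=
  repr a *: (u : quotmod (ideal_smul I M)).

Lemma red_scaleE (a : R) (u : quotmod (ideal_smul I M)) :
  red_scale (\pi_({ideal_quot I}) a) u = a *: u.
Proof.
rewrite /red_scale -[u]qreprK -!linearZ; apply/qproj_eq; rewrite -scalerBl.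
apply/asboolP; exists 1%N, (fun=> 1),
  (fun=> (repr (\pi_({ideal_quot I}) a) - a) *: qrepr u); split=> [_|].
  exists (repr (\pi_({ideal_quot I}) a) - a); last by exists (qrepr u).
  by rewrite /= Quotient.idealrBE reprK.
by rewrite big_ord1 scale1r.
Qed.

Fact red_scaleA a b u : red_scale a (red_scale b u) = red_scale (a * b) u.
Proof.
rewrite -[a]reprK -[b]reprK -(rmorphM (\pi_({ideal_quot I}))) !red_scaleE.
exact: scalerA.
Qed.
Fact red_scale1 : left_id 1 red_scale.
Proof.
by move=> u; rewrite -(rmorph1 (\pi_({ideal_quot I}))) red_scaleE scale1r.
Qed.
Fact red_scaleDr : right_distributive red_scale +%R.
Proof. by move=> a u v; rewrite /red_scale scalerDr. Qed.
Fact red_scaleDl u : {morph red_scale^~ u : a b / a + b}.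
Proof.
move=> a b; rewrite -[a]reprK -[b]reprK -(raddfD (\pi_({ideal_quot I}))).
by rewrite !red_scaleE scalerDl.
Qed.
HB.instance Definition _ := GRing.Zmodule_isLmodule.Build {ideal_quot I} redmod
  red_scaleA red_scale1 red_scaleDr red_scaleDl.
End Reduction.

Section QuotientAlgebra.
Variables (D : comNzRingType) (R : comAlgType D) (I : idealr R).
Local Notation Q := {ideal_quot I}.

Definition qalg_scale (a : D) (x : Q) : Q := \pi_Q (a *: repr x).

Lemma qalg_scaleE a (x : R) : qalg_scale a (\pi_Q x) = \pi_Q (a *: x).
Proof.
apply/eqP; rewrite -Quotient.idealrBE -scalerBr -mulr_algl idealMr //.
by rewrite Quotient.idealrBE reprK.
Qed.

Fact qalg_scaleA a b x : qalg_scale a (qalg_scale b x) = qalg_scale (a * b) x.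
Proof.
rewrite -[x]reprK; move: (repr x) => y.
by rewrite (qalg_scaleE b) (qalg_scaleE a) (qalg_scaleE (a * b)) scalerA.
Qed.
Fact qalg_scale1 : left_id 1 qalg_scale.
Proof. by move=> x; rewrite -[x]reprK (qalg_scaleE 1) scale1r. Qed.
Fact qalg_scaleDr : right_distributive qalg_scale +%R.
Proof.
move=> a x y; rewrite -[x]reprK -[y]reprK; move: (repr x) (repr y) => u v.
rewrite -(raddfD \pi_Q) (qalg_scaleE a (u + v)).
by rewrite (qalg_scaleE a u) (qalg_scaleE a v) scalerDr (raddfD \pi_Q).
Qed.
Fact qalg_scaleDl x : {morph qalg_scale^~ x : a b / a + b}.
Proof.
move=> a b; rewrite -[x]reprK; move: (repr x) => u.
rewrite (qalg_scaleE (a + b)) (qalg_scaleE a) (qalg_scaleE b).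
by rewrite scalerDl (raddfD \pi_Q).
Qed.
HB.instance Definition _ := GRing.Zmodule_isLmodule.Build D Q
  qalg_scaleA qalg_scale1 qalg_scaleDr qalg_scaleDl.

Fact qalg_scaleAl (a : D) (x y : Q) : a *: (x * y) = a *: x * y.
Proof.
rewrite -[x]reprK -[y]reprK; move: (repr x) (repr y) => u v.
rewrite -(rmorphM \pi_Q) -![a *: _]/(qalg_scale a _).
rewrite (qalg_scaleE a (u * v)) (qalg_scaleE a u).
by rewrite scalerAl (rmorphM \pi_Q).
Qed.
HB.instance Definition _ := GRing.Lmodule_isLalgebra.Build D Q qalg_scaleAl.
HB.instance Definition _ := GRing.Lalgebra_isComAlgebra.Build D Q.
End QuotientAlgebra.

Section Augmented.
Variables (D : idomainType) (A : comAlgType D) (lam : {lrmorphism A -> D | *%R}).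

Definition augker : {pred A} := fun x => lam x == 0.

Fact augker_idealr_closed : idealr_closed augker.
Proof.
split=> [||a x y]; rewrite !unfold_in ?rmorph0 ?rmorph1 ?oner_eq0 //.
by move=> /eqP x0 /eqP y0; rewrite rmorphD rmorphM /= x0 y0 mulr0 addr0.
Qed.
HB.instance Definition _ := isIdealr.Build A augker augker_idealr_closed.
Fact augker_prime_closed : prime_idealr_closed augker.
Proof. by move=> x y; rewrite !unfold_in rmorphM mulf_eq0. Qed.
HB.instance Definition _ :=
  isPrimeIdealrClosed.Build A augker augker_prime_closed.

(* The augmentation ideal p, seen as an A-module; A^o and A need separate
   closedness instances. *)
Definition augker_mod : {pred A^o} := augker.
Fact augker_mod_closed : submod_closed augker_mod.
Proof.
by case: augker_idealr_closed => h0 _ h; split=> // a x y; apply: h.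
Qed.
HB.instance Definition _ :=
  GRing.isSubmodClosed.Build A A^o augker_mod augker_mod_closed.

(* p / p ^ 2, written as N / p N for the module N = p. *)
Definition cotangent : Type := quotmod (ideal_smul augker (submod augker_mod)).
HB.instance Definition _ := GRing.Lmodule.on cotangent.

Variable M : lmodType A.

(* D is an A-module through lam; A-modules are D-modules through in_alg A. *)
Local Notation O_A := (restr lam D^o).
Local Notation quotM := (quotmod (ideal_smul augker M)).

Definition congruence_map :
    tf (restr (in_alg A) (Hom O_A M)) -> tf (restr (in_alg A) (Hom O_A quotM)) :=
  tf_map (U := restr (in_alg A) (Hom O_A M))
         (V := restr (in_alg A) (Hom O_A quotM))
    (restr_map (in_alg A) (hom_map O_A (qproj (ideal_smul augker M)))).
HB.instance Definition _ := GRing.Linear.on congruence_map.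
Definition congruence_module : Type := coker congruence_map.
HB.instance Definition _ := GRing.Lmodule.on congruence_module.

(* Meaningful when cotangent has finite length over D. *)
Definition wiles_defect : int :=
  (free_rank (locmod augker M) * mod_length (restr (in_alg A) cotangent))%:Z
  - (mod_length congruence_module)%:Z.
End Augmented.

Section QuotientAugmentation.
Variables (D : idomainType) (R : comAlgType D) (lam : {lrmorphism R -> D | *%R}).
Variable y : seq R.
Hypothesis y_ker : all (mem (augker lam)) y.

Fact gen_ideal_augker x : x \in gen_ideal y -> lam x = 0.
Proof.
move=> /asboolP[n [a [u [uy ->]]]]; rewrite rmorph_sum big1 //= => i _.
have /eqP u0 : u i \in augker lam by apply: (allP y_ker); exact: uy.
by rewrite /GRing.scale /= rmorphM /= u0 mulr0.
Qed.

Fact gen_ideal_idealr_closed : idealr_closed (gen_ideal y).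
Proof.
have [h0 h] := mod_span_closed (M := R^o) [set` y]; split=> //.
by apply/negP => /gen_ideal_augker; rewrite rmorph1; apply/eqP/oner_neq0.
Qed.
Definition seq_ideal : idealr R :=
  HB.pack (gen_ideal y) (isIdealr.Build R (gen_ideal y) gen_ideal_idealr_closed).

(* The augmentation induced by lam; its kernel is the image of the kernel
   of lam. *)
Definition aug_quot (x : {ideal_quot seq_ideal}) : D := lam (repr x).

Lemma aug_quotE x : aug_quot (\pi_({ideal_quot seq_ideal}) x) = lam x.
Proof.
apply/eqP; rewrite -subr_eq0 -raddfB; apply/eqP/gen_ideal_augker.
by rewrite (Quotient.idealrBE seq_ideal) reprK.
Qed.

Fact aug_quot_is_linear : linear_for *%R aug_quot.
Proof.
move=> a x z; rewrite -[x]reprK -[z]reprK; move: (repr x) (repr z) => u v.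
rewrite -[a *: _]/(qalg_scale a _) qalg_scaleE -(raddfD \pi_({ideal_quot _})).
by rewrite !aug_quotE linearP.
Qed.
HB.instance Definition _ := GRing.isLinear.Build D {ideal_quot seq_ideal} D
  *%R aug_quot aug_quot_is_linear.
Fact aug_quot_is_monoid_morphism : monoid_morphism aug_quot.
Proof.
split=> [|x z]; first by rewrite -(rmorph1 \pi_({ideal_quot _})) aug_quotE rmorph1.
rewrite -[x]reprK -[z]reprK; move: (repr x) (repr z) => u v.
by rewrite -(rmorphM \pi_({ideal_quot _})) !aug_quotE rmorphM.
Qed.
HB.instance Definition _ := GRing.isMonoidMorphism.Build {ideal_quot seq_ideal} D
  aug_quot aug_quot_is_monoid_morphism.
End QuotientAugmentation.
Arguments aug_quot {D R lam y} y_ker x.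
Arguments seq_ideal {D R lam y} y_ker.

Section Padic.

(* Additive valuations; the value at 0 is irrelevant. *)
Definition discrete_valuation (K : fieldType) (v : K -> int) :=
  (forall x y, x != 0 -> y != 0 -> v (x * y) = v x + v y) /\
  (forall x y, x != 0 -> y != 0 -> x + y != 0 ->
     Num.min (v x) (v y) <= v (x + y)).

Definition val_close (K : fieldType) (v : K -> int) (n : int) (x y : K) :=
  x = y \/ n <= v (x - y).

(* (K, v) is the completion of the rationals for the ell-adic valuation. *)
Definition is_Qell (ell : nat) (K : fieldType) (v : K -> int) :=
  [/\ [pchar K] =i pred0,
      discrete_valuation v,
      forall q : rat, q != 0 ->
        v (ratr q) = (logn ell `|numq q|)%:Z - (logn ell `|denq q|)%:Z,
      forall n x, exists q : rat, val_close v n x (ratr q) &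
      forall u : nat -> K,
        (forall n, exists N, forall i j, (N <= i)%N -> (N <= j)%N ->
           val_close v n (u i) (u j)) ->
        exists l, forall n, exists N, forall i, (N <= i)%N ->
          val_close v n (u i) l].

(* O is isomorphic to the valuation ring of a finite extension E of Q_ell, where
   w is the integer-valued multiple, by some e > 0, of the extension of v. *)
Definition padic_integer_ring (ell : nat) (O : idomainType) :=
  exists (K : fieldType) (v : K -> int) (E : fieldExtType K) (w : E -> int)
         (e : nat) (i : {rmorphism O -> E}),
    [/\ is_Qell ell v, discrete_valuation w,
        (0 < e)%N /\ (forall x : K, x != 0 -> w x%:A = v x *+ e),
        injective i &
        forall x : E, (exists a, i a = x) <-> (x = 0 \/ 0 <= w x)].

(* pi generates the maximal ideal. *)
Definition uniformizer (O : idomainType) (pi : O) :=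
  forall x : O, x \isn't a GRing.unit <-> exists y, x = y * pi.
End Padic.

(* Main.v *)
From HB Require Import structures.
Require Import Defs.
From mathcomp Require Import all_boot all_order all_algebra all_field ring_quotient ring zify.
From mathcomp Require Import boolp classical_sets functions.

(** Why the defect does not depend on the sequence.

    Write p for the kernel of lam, L(y) for the submodule of all n in M with
    p n contained in (y) M, and T for the saturation of p M over O. The
    cotangent space of R / (y) is p / (p ^ 2 + (y)), and the congruence module
    of M / (y) M is M / (L(y) + T): a homomorphism from O to a module is an
    element killed by p. So both lengths can be measured between submodules of
    the fixed modules R and M, and the rank is that of M / T over O, for all these y.

    One element at a time. Let (w, f) and (w, g) be two of the sequences. For n
    in L(w, f) there is n' with g n = f n' modulo (w) M, and the regularity of f
    puts n' into L(w, g) (socle_exchange). As (w, f) generates p up to p ^ 2 and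
    up to torsion, some nonzero a and b in O satisfy b g = a f modulo
    p ^ 2 + (w); dividing by f again gives b n' = a n modulo p M. Hence a L(w, f)
    and b L(w, g) agree modulo T, just as a f and b g agree modulo
    p ^ 2 + (w). Computing the colength of these common submodules in two ways,
    the cotangent lengths differ by length (O / b) - length (O / a)
    (cot_length_exchange), and the congruence lengths by the rank times the same
    number (cong_length_exchange). The defect is unchanged. This needs a f to be
    nonzero modulo p ^ 2 + (w), which holds because otherwise (w) and p would
    agree after localization at p, and the regularity of f would give M = p M
    there, that is M = 0 (cot_span_torsion_free).

    Connecting two sequences. The last elements f and f' of two sequences (w, f)
    and (w', f') are both replaced by one element g (common_replacement); then g
    is moved to the front and an induction on the length of the tails applies
    (has_defect_independent). Regular sequences in the maximal ideal may be
    permuted by the lemma of Nakayama. The element g is alpha + beta ^ i for a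
    large i, where alpha and beta are combinations of f and f': modulo p ^ 2
    only alpha matters, and the freedom in i makes g regular, because the
    kernels of the products of these elements form an ascending chain
    (regular_mod_generic).

    Flatness. The quotient M / (y) M is torsion-free because varpi is regular on
    it and every nonzero element of O is a unit times a power of varpi. Over
    such a ring a torsion-free module is the union of free submodules, and a
    relation in a tensor product involves only finitely many elements
    (torsion_free_flat). *)

Set Implicit Arguments.
Unset Strict Implicit.
Unset Printing Implicit Defensive.

Import Order.TTheory GRing.Theory Num.Theory.
Local Open Scope ring_scope.
Local Open Scope classical_set_scope.

(** * Submodules as sets, and the length of an interval of submodules *)

Section Submodules.
Variables (R : comNzRingType) (M : lmodType R).
Implicit Types A B X : set M.

Definition submodule A := A 0 /\ forall a x y, A x -> A y -> A (a *: x + y).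

Lemma submodule0 A : submodule A -> A 0. Proof. by case. Qed.
Lemma submoduleD A x y : submodule A -> A x -> A y -> A (x + y).
Proof. by move=> [_ h] ax ay; rewrite -[x]scale1r; apply: h. Qed.
Lemma submoduleZ A a x : submodule A -> A x -> A (a *: x).
Proof. by move=> [h0 h] ax; rewrite -[_ *: _]addr0; apply: h. Qed.
Lemma submoduleN A x : submodule A -> A x -> A (- x).
Proof. by move=> h ax; rewrite -scaleN1r; apply: submoduleZ. Qed.
Lemma submoduleB A x y : submodule A -> A x -> A y -> A (x - y).
Proof. by move=> h ax ay; apply: submoduleD => //; apply: submoduleN. Qed.
Lemma submodule_sum A I (r : seq I) (P : pred I) (F : I -> M) :
  submodule A -> (forall i, P i -> A (F i)) -> A (\sum_(i <- r | P i) F i).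
Proof.
move=> h hF; elim/big_ind: _ => //; first exact: submodule0.
by move=> x y; apply: submoduleD.
Qed.
Lemma submodule_subl A x y : submodule A -> A (x - y) -> A x -> A y.
Proof.
by move=> h axy ax; rewrite -(subKr x y); apply: submoduleB.
Qed.
Lemma submodule_subr A x y : submodule A -> A (x - y) -> A y -> A x.
Proof. by move=> h axy ay; rewrite -(subrK y x); apply: submoduleD. Qed.

Lemma submodClosed_submodule (N : submodClosed M) : submodule [set` N].
Proof.
split=> [|a x y xN yN] /=; first exact: rpred0.
by rewrite rpredD ?rpredZ.
Qed.

Lemma mod_span_submodule X : submodule [set` mod_span X].
Proof. exact: submodClosed_submodule. Qed.

Lemma mod_span_sub X x : X x -> x \in mod_span X.
Proof.
move=> Xx; apply/asboolP; exists 1%N, (fun=> 1), (fun=> x); split=> //.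
by rewrite big_ord1 scale1r.
Qed.

Lemma mod_span_min X A : submodule A -> X `<=` A ->
  forall x, x \in mod_span X -> A x.
Proof.
move=> hA XA x /asboolP[n [a [u [Xu ->]]]].
by apply: submodule_sum => // i _; apply: submoduleZ => //; apply: XA.
Qed.

Lemma mod_span_id A x : submodule A -> (x \in mod_span A) <-> A x.
Proof. by move=> hA; split; [apply: mod_span_min | apply: mod_span_sub]. Qed.

Definition sumset A B : set M := [set x | exists2 y, A y & B (x - y)].

Lemma sumset_submodule A B : submodule A -> submodule B -> submodule (sumset A B).
Proof.
move=> hA hB; split; first by exists 0; rewrite ?subr0; apply: submodule0.
move=> a x y [x' Ax' Bx] [y' Ay' By]; exists (a *: x' + y').
  by case: hA => _; apply.
by rewrite opprD addrACA -scalerBr; case: hB => _; apply.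
Qed.

Lemma sumsetl A B : submodule B -> A `<=` sumset A B.
Proof. by move=> hB x Ax; exists x => //; rewrite subrr; apply: submodule0. Qed.
Lemma sumsetr A B : submodule A -> B `<=` sumset A B.
Proof. by move=> hA x Bx; exists 0; [apply: submodule0 | rewrite subr0]. Qed.
Lemma sumset_min A B C : submodule C -> A `<=` C -> B `<=` C -> sumset A B `<=` C.
Proof.
by move=> hC AC BC x [y /AC Cy /BC Cxy]; apply: submodule_subr Cxy Cy.
Qed.

Lemma setI_submodule A B : submodule A -> submodule B -> submodule (A `&` B).
Proof.
move=> [A0 hA] [B0 hB]; split=> [|a x y [Ax Bx] [Ay By]]; first by split.
by split; [apply: hA | apply: hB].
Qed.

Lemma setT_submodule : submodule [set: M]. Proof. by []. Qed.
Lemma set0_submodule : submodule [set (0 : M)].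
Proof. by split=> // a x y -> ->; rewrite scaler0 addr0. Qed.

End Submodules.

Section IntervalLength.
Variables (D : comNzRingType) (X : lmodType D).
Implicit Types A B C : set X.

Definition interval_chain A B n := exists N : nat -> set X,
  (forall i, (i <= n)%N -> [/\ submodule (N i), A `<=` N i & N i `<=` B]) /\
  (forall i, (i < n)%N -> N i `<=` N i.+1 /\ exists2 x, N i.+1 x & ~ N i x).

Definition ilength A B n := max_nat (interval_chain A B) n.

Lemma max_nat_unique P n k : max_nat P n -> max_nat P k -> n = k.
Proof.
by move=> [Pn ubn] [Pk ubk]; apply/eqP; rewrite eqn_leq ubn ?ubk.
Qed.

Lemma interval_chain0 A B : submodule A -> A `<=` B -> interval_chain A B 0.
Proof. by move=> hA AB; exists (fun=> A); split=> // i _; split. Qed.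

Lemma interval_chain_widen A B A' B' n : A' `<=` A -> B `<=` B' ->
  interval_chain A B n -> interval_chain A' B' n.
Proof.
move=> AA BB [N [h1 h2]]; exists N; split=> // i /h1[h AN NB].
by split=> //; [apply: subset_trans AN | apply: subset_trans BB].
Qed.

Lemma interval_chain_rcons A B B' n : submodule B' -> A `<=` B ->
  B `<=` B' -> (exists2 x, B' x & ~ B x) ->
  interval_chain A B n -> interval_chain A B' n.+1.
Proof.
move=> hB' AB BB [x B'x Bx] [N [h1 h2]].
exists (fun i => if (i <= n)%N then N i else B'); split=> i.
  move=> _; case: leqP => [/h1[? ? NB]|_]; split=> //.
    exact: subset_trans BB.
  exact: subset_trans BB.
rewrite ltnS => ile; rewrite ile; case: ltnP => [/h2//|nle].
have [_ _ NB] := h1 _ ile; split; first exact: subset_trans BB.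
by exists x => // /NB.
Qed.

(** Only the strict steps of a weakly increasing chain count. *)
Lemma weak_chain A (N : nat -> set X) l :
  (forall i, (i <= l)%N -> submodule (N i) /\ A `<=` N i) ->
  (forall i, (i < l)%N -> N i `<=` N i.+1) ->
  submodule A ->
  interval_chain A (N l) (\sum_(i < l) `[< exists2 x, N i.+1 x & ~ N i x >]).
Proof.
move=> h1 h2 hA; elim: l h1 h2 => [|l IH] h1 h2.
  by rewrite big_ord0; apply: interval_chain0 => //; case: (h1 0%N).
have {}IH := IH (fun i il => h1 i (leqW il)) (fun i il => h2 i (leqW il)).
rewrite big_ord_recr /=; have [hs AN] := h1 _ (leqnn l.+1).
have [_ ANl] := h1 _ (leqnSn l).
case: asboolP => [e|_] /=; rewrite ?addn1 ?addn0.
  by apply: interval_chain_rcons e IH => //; apply: h2.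
by apply: interval_chain_widen IH => //; apply: h2.
Qed.

Lemma interval_chain_cat A B C n k : A `<=` B -> B `<=` C ->
  interval_chain A B n -> interval_chain B C k -> interval_chain A C (n + k).
Proof.
move=> AB BC [N [h1 h2]] [N' [h1' h2']].
exists (fun i => if (i < n)%N then N i else N' (i - n)%N); split=> i.
  move=> ink; case: ltnP => [/ltnW/h1[? ? NB]|ni].
    by split=> //; apply: subset_trans BC.
  have /h1'[? BN NC] : (i - n <= k)%N by rewrite leq_subLR.
  by split=> //; apply: subset_trans BN.
move=> ink; case: (ltnP i n) => [lin|ni].
  have [le1 [x Nx nNx]] := h2 _ lin; case: ltnP => [_|ni]; first by split=> //; exists x.
  have in1 : i.+1 = n by apply/eqP; rewrite eqn_leq lin ni.
  have [_ _ NB] := h1 n (leqnn n); have [_ BN _] := h1' 0%N (leq0n k).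
  rewrite in1 subnn; split.
    by apply: subset_trans le1 _; rewrite in1; apply: subset_trans NB _.
  by exists x => //; apply/BN/NB; rewrite -in1.
by rewrite ltnNge leqW //= subSn //; apply: h2'; rewrite ltn_subLR.
Qed.

(** A step of a chain from A to C is seen in the intersections with B or in the
    sums with B, so a chain is no longer than two chains around B. *)
Lemma ilength_add A B C n k : submodule A -> submodule B -> submodule C ->
  A `<=` B -> B `<=` C -> ilength A B n -> ilength B C k -> ilength A C (n + k).
Proof.
move=> hA hB hC AB BC [cn ubn] [ck ubk]; split; first exact: interval_chain_cat cn ck.
move=> l [N [h1 h2]].
pose NI i := N i `&` B; pose NS i := sumset (N i) B.
have hNI i : (i <= l)%N -> submodule (NI i) /\ A `<=` NI i.
  move=> /h1[hN AN _]; split; first exact: setI_submodule.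
  by move=> x Ax; split; [apply: AN | apply: AB].
have hNS i : (i <= l)%N -> submodule (NS i) /\ B `<=` NS i.
  move=> /h1[hN AN _]; split; first exact: sumset_submodule.
  exact: sumsetr.
have iNI i : (i < l)%N -> NI i `<=` NI i.+1.
  by move=> /h2[NN _] x [Nx Bx]; split=> //; apply: NN.
have iNS i : (i < l)%N -> NS i `<=` NS i.+1.
  by move=> /h2[NN _] x [y /NN Ny By]; exists y.
have /ubn le1 : interval_chain A B (\sum_(i < l) `[< exists2 x, NI i.+1 x & ~ NI i x >]).
  by apply: interval_chain_widen (weak_chain hNI iNI hA) => // x [].
have /ubk le2 : interval_chain B C (\sum_(i < l) `[< exists2 x, NS i.+1 x & ~ NS i x >]).
  apply: interval_chain_widen (weak_chain hNS iNS hB) => //.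
  by have [_ _ NC] := h1 l (leqnn l); apply: sumset_min.
suff le3 : (l <= \sum_(i < l) `[< exists2 x, NI i.+1 x & ~ NI i x >] +
            \sum_(i < l) `[< exists2 x, NS i.+1 x & ~ NS i x >])%N.
  exact: leq_trans le3 (leq_add le1 le2).
rewrite -big_split /= -[X in (X <= _)%N]card_ord -sum1_card leq_sum // => i _.
have [NN [x Nx nNx]] := h2 _ (ltn_ord i).
case: asboolP => [//|nI]; case: asboolP => [//|nS]; case: nS.
(* a step that is invisible modulo B is visible inside B *)
exists x; first exact: sumsetl.
move=> [y Ny Bxy]; case: nI; exists (x - y).
  split=> //; have [hN _ _] := h1 _ (ltn_ord i).
  by apply: submoduleB => //; apply: NN.
have [hN _ _] := h1 _ (ltnW (ltn_ord i)).
by move=> [/(submodule_subr hN)/(_ Ny)].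
Qed.

Lemma ilengthxx A : submodule A -> ilength A A 0.
Proof.
move=> hA; split; first exact: interval_chain0.
move=> [//|k] [N [h1 h2]]; have [_ [x Nx nNx]] := h2 0%N isT.
have [_ _ /(_ _ Nx) Ax] := h1 1%N isT.
by have [_ AN _] := h1 0%N isT; case: nNx; apply: AN.
Qed.

End IntervalLength.

Section IntervalIso.
Variables (D : comNzRingType) (X Y : lmodType D).

(** The correspondence theorem together with the second isomorphism theorem:
    f need only be linear on B, and the hypotheses say that it induces an
    isomorphism from B / A to B' / A'. *)
Lemma interval_chain_iso (A B : set X) (A' B' : set Y) (f : X -> Y) n :
  submodule A -> submodule B -> submodule A' -> submodule B' ->
  A `<=` B -> A' `<=` B' ->
  (forall a x y, B x -> B y -> f (a *: x + y) = a *: f x + f y) ->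
  (forall x, B x -> B' (f x)) ->
  (forall y, B' y -> exists2 x, B x & A' (y - f x)) ->
  (forall x, B x -> A' (f x) <-> A x) ->
  interval_chain A B n <-> interval_chain A' B' n.
Proof.
move=> hA hB hA' hB' AB AB' lf fB fsurj fA.
have B0 : B 0 by apply: submodule0.
have f0 : f 0 = 0.
  by have := lf 1 0 0 B0 B0; rewrite !scale1r addr0 -{1}[f 0]addr0 => /addrI.
have fB2 x y : B x -> B y -> f (x - y) = f x - f y.
  by move=> Bx By; have := lf (-1) y x By Bx; rewrite !scaleN1r ![- _ + _]addrC.
split=> -[N [h1 h2]].
  exists (fun i => [set y | exists2 x, N i x & A' (y - f x)]); split=> i il.
    have [hN AN NB] := h1 _ il; split.
    - split; first by exists 0; rewrite ?f0 ?subr0; apply: submodule0.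
      move=> a x y [x' Nx Ax] [y' Ny Ay]; exists (a *: x' + y').
        by case: hN => _; apply.
      rewrite lf; try exact: NB.
      by rewrite opprD addrACA -scalerBr; case: hA' => _; apply.
    - by move=> y Ay; exists 0; rewrite ?f0 ?subr0 //; apply: submodule0.
    - by move=> y [x /NB/fB Bx /AB' By]; apply: submodule_subr By Bx.
  have [NN [x Nx nNx]] := h2 _ il; split.
    by move=> y [z /NN Nz Ay]; exists z.
  exists (f x); first by exists x; rewrite // subrr; apply: submodule0.
  have [hN AN NB] := h1 _ (ltnW il).
  have [_ _ NB1] := h1 _ il.
  move=> [y Ny]; rewrite -fB2; try by [apply: NB|apply: NB1].
  move=> /fA-/(_ (submoduleB hB (NB1 _ Nx) (NB _ Ny)))/AN.
  by move=> /(submodule_subr hN)/(_ Ny).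
exists (fun i => [set x | B x /\ N i (f x)]); split=> i il.
  have [hN AN NB] := h1 _ il; split.
  - split; first by rewrite /= f0; split=> //; apply: submodule0.
    move=> a x y [Bx Nx] [By Ny]; split; first by case: hB => _; apply.
    by rewrite lf //; case: hN => _; apply.
  - by move=> x Ax; have Bx := AB _ Ax; split=> //; apply/AN/fA.
  - by move=> x [].
have [NN [y Ny nNy]] := h2 _ il; split; first by move=> x [Bx /NN].
have [hN AN NB] := h1 _ (ltnW il).
have [hN1 AN1 NB1] := h1 _ il.
have [x Bx Ayx] := fsurj y (NB1 _ Ny); exists x.
  by split=> //; apply: (submodule_subl hN1 (x := y)) => //; exact: AN1.
by move=> [_ Nx]; apply: nNy; apply: (submodule_subr hN _ Nx); apply: AN.
Qed.

End IntervalIso.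

Section ModuleLength.
Variables (D : comNzRingType) (Q : lmodType D).

Lemma submod_chainE n :
  submod_chain Q n <-> interval_chain [set (0 : Q)] [set: Q] n.
Proof.
split=> -[N].
  move=> h; exists (fun i => [set` N i]); split=> [i _|i /h[NN [x Nx /negP nNx]]].
    split=> //; first exact: submodClosed_submodule.
    by move=> _ ->; rewrite /= rpred0.
  by split; [exact: NN | exists x].
move=> [h1 h2]; exists (fun i => mod_span (N i) : submodClosed Q) => i il.
have [NN [x Nx nNx]] := h2 _ il.
have [h _ _] := h1 _ (ltnW il); have [h' _ _] := h1 _ il.
split; first by move=> y /(mod_span_id _ h)/NN/(mod_span_id _ h').
by exists x; [apply/(mod_span_id _ h') | apply/negP => /(mod_span_id _ h)].
Qed.

Variables (X : lmodType D) (A B : set X) (f : X -> Q).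
Hypotheses (hA : submodule A) (hB : submodule B) (AB : A `<=` B).
Hypothesis f_lin :
  forall a x y, B x -> B y -> f (a *: x + y) = a *: f x + f y.
Hypothesis f_surj : forall q, exists2 x, B x & f x = q.
Hypothesis f_ker : forall x, B x -> f x = 0 <-> A x.

Lemma submod_chain_iso n : submod_chain Q n <-> interval_chain A B n.
Proof.
rewrite submod_chainE; symmetry; apply: (interval_chain_iso (f := f)) => //.
- exact: set0_submodule.
by move=> y _; have [x Bx <-] := f_surj y; exists x; rewrite //= subrr.
Qed.

Lemma mod_length_interval n : ilength A B n -> mod_length Q = n.
Proof.
have e k : max_nat (submod_chain Q) k <-> ilength A B k.
  split=> -[ch ub]; split; try exact/submod_chain_iso.
    by move=> l /submod_chain_iso/ub.
  by move=> l /submod_chain_iso/ub.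
move=> /e h; apply: xget_unique => // k hk; exact: max_nat_unique hk h.
Qed.

End ModuleLength.

Lemma ilength_iso (D : comNzRingType) (X Y : lmodType D)
    (A B : set X) (A' B' : set Y) (f : X -> Y) n :
  submodule A -> submodule B -> submodule A' -> submodule B' ->
  A `<=` B -> A' `<=` B' ->
  (forall a x y, B x -> B y -> f (a *: x + y) = a *: f x + f y) ->
  (forall x, B x -> B' (f x)) ->
  (forall y, B' y -> exists2 x, B x & A' (y - f x)) ->
  (forall x, B x -> A' (f x) <-> A x) ->
  ilength A B n -> ilength A' B' n.
Proof.
move=> hA hB hA' hB' AB AB' h1 h2 h3 h4.
have e k := interval_chain_iso k hA hB hA' hB' AB AB' h1 h2 h3 h4.
by case=> ch ub; split=> [|l]; [exact/e | move/e/ub].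
Qed.

(** * Noetherian modules and the determinant trick *)

Section FinitelyGenerated.
Variables (R : comNzRingType) (M : lmodType R).
Implicit Types (A B : set M) (s : seq M).

Definition fg_subset B :=
  exists s : seq M, (forall x, x \in s -> B x) /\
                    (forall x, B x -> x \in mod_span [set` s]).

Lemma mod_span_cons y s x : x \in mod_span ([set` y :: s] : set M) ->
  exists a, x - a *: y \in mod_span ([set` s] : set M).
Proof.
move: x; apply: mod_span_min => [|x].
  split=> [|a x z [b hb] [b' hb']]; first by exists 0; rewrite scale0r subr0 rpred0.
  exists (a * b + b'); rewrite scalerDl opprD addrACA -scalerA -scalerBr.
  by rewrite rpredD ?rpredZ.
rewrite /= inE => /orP[/eqP->|xs]; first by exists 1; rewrite scale1r subrr rpred0.
by exists 0; rewrite scale0r subr0; apply: mod_span_sub.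
Qed.

Lemma mod_span_seqP s x : x \in mod_span [set` s] ->
  exists a : 'I_(size s) -> R, x = \sum_i a i *: s`_i.
Proof.
move: x; apply: mod_span_min => [|x /= xs].
  split=> [|a x z [b ->] [b' ->]].
    by exists (fun=> 0); rewrite big1 // => i _; rewrite scale0r.
  exists (fun i => a * b i + b' i); rewrite scaler_sumr -big_split.
  by apply: eq_bigr => i _; rewrite scalerDl scalerA.
have xi : (index x s < size s)%N by rewrite index_mem.
exists (fun i => (i == Ordinal xi)%:R).
rewrite (bigD1 (Ordinal xi)) //= eqxx scale1r nth_index // big1 ?addr0 // => i.
by move=> /negPf->; rewrite scale0r.
Qed.

End FinitelyGenerated.

Section Noetherian.
Variable R : comNzRingType.
Hypothesis noethR : noetherian R.

Lemma submodule_idealr (I : set R^o) : submodule I -> ~ I 1 ->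
  exists J : idealr R, forall x, x \in J <-> I x.
Proof.
move=> hI I1.
have cl : idealr_closed (mod_span I : {pred R}).
  split; [exact: rpred0 | by apply/negP => /(mod_span_id _ hI) |].
  by have [_] := mod_span_closed I.
pose J : idealr R :=
  HB.pack (mod_span I : {pred R}) (isIdealr.Build R (mod_span I : {pred R}) cl).
by exists J => x; apply: mod_span_id.
Qed.

Lemma noetherian_submodule (I : set R^o) : submodule I ->
  exists s : seq R, forall x, I x <-> x \in gen_ideal s.
Proof.
move=> hI; have [I1|I1] := pselect (I 1).
  exists [:: 1] => x; split=> [_|_].
    rewrite -[x]mulr1; apply: rpredZ; apply: mod_span_sub.
    by rewrite /= inE.
  by rewrite -[x]mulr1; apply: (submoduleZ x hI I1).
have [J hJ] := submodule_idealr hI I1; have [s hs] := noethR J.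
by exists s => x; rewrite -hs; symmetry; apply: hJ.
Qed.

Section Modules.
Variable M : lmodType R.

(** Hilbert's argument: the leading coefficients along the first generator form
    an ideal. *)
Lemma fg_subset_span (s : seq M) (B : set M) : submodule B ->
  (forall x, B x -> x \in mod_span [set` s]) -> fg_subset B.
Proof.
elim: s B => [|y s IH] B hB Bs; first by exists [::]; split.
pose I : set R^o := [set a | exists2 n, n \in mod_span [set` s] & B (a *: y + n)].
have hI : submodule I.
  split; first by exists 0; rewrite ?rpred0 // scale0r addr0; apply: submodule0.
  move=> a b c [n ns Bn] [k ks Bk]; exists (a *: n + k).
    by rewrite rpredD ?rpredZ.
  rewrite scalerDl -[(a *: b) *: y]scalerA addrACA -scalerDr.
  by case: hB => _; apply.
have [l hl] := noetherian_submodule hI.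
have [nf hnf] : exists nf : R -> M, forall a, I a ->
    nf a \in mod_span [set` s] /\ B (a *: y + nf a).
  have /choice[nf h] : forall a, exists n, I a ->
      n \in mod_span [set` s] /\ B (a *: y + n).
    move=> a; have [[n ns Bn]|nI] := pselect (I a); first by exists n.
    by exists 0.
  by exists nf.
have [l' [l'B hl']] : fg_subset (B `&` [set` mod_span [set` s]]).
  apply: IH => [|x []//]; apply: setI_submodule => //.
  exact: mod_span_submodule.
exists ([seq a *: y + nf a | a <- l] ++ l'); split=> [x|x Bx].
  rewrite mem_cat => /orP[/mapP[a al ->]|/l'B[]//].
  by have /hl/hnf[] : a \in gen_ideal l by apply: mod_span_sub.
pose S := mod_span [set` [seq a *: y + nf a | a <- l] ++ l'].
have lS z : z \in l' -> z \in S.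
  by move=> zl; apply: mod_span_sub; rewrite /= mem_cat zl orbT.
have l'S z : z \in mod_span [set` l'] -> z \in S.
  by move: z; apply: mod_span_min => //; apply: submodClosed_submodule.
have step (a : R) : a \in gen_ideal l ->
    exists z, [/\ z \in S, B z & z - a *: y \in mod_span [set` s]].
  move: a; apply: (@mod_span_min _ R^o) => [|a al].
    split; first by exists 0; rewrite scale0r subr0 !rpred0; split=> //; apply: submodule0.
    move=> a b c [z [zS Bz zs]] [z' [z'S Bz' zs']]; exists (a *: z + z'); split.
    - by rewrite rpredD ?rpredZ.
    - by case: hB => _; apply.
    - rewrite scalerDl -[(a *: b) *: y]scalerA opprD addrACA -scalerBr.
      by rewrite rpredD ?rpredZ.
  have [ns Bn] : nf a \in mod_span [set` s] /\ B (a *: y + nf a).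
    by apply: hnf; apply/hl; apply: mod_span_sub.
  exists (a *: y + nf a); split=> //; last by rewrite addrC addKr.
  by apply: mod_span_sub; rewrite /= mem_cat (map_f (fun a => a *: y + nf a)).
have [a xay] := mod_span_cons (Bs _ Bx).
have /hl/step[z [zS Bz zay]] : I a.
  exists (x - a *: y) => //; by rewrite addrC subrK.
rewrite -(subrK z x) rpredD //; apply: l'S; apply: hl'; split.
  exact: submoduleB.
rewrite /= (_ : x - z = (x - a *: y) - (z - a *: y)); last first.
  by rewrite opprB addrA subrK.
by rewrite rpredD // -scaleN1r rpredZ.
Qed.

Hypothesis fgM : finitely_generated M.

Lemma fg_submodule (B : set M) : submodule B -> fg_subset B.
Proof. by have [s hs] := fgM; move=> hB; apply: (@fg_subset_span s). Qed.

Lemma ascending_chain (S : nat -> set M) : (forall n, submodule (S n)) ->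
  (forall n, S n `<=` S n.+1) -> exists n0, forall n, S n `<=` S n0.
Proof.
move=> hS SS.
have mono i j : (i <= j)%N -> S i `<=` S j.
  move=> /subnK<-; elim: (j - i)%N => [//|k IH] x /IH; exact: SS.
have hU : submodule [set x | exists n, S n x].
  split; first by exists 0%N; apply: submodule0.
  move=> a x y [n Sn] [k Sk]; exists (maxn n k); case: (hS (maxn n k)) => _; apply.
    exact: mono (leq_maxl _ _) _ Sn.
  exact: mono (leq_maxr _ _) _ Sk.
have [s [sU Us]] := fg_submodule hU.
have [n0 hn0] : exists n0, forall x, x \in s -> S n0 x.
  elim: s sU {Us} => [|y s IH] sU; first by exists 0%N.
  have [|n1 h1] := IH; first by move=> x xs; apply: sU; rewrite inE xs orbT.
  have [n2 h2] := sU y (mem_head _ _); exists (maxn n1 n2) => x.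
  rewrite inE => /orP[/eqP->|/h1]; first exact: mono (leq_maxr _ _) _ h2.
  exact: mono (leq_maxl _ _) _.
exists n0 => n x Sx; have /Us : exists n, S n x by exists n.
exact: mod_span_min.
Qed.
End Modules.

Lemma finitely_generated_regular : finitely_generated (R^o : lmodType R).
Proof.
exists [:: 1] => x; rewrite -[x]mulr1.
have h := mod_span_submodule (M := R^o) [set` [:: 1]].
by apply: (submoduleZ x h); apply: mod_span_sub; rewrite /= inE.
Qed.

(** Otherwise the multiples of s would form a proper ideal, which lies in a
    maximal ideal because ascending chains of ideals stop. *)
Lemma notin_local_unit (m : idealr R) (s : R) :
  local_ring m -> s \notin m -> exists t, t * s = 1.
Proof.
move=> [mmax muniq] sm; apply: contrapT => nt.
pose I0 : set R^o := [set x | exists t, x = t * s].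
have hI0 : submodule I0.
  split=> [|a x y [t ->] [t' ->]]; first by exists 0; rewrite mul0r.
  by exists (a * t + t'); rewrite [RHS]mulrDl -[(a * t) * s]mulrA.
have [J0 hJ0] : exists J : idealr R, forall x, x \in J <-> I0 x.
  by apply: submodule_idealr => // -[t e]; apply: nt; exists t.
have sJ0 : s \in J0 by apply/hJ0; exists 1; rewrite mul1r.
have [F hF] : exists F : idealr R -> idealr R, forall J : idealr R, s \in J ->
   {subset J <= F J} /\ ~ {subset F J <= J}.
  suff /choice[F h] : forall J : idealr R, exists J' : idealr R, s \in J ->
    {subset J <= J'} /\ ~ {subset J' <= J} by exists F.
  move=> J; apply: contrapT => nJ.
  have Jmax : maximal_ideal J.
    move=> K JK; apply: contrapT => nKJ; apply: nJ; by exists K.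
  have [sJ|sJ] := boolP (s \in J); last by apply: nJ; exists J => sJ'; rewrite sJ' in sJ.
  by move: sm; rewrite -(muniq _ Jmax) sJ.
pose S n : set R^o := [set` iter n F J0].
have sS n : s \in iter n F J0.
  by elim: n => [//|n IH] /=; have [h _] := hF _ IH; apply: h.
have [n0 hn0] : exists n0, forall n, S n `<=` S n0.
  apply: ascending_chain; first exact: finitely_generated_regular.
    move=> n; split; first exact: (idealr0 (iter n F J0)).
    move=> a x y; rewrite /S /= => xI yI.
    by apply: rpredD => //; apply: idealMr.
  by move=> n x Sx; have [h _] := hF _ (sS n); apply: h.
by have [_] := hF _ (sS n0); apply => x; apply: (hn0 n0.+1).
Qed.

End Noetherian.

Section Determinant.
Variables (R : comNzRingType) (M : lmodType R).

Lemma det_trick k (b : 'I_k -> M) (Q : 'M[R]_k) (A : set M) : submodule A ->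
  (forall i, A (\sum_j Q i j *: b j)) -> forall j, A (\det Q *: b j).
Proof.
move=> hA hQ j.
have -> : \det Q *: b j = \sum_i (\adj Q) j i *: \sum_l Q i l *: b l.
  transitivity (\sum_l (\adj Q *m Q) j l *: b l).
    rewrite mul_adj_mx (bigD1 j) //= !mxE eqxx big1 ?addr0 // => l /negPf lj.
    by rewrite !mxE eq_sym lj scale0r.
  under [RHS]eq_bigr do rewrite scaler_sumr.
  rewrite exchange_big /=; apply: eq_bigr => l _; rewrite mxE scaler_suml.
  by apply: eq_bigr => i _; rewrite scalerA.
by apply: submodule_sum => // i _; apply: submoduleZ.
Qed.

Variables (S : comNzRingType) (phi : {rmorphism R -> S}).

(** This is A + J B for the ideal J = ker phi. *)
Definition add_kermul (A B : set M) : set M :=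
  [set x | x \in mod_span (A `|` [set j *: x | j in [set j | phi j = 0] & x in B])].

(** Nakayama's lemma: the matrix of a on generators of B, minus its part in
    J = ker phi, has a determinant that phi sends to a power of phi a. With phi
    the augmentation and phi a nonzero, s is a denominator outside p; with phi
    the projection onto the residue field of a local ring and a = 1, s is a
    unit. *)
Lemma nakayama_det (A B : set M) (a : R) : submodule A -> fg_subset B ->
  (forall x, B x -> add_kermul A B (a *: x)) ->
  exists k s, phi s = phi a ^+ k /\ forall x, B x -> A (s *: x).
Proof.
move=> hA [l [lB Bl]] h; pose b (i : 'I_(size l)) := l`_i.
have bB i : B (b i) by apply: lB; rewrite mem_nth.
have Z x : add_kermul A B x -> exists q : 'I_(size l) -> R,
    (forall j, phi (q j) = 0) /\ A (x - \sum_j q j *: b j).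
  move: x; apply: mod_span_min => [|x [Ax|[j phij [y By <-]]]].
  - split.
      exists (fun=> 0); split=> [j|]; first by rewrite rmorph0.
      by rewrite big1 ?subr0 => [|j _]; rewrite ?scale0r //; apply: submodule0.
    move=> c x y [q [q0 Aq]] [q' [q'0 Aq']]; exists (fun i => c * q i + q' i).
    split=> [j|]; first by rewrite rmorphD rmorphM /= q0 q'0 mulr0 addr0.
    suff -> : c *: x + y - \sum_j (c * q j + q' j) *: b j =
      c *: (x - \sum_j q j *: b j) + (y - \sum_j q' j *: b j).
      by case: hA => _; apply.
    rewrite scalerBr addrACA -opprD scaler_sumr -big_split /=.
    by under eq_bigr do rewrite scalerDl -scalerA.
  - exists (fun=> 0); split=> [j|]; first by rewrite rmorph0.
    by rewrite big1 ?subr0 => [|j _] //; rewrite scale0r.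
  - have [c ->] := mod_span_seqP (Bl _ By); exists (fun i => j * c i).
    split=> [i|]; first by rewrite rmorphM phij mul0r.
    rewrite scaler_sumr -sumrB big1 => [|i _]; first exact: submodule0.
    by rewrite scalerA subrr.
have [q hq] := choice (fun i => Z _ (h _ (bB i))).
pose Q := a%:M - \matrix_(i, j) q i j.
have AQ i : A (\sum_j Q i j *: b j).
  have [_] := hq i; congr A; under [RHS]eq_bigr do rewrite !mxE scalerBl.
  rewrite sumrB; congr (_ - _); rewrite (bigD1 i) //= eqxx big1 ?addr0 // => j.
  by rewrite eq_sym => /negPf->; rewrite scale0r.
exists (size l), (\det Q); split.
  rewrite -det_map_mx -det_scalar; congr (\det _); apply/matrixP => i j.
  rewrite !mxE rmorphB; have [-> _] := hq i; rewrite subr0.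
  by case: (i == j); rewrite ?mulr1n ?mulr0n ?rmorph0.
move=> x /Bl; move: x; apply: (mod_span_min (A := [set x | A (\det Q *: x)])) => [|y yl].
  split=> [|c y z Ay Az] /=; first by rewrite scaler0; apply: submodule0.
  rewrite scalerDr scalerA mulrC -scalerA; by case: hA => _; apply.
have yi : (index y l < size l)%N by rewrite index_mem.
by have := det_trick hA AQ (Ordinal yi); rewrite /b /= nth_index.
Qed.
End Determinant.

(** * Regular sequences over a noetherian local ring *)

Lemma qproj0P (R : comNzRingType) (M : lmodType R) (N : submodClosed M) (x : M) :
  qproj N x = 0 <-> x \in N.
Proof. by rewrite -(linear0 (qproj N)) qproj_eq subr0. Qed.

Lemma qprojZ (R : comNzRingType) (M : lmodType R) (N : submodClosed M) a (x : M) :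
  qproj N (a *: x) = a *: qproj N x.
Proof. exact: linearZ. Qed.

Lemma qprojB (R : comNzRingType) (M : lmodType R) (N : submodClosed M) (x y : M) :
  qproj N (x - y) = qproj N x - qproj N y.
Proof. exact: linearB. Qed.

Section RegularSequences.
Variables (R : comNzRingType) (M : lmodType R).
Implicit Types (A B : set M) (s t : seq R).

Definition smul s : set M := [set x | x \in ideal_smul (gen_ideal s) M].

Lemma smul_submodule s : submodule (smul s).
Proof. exact: submodClosed_submodule. Qed.

Lemma smul_mem s a n : a \in s -> smul s (a *: n).
Proof.
move=> sa; apply: mod_span_sub; exists a; last by exists n.
exact: mod_span_sub.
Qed.

Lemma smul_min s B : submodule B -> (forall a n, a \in s -> B (a *: n)) ->
  smul s `<=` B.
Proof.
move=> hB h; apply: mod_span_min => // _ [a + [n _ <-]]; rewrite /=.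
move: a; apply: (@mod_span_min R R^o) => [|a sa]; last exact: h.
split; first by rewrite scale0r; apply: submodule0.
move=> a b c Bb Bc; rewrite scalerDl -[(a *: b) *: n]scalerA.
by case: hB => _; apply.
Qed.

Lemma smul_sub s t : {subset s <= t} -> smul s `<=` smul t.
Proof.
by move=> st; apply: smul_min => [|a n /st]; [apply: smul_submodule | apply: smul_mem].
Qed.

Lemma eq_smul s t : s =i t -> smul s = smul t.
Proof.
by move=> st; rewrite eqEsubset; split; apply: smul_sub => x; rewrite st.
Qed.

Lemma smul_nil x : smul [::] x -> x = 0.
Proof. by move: x; apply: smul_min => //; apply: set0_submodule. Qed.

Lemma smul_rcons s a x : smul (rcons s a) x <-> exists n, smul s (x - a *: n).
Proof.
split=> [|[n h]].
  move: x; apply: smul_min => [|b n].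
    split; first by exists 0; rewrite scaler0 subr0; apply: (submodule0 (smul_submodule s)).
    move=> c x y [n hn] [k hk]; exists (c *: n + k).
    rewrite scalerDr scalerA mulrC -scalerA opprD addrACA -scalerBr.
    by have [_] := smul_submodule s; apply.
  rewrite mem_rcons inE => /orP[/eqP->|bs].
    by exists n; rewrite subrr; apply: (submodule0 (smul_submodule s)).
  by exists 0; rewrite scaler0 subr0; apply: smul_mem.
have hs := smul_submodule (rcons s a).
apply: (submodule_subr hs (y := a *: n)); last by apply: smul_mem; rewrite mem_rcons mem_head.
by apply: smul_sub h => b bs; rewrite mem_rcons inE bs orbT.
Qed.

Definition regular_mod A a := forall n, A (a *: n) -> A n.

(** The argument pre holds the elements that have already been divided out. *)
Fixpoint weakly_regular (pre s : seq R) : Prop :=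
  if s is a :: s' then
    regular_mod (smul pre) a /\ weakly_regular (rcons pre a) s'
  else True.

Lemma regular_seq_weakly s : regular_seq M s -> weakly_regular [::] s.
Proof.
move=> [h _].
have {h} : forall i, (i < size s)%N -> regular_mod (smul ([::] ++ take i s)) s`_i.
  move=> i /h hi n hn; apply/qproj0P; apply: hi.
  by rewrite -linearZ; apply/qproj0P.
elim: s [::] => [//|a s IH] pre h; split; first by have := h 0%N isT; rewrite take0 cats0.
apply: IH => i il; have := h i.+1 il; by rewrite /= cat_rcons.
Qed.

Lemma eq_weakly_regular pre pre' s : pre =i pre' ->
  weakly_regular pre s -> weakly_regular pre' s.
Proof.
elim: s pre pre' => [//|a s IH] pre pre' e /= [h1 h2]; split.
  by rewrite -(eq_smul e).
by apply: IH h2 => x; rewrite !mem_rcons !inE e.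
Qed.

Lemma weakly_regular_cat pre s t : weakly_regular pre (s ++ t) <->
  weakly_regular pre s /\ weakly_regular (pre ++ s) t.
Proof.
elim: s pre => [|a s IH] pre /=; first by rewrite cats0; split=> [|[]].
by rewrite IH cat_rcons; split=> [[? []]|[[]]].
Qed.

Section Local.
Variable m : idealr R.
Hypotheses (R_local : local_ring m) (R_noeth : noetherian R).
Hypothesis M_fg : finitely_generated M.

Lemma one_plus_local_unit (s : R) : s - 1 \in m -> exists r, r * s = 1.
Proof.
move=> s1; apply: (notin_local_unit R_noeth R_local); apply/negP => sm.
have : s - (s - 1) \in m by rewrite rpredB.
by rewrite subKr idealr1.
Qed.

Lemma nakayama_local A K a : submodule A -> submodule K -> a \in m ->
  (forall x, K x -> exists2 y, K y & A (x - a *: y)) -> K `<=` A.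
Proof.
move=> hA hK am h x Kx.
pose phi : {rmorphism R -> {ideal_quot m}} := \pi_({ideal_quot m})%qT.
have phi0 j : j \in m -> phi j = 0.
  move=> jm; rewrite -(rmorph0 phi); apply/eqP.
  by rewrite -Quotient.idealrBE subr0.
have [k [s [es As]]] : exists k (r : R), phi r = phi 1 ^+ k /\ forall x, K x -> A (r *: x).
  apply: nakayama_det => //; first exact: fg_submodule.
  move=> y Ky; rewrite scale1r; have [z Kz Az] := h _ Ky.
  have hS := mod_span_submodule (A `|` [set j *: x | j in [set j | phi j = 0] & x in K]).
  apply: (submodule_subr hS (y := a *: z)); apply: mod_span_sub; first by left.
  by right; exists a; [exact: phi0 | exists z].
have [t ts] : exists r, r * s = 1.
  apply: one_plus_local_unit; rewrite Quotient.idealrBE; apply/eqP.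
  by rewrite [LHS]es rmorph1 expr1n -(rmorph1 phi).
by rewrite -[x]scale1r -ts -scalerA; apply: submoduleZ => //; apply: As.
Qed.

(** The kernel K of b on M / (pre) M satisfies K = a K, hence vanishes by
    Nakayama. *)
Lemma regular_swap pre a b : a \in m ->
  regular_mod (smul pre) a -> regular_mod (smul (rcons pre a)) b ->
  regular_mod (smul pre) b /\ regular_mod (smul (rcons pre b)) a.
Proof.
move=> am ra rb; have hp := smul_submodule pre.
have rb' : regular_mod (smul pre) b.
  apply: (nakayama_local (K := [set n | smul pre (b *: n)]) (a := a)) => //.
    split=> [|c x y /= bx b_y]; first by rewrite /= scaler0; apply: submodule0.
    by rewrite scalerDr scalerA mulrC -scalerA; case: hp => _; apply.
  move=> x /= bx; have /rb/smul_rcons[n xan] : smul (rcons pre a) (b *: x).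
    by apply: smul_sub bx => c cs; rewrite mem_rcons inE cs orbT.
  exists n => //; apply: ra; rewrite scalerA mulrC -scalerA.
  apply: (submodule_subl hp (x := b *: x)) => //.
  by rewrite -scalerBr; apply: submoduleZ.
split=> // n /smul_rcons[k h].
have /rb/smul_rcons[k' h'] : smul (rcons pre a) (b *: k).
  apply/smul_rcons; exists n; rewrite -opprB; exact: submoduleN.
apply/smul_rcons; exists k'; apply: ra; rewrite scalerBr.
have -> : a *: n - a *: (b *: k') = (a *: n - b *: k) + b *: (k - a *: k').
  by rewrite scalerBr addrA subrK !scalerA mulrC.
by apply: submoduleD => //; apply: submoduleZ.
Qed.

Lemma weakly_regular_move pre s z t : (forall a, a \in s -> a \in m) ->
  weakly_regular pre (s ++ z :: t) -> weakly_regular pre (z :: s ++ t).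
Proof.
elim: s pre => [//|a s IH] pre sm /= [ra].
move=> /IH[b bs|rz h]; first by apply: sm; rewrite inE bs orbT.
have [|rz' ra'] := regular_swap _ ra rz; first by apply: sm; rewrite mem_head.
split=> //; split=> //; apply: eq_weakly_regular h => x.
by rewrite !(mem_rcons, inE) orbCA.
Qed.

(** Instead of prime avoidance: put w n = alpha + beta ^+ n.+1. On an element
    of M / A killed by w n, each w j with j < n acts as a unit times a power of
    beta. So a nonzero kernel of w n is not contained in the kernel of the
    product of the earlier w j, and the kernels of these products would keep
    growing. *)
Lemma regular_mod_generic A alpha beta : submodule A -> beta \in m ->
  (forall x, A (alpha *: x) -> A (beta *: x) -> A x) ->
  exists n0, forall n, (n0 <= n)%N -> regular_mod A (alpha + beta ^+ n.+1).
Proof.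
move=> hA bm H; pose w i := alpha + beta ^+ i.+1.
(* beta is nilpotent on no element killed by w n, for such an element would
   be killed by alpha as well *)
have Apow n N y : A (w n *: y) -> A (beta ^+ N *: y) -> A y.
  elim: N y => [|N IH] y Aw; first by rewrite expr0 scale1r.
  rewrite exprSr -scalerA => /IH Ab.
  have {}Ab : A (beta *: y).
    by apply: Ab; rewrite scalerA mulrC -scalerA; apply: submoduleZ.
  apply: H => //; apply: (submodule_subr hA (y := - (beta ^+ n *: (beta *: y)))).
    by rewrite opprK scalerA -exprSr -scalerDl.
  by apply: submoduleN => //; apply: submoduleZ.
have AZ a x : A x -> A (a *: x) by apply: submoduleZ.
have [n0 hn0] : exists n0, forall n,
    [set x | A ((\prod_(i < n) w i) *: x)] `<=` [set x | A ((\prod_(i < n0) w i) *: x)].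
  apply: (ascending_chain R_noeth M_fg) => n.
    split=> [|c x y /= Ax Ay]; first by rewrite /= scaler0; apply: submodule0.
    by rewrite scalerDr scalerA mulrC -scalerA; case: hA => _; apply.
  by move=> x /= Ax; rewrite big_ord_recr /= mulrC -scalerA; apply: AZ.
exists n0 => n n0n x Awx.
have : A ((\prod_(i < n0) w i) *: x).
  by apply: (hn0 n.+1); rewrite /= big_ord_recr /= -scalerA; apply: AZ.
elim: {hn0} n0 n0n => [|j IH] jn; first by rewrite big_ord0 scale1r.
rewrite big_ord_recr /= mulrC -scalerA => Awj; apply: IH; first exact: ltnW.
pose y := (\prod_(i < j) w i) *: x; rewrite -/y in Awj *.
have Awn : A (w n *: y) by rewrite scalerA mulrC -scalerA; apply: AZ.
clearbody y.
apply: (Apow n j.+1) => //.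
have [t ht] : exists r, r * (1 - beta ^+ (n - j)) = 1.
  apply: one_plus_local_unit; rewrite addrC addKr rpredN.
  by rewrite -(@prednK (n - j)) ?subn_gt0 // exprSr idealMr.
have -> : beta ^+ j.+1 *: y = t *: (w j *: y - w n *: y).
  rewrite -scalerBl scalerA; congr (_ *: _).
  have en : beta ^+ n.+1 = beta ^+ (n - j) * beta ^+ j.+1.
    by rewrite -exprD addnS subnK // ltnW.
  transitivity ((t * (1 - beta ^+ (n - j))) * beta ^+ j.+1); first by rewrite ht mul1r.
  by rewrite /w en; ring.
by apply: AZ; apply: submoduleB.
Qed.

End Local.
End RegularSequences.
Arguments smul {R} M s.
Arguments weakly_regular {R} M pre s.

(** The valuation w of the field of fractions is nonnegative on O and vanishes
    exactly on the units, so dividing by varpi lowers it; varpi is nonzero since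
    ell is a nonzero non-unit. *)
Lemma padic_integer_ring_dvr ell (O : idomainType) (varpi : O) :
  prime ell -> padic_integer_ring ell O -> uniformizer varpi ->
  varpi != 0 /\ forall a : O, a != 0 ->
    exists k u, u \is a GRing.unit /\ a = u * varpi ^+ k.
Proof.
move=> ell_prime [K [v [E [w [e [i [[char0 _ vrat _ _] [wM _] [e0 wA] iinj iO]]]]]]] unif.
have i0 a : a != 0 -> i a != 0 by rewrite -(inj_eq iinj) rmorph0.
have w1 : w 1 = 0.
  by have := wM 1 1 (oner_neq0 _) (oner_neq0 _); rewrite mulr1 -{1}[w 1]addr0 => /addrI.
have w_ge0 a : a != 0 -> 0 <= w (i a).
  by move=> /i0 /negPf a0; have [/(_ (ex_intro _ a erefl))[/eqP|//]] := iO (i a); rewrite a0.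
have w_unit a : a \is a GRing.unit -> w (i a) = 0.
  move=> ua; have a0 : a != 0 by apply: contraTneq ua => ->; rewrite unitr0.
  have b0 : a^-1 != 0 by rewrite invr_eq0.
  have := wM _ _ (i0 _ a0) (i0 _ b0); rewrite -rmorphM divrr // rmorph1 w1.
  have := w_ge0 _ a0; have := w_ge0 _ b0; lia.
have unit_w a : a != 0 -> w (i a) = 0 -> a \is a GRing.unit.
  move=> a0 wa; have ia0 := i0 _ a0; have iv0 : (i a)^-1 != 0 by rewrite invr_eq0.
  have := wM _ _ ia0 iv0; rewrite divff // w1 wa add0r => wv.
  have [_ /(_ (or_intror _))[|b ib]] := iO (i a)^-1; first by rewrite -wv.
  by apply/unitrP; exists b; split; apply: iinj; rewrite rmorphM ib rmorph1 ?mulVf ?divff.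
have varpiN : varpi \isn't a GRing.unit by apply/unif; exists 1; rewrite mul1r.
have varpi0 : varpi != 0.
  apply/eqP => v0.
  have ellK : (ell%:R : K) != 0.
    have := char0 ell; rewrite [X in X = _](_ : _ = (ell%:R == 0 :> K)) => [->//|].
    by rewrite inE ell_prime.
  have ellO : (ell%:R : O) != 0.
    apply/eqP => /(congr1 i); rewrite rmorph0 rmorph_nat => /eqP.
    by rewrite -scaler_nat scaler_eq0 oner_eq0 orbF; apply/negP.
  have nu : (ell%:R : O) \isn't a GRing.unit.
    apply/negP => /w_unit; rewrite rmorph_nat -scaler_nat wA //.
    have := vrat ell%:R; rewrite pnatr_eq0 -lt0n prime_gt0 // => /(_ isT).
    rewrite (_ : ratr _ = ell%:R); last by rewrite ratr_nat.
    rewrite -[ell%:R in RHS]/((ell%:Z)%:~R) numq_int denq_int /= logn_prime // eqxx logn1 subr0.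
  by move=> ->; lia.
  by have [/(_ nu)[b] + _] := unif ell%:R; rewrite v0 mulr0; apply/eqP.
split=> // a; move: {2}(absz _).+1 (ltnSn (absz (w (i a)))) => n.
elim: n a => [//|n IH] a an a0.
have [ua|nua] := boolP (a \is a GRing.unit).
  by exists 0%N, a; rewrite expr0 mulr1.
have [/(_ nua)[b ab] _] := unif a.
have b0 : b != 0 by apply: contraNneq a0 => b0; rewrite ab b0 mul0r.
have wv : 0 < w (i varpi).
  rewrite lt_neqAle w_ge0 // andbT eq_sym.
  by apply: contraNneq varpiN => /(unit_w _ varpi0).
have [|//|k [u [uu bu]]] := IH b.
  have := wM _ _ (i0 _ b0) (i0 _ varpi0); rewrite -rmorphM -ab.
  move: (w_ge0 _ b0) (w_ge0 _ a0) wv an.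
  by move: (w _) (w _) (w _) => x y z; lia.
by exists k.+1, u; split=> //; rewrite ab bu exprSr mulrA.
Qed.

(** * Modules over a discrete valuation ring *)

Section ValuationRing.
Variables (O : idomainType) (varpi : O).
Hypotheses (varpi0 : varpi != 0) (varpiN : varpi \isn't a GRing.unit).
Hypothesis dvr : forall a : O, a != 0 ->
  exists k u, u \is a GRing.unit /\ a = u * varpi ^+ k.

Lemma dvr_total (a b : O) : (exists q, a = q * b) \/ (exists q, b = q * a).
Proof.
have [->|/dvr[k [u [uu ->]]]] := eqVneq a 0; first by left; exists 0; rewrite mul0r.
have [->|/dvr[l [v [vu ->]]]] := eqVneq b 0; first by right; exists 0; rewrite mul0r.
wlog kl : k l u v uu vu / (k <= l)%N => [h|].
  by have [/h|/ltnW/h] := leqP k l; last rewrite or_comm; apply.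
right; exists (v * u^-1 * varpi ^+ (l - k)).
by rewrite -(subnK kl) exprD mulrACA divrK // addnK.
Qed.

Lemma dvr_divisor (s : seq O) : s != [::] ->
  exists2 x, x \in s & forall y, y \in s -> exists q, y = q * x.
Proof.
elim: s => [//|x [|y s] IH] _.
  by exists x; rewrite ?mem_head // => y; rewrite inE => /eqP->; exists 1; rewrite mul1r.
have [//|z zs hz] := IH; have [[q xq]|[q zq]] := dvr_total x z.
  exists z => [|t]; first by rewrite inE zs orbT.
  by rewrite inE => /orP[/eqP->|/hz//]; exists q.
exists x => [|t]; first by rewrite mem_head.
rewrite inE => /orP[/eqP->|/hz[q' ->]]; first by exists 1; rewrite mul1r.
by exists (q' * q); rewrite zq mulrA.
Qed.

Definition multiples (a : O) : set O^o := [set x | exists t, x = t * a].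

Lemma multiples_submodule a : submodule (multiples a).
Proof.
split=> [|b x y [t ->] [t' ->]]; first by exists 0; rewrite mul0r.
by exists (b * t + t'); rewrite mulrDl -mulrA.
Qed.

Lemma ilength_multiples_varpi : ilength (multiples varpi) setT 1.
Proof.
have h := multiples_submodule varpi.
have nu x : ~ multiples varpi x -> (x : O) \is a GRing.unit.
  move=> nx; have /dvr[k [u [uu xu]]] : (x : O) != 0.
    by apply/eqP => x0; apply: nx; exists 0; rewrite mul0r.
  case: k xu => [|k] xu; first by rewrite xu expr0 mulr1.
  by case: nx; exists (u * varpi ^+ k); rewrite xu exprSr mulrA.
split=> [|[|[|k]] // [N [h1 h2]]].
  apply: (interval_chain_rcons (B := multiples varpi)) => //.
    exists 1 => // -[t /esym vt]; move/negP: varpiN; apply; apply/unitrP.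
    by exists t; rewrite [varpi * t]mulrC; split.
  exact: interval_chain0.
have [_ [x N1x nN0x]] := h2 0%N isT; have [_ [y N2y nN1y]] := h2 1%N isT.
have [_ vN0 _] := h1 0%N isT; have [hN1 _ _] := h1 1%N isT; case: nN1y.
have ux : (x : O) \is a GRing.unit by apply: nu => /vN0.
by rewrite -(divrK ux y); apply: (submoduleZ (y / x : O) hN1 N1x).
Qed.

Lemma ilength_multiples a : a != 0 -> exists l, ilength (multiples a) setT l.
Proof.
move=> /dvr[k [u [uu ->]]]; exists k.
have -> : multiples (u * varpi ^+ k) = multiples (varpi ^+ k).
  rewrite eqEsubset; split=> x [t ->]; first by exists (t * u); rewrite mulrA.
  by exists (t / u); rewrite mulrA divrK.
elim: k => [|k IH].
  have -> : multiples (varpi ^+ 0) = setT.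
    by rewrite -subTset => x _; exists x; rewrite expr0 mulr1.
  exact: ilengthxx.
have sub : multiples (varpi ^+ k.+1) `<=` multiples (varpi ^+ k).
  by move=> x [t ->]; exists (t * varpi); rewrite exprS mulrA.
rewrite -add1n; apply: ilength_add IH => //; try exact: multiples_submodule.
apply: (ilength_iso (f := fun t : O^o => (t : O) * varpi ^+ k : O^o)) ilength_multiples_varpi => //;
  try exact: multiples_submodule.
- by move=> b x y _ _; rewrite mulrDl -mulrA.
- by move=> x _; exists x.
- move=> y [t ->]; exists t => //; rewrite subrr.
  exact: submodule0 (multiples_submodule _).
move=> x _; split=> -[t e]; exists t; last by rewrite e exprS mulrA.
apply: (mulIf (expf_neq0 k varpi0)); rewrite e exprS mulrA; by [].
Qed.

Section Modules.
Variable X : lmodType O.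
Implicit Types (A B T : set X) (s : seq X).

Definition pure T := forall a x, a != 0 -> T (a *: x) -> T x.

Definition basis_mod T r (e : 'I_r -> X) (Y : set X) :=
  (forall x, Y x -> exists c : 'I_r -> O, T (x - \sum_i c i *: e i)) /\
  (forall c : 'I_r -> O, T (\sum_i c i *: e i) -> forall i, c i = 0).

(** A generating family of minimal size is a basis: in a relation, all
    coefficients are multiples of one of them, which can be divided out. *)
Lemma basis_mod_exists T s : submodule T -> pure T ->
  exists r (e : 'I_r -> X), basis_mod T e [set` mod_span [set` s]].
Proof.
move=> hT pT.
pose gens r := `[< exists e : 'I_r -> X, forall x, x \in mod_span [set` s] ->
  exists c : 'I_r -> O, T (x - \sum_i c i *: e i) >].
have exg : exists r, gens r.
  exists (size s); apply/asboolP; exists (fun i => s`_i) => x xs.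
  have [c ->] := mod_span_seqP xs; exists c; rewrite subrr; exact: submodule0.
case: (ex_minnP exg) => r /asboolP[e he] rmin; exists r, e; split=> // c Tc.
apply: contrapT => nc.
have [i0 ci0] : exists i, c i != 0.
  by apply: contrapT => nci; apply: nc => i; apply: contrapT => /eqP ci; apply: nci; exists i.
have [|_ /codomP[j ->] hq] := @dvr_divisor (codom c).
  by apply/eqP => ec; have := codom_f c i0; rewrite ec.
have /choice[q {}hq] : forall i, exists q, c i = q * c j by move=> i; apply/hq/codom_f.
have cj0 : c j != 0 by apply: contraNneq ci0 => cj; rewrite hq cj mulr0.
have Tq : T (\sum_i q i *: e i).
  apply: (pT (c j)) => //; congr T: Tc; rewrite scaler_sumr; apply: eq_bigr => i _.
  by rewrite hq mulrC scalerA.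
have qj : q j = 1 by apply: (mulIf cj0); rewrite -hq mul1r.
case: r e he rmin c Tc nc i0 ci0 j {hq} q Tq qj cj0 => [|r] e he rmin c Tc nc i0 ci0 j q Tq qj cj0.
  by case: j {qj cj0}.
suff /rmin : gens r by rewrite ltnn.
apply/asboolP; exists (fun i => e (lift j i)) => x /he[b Tb].
exists (fun i => b (lift j i) - b j * q (lift j i)).
have bE : \sum_i b i *: e i = \sum_i (b (lift j i) - b j * q (lift j i)) *: e (lift j i) +
    b j *: \sum_i q i *: e i.
  rewrite !(bigD1_ord j) //= qj scale1r scalerDr addrCA scaler_sumr -big_split /=.
  by congr (_ + _); apply: eq_bigr => i _; rewrite scalerBl scalerA subrK.
apply: (submodule_subr hT (y := b j *: \sum_i q i *: e i)); last exact: submoduleZ.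
by rewrite -addrA -opprD -bE.
Qed.

Lemma ilength_cyclic A x l a : submodule A -> ilength (multiples a) setT l ->
  (forall t : O, A (t *: x) <-> multiples a t) ->
  ilength A [set y | exists t : O, A (y - t *: x)] l.
Proof.
move=> hA la hx; have hm := multiples_submodule a.
apply: (ilength_iso (f := fun t : O^o => (t : O) *: x)) la => //.
- split=> [|b y z [t At] [t' At']]; first by exists 0; rewrite scale0r subr0; apply: submodule0.
  exists (b * t + t'); rewrite scalerDl -scalerA opprD addrACA -scalerBr.
  by case: hA => _; apply.
- by move=> y Ay; exists 0; rewrite scale0r subr0.
- by move=> b y z _ _; rewrite scalerDl -[(b *: y) *: x]scalerA.
- by move=> t _; exists t; rewrite subrr; apply: submodule0.
- by move=> y [t At]; exists t.
Qed.

(** The nonzero ideals of O are the powers of the maximal ideal. *)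
Lemma ilength_multiples_sub (I : set O^o) d : submodule I -> d != 0 -> I d ->
  exists a, (forall t, I t <-> multiples a t).
Proof.
move=> hI d0 Id; have [l hl] := ilength_multiples d0.
have dI : multiples d `<=` I by move=> _ [t ->]; apply: (submoduleZ t hI Id).
have ex : exists k, `[< I (varpi ^+ k : O^o) >].
  have [k [u [uu du]]] := dvr d0; exists k; apply/asboolP.
  by have := submoduleZ (u^-1 : O) hI Id; rewrite du /GRing.scale /= mulKr.
case: (ex_minnP ex) => k /asboolP Ik kmin; exists (varpi ^+ k) => t; split; last first.
  by move=> [t' ->]; apply: (submoduleZ (t' : O) hI Ik).
have [->|/dvr[n [u [uu tu]]]] := eqVneq (t : O) 0; first by exists 0; rewrite mul0r.
move=> It; have /kmin kn : `[< I (varpi ^+ n : O^o) >].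
  apply/asboolP; have := submoduleZ (u^-1 : O) hI It; rewrite tu /GRing.scale /=.
  by rewrite mulKr.
exists (u * varpi ^+ (n - k)); rewrite tu -mulrA -exprD subnK //.
Qed.

(** Each generator in turn contributes a quotient of O / d. *)
Lemma ilength_torsion s A B d : submodule A -> submodule B -> A `<=` B -> d != 0 ->
  (forall x, x \in s -> B x /\ A (d *: x)) ->
  (forall x, B x -> x \in mod_span (A `|` [set` s])) -> exists n, ilength A B n.
Proof.
elim: s A => [|x s IH] A hA hB AB d0 hs Bs.
  suff -> : A = B by exists 0%N; apply: ilengthxx.
  rewrite eqEsubset; split=> // x /Bs; apply: mod_span_min => // y [//|].
  by rewrite /= in_nil.
pose A1 := [set y | exists t : O, A (y - t *: x)].
have hA1 : submodule A1.
  split=> [|b y z [t At] [t' At']]; first by exists 0; rewrite scale0r subr0; apply: submodule0.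
  exists (b * t + t'); rewrite scalerDl -scalerA opprD addrACA -scalerBr.
  by case: hA => _; apply.
have AA1 : A `<=` A1 by move=> y Ay; exists 0; rewrite scale0r subr0.
have [Bx Adx] := hs x (mem_head _ _).
have A1B : A1 `<=` B.
  by move=> y [t /AB Byt]; apply: (submodule_subr hB Byt); apply: submoduleZ.
have [n hn] : exists n, ilength A1 B n.
  apply: IH => // [y ys|y /Bs].
    have [|By Ady] := hs y; first by rewrite inE ys orbT.
    by split=> //; apply: AA1.
  move: y; apply: mod_span_min => [|y]; first exact: mod_span_submodule.
  case=> [/AA1 Ay|/=]; first by apply: mod_span_sub; left.
  rewrite inE => /orP[/eqP->|ys]; apply: mod_span_sub; [left|by right].
  by exists 1; rewrite scale1r subrr; apply: submodule0.
have [a ha] : exists a, forall t, A (t *: x) <-> multiples a t.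
  apply: (@ilength_multiples_sub [set t | A (t *: x)] d) => //.
  split=> [|b y z /= Ay Az]; first by rewrite /= scale0r; apply: submodule0.
  by rewrite scalerDl -[(b *: y) *: x]scalerA; case: hA => _; apply.
have a0 : a != 0.
  have /ha[t dt] := Adx; apply: contraNneq d0 => a0.
  by move: dt; rewrite a0 mulr0 => ->.
have [l hl] := ilength_multiples a0; exists (l + n)%N.
by apply: ilength_add hn => //; apply: (ilength_cyclic hA hl ha).
Qed.

(** Otherwise the submodules A + O varpi ^ i x form a chain that is too long. *)
Lemma ilength_annihilated A B n : submodule A -> submodule B ->
  A `<=` B -> ilength A B n -> forall x, B x -> A (varpi ^+ n *: x).
Proof.
move=> hA hB AB [_ ub] x Bx; apply: contrapT => nA.
pose N i := [set y | exists t : O, A (y - (t * varpi ^+ (n.+1 - i)) *: x)].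
suff /ub : interval_chain A B n.+1 by rewrite ltnn.
exists N; split=> i il.
  split.
  - split=> [|b y z [t At] [t' At']].
      by exists 0; rewrite mul0r scale0r subr0; apply: submodule0.
    exists (b * t + t'); rewrite mulrDl scalerDl -mulrA -scalerA opprD addrACA -scalerBr.
    by case: hA => _; apply.
  - by move=> y Ay; exists 0; rewrite mul0r scale0r subr0.
  - by move=> y [t /AB Byt]; apply: (submodule_subr hB Byt); apply: submoduleZ.
rewrite ltnS in il; have e : (n.+1 - i = (n - i).+1)%N by rewrite subSn.
rewrite /N subSS e; split=> [y [t At]|].
  by exists (t * varpi); rewrite -mulrA -exprS.
exists (varpi ^+ (n - i) *: x).
  by exists 1; rewrite mul1r subrr; apply: submodule0.
move=> [t]; rewrite -scalerBl.
have -> : varpi ^+ (n - i) - t * varpi ^+ (n - i).+1 = (1 - t * varpi) * varpi ^+ (n - i).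
  by rewrite exprS; ring.
have u1 : 1 - t * varpi \is a GRing.unit.
  have nv y : 1 != y * varpi.
    apply: contraNneq varpiN => e1; apply/unitrP; exists y.
    by rewrite [varpi * y]mulrC -e1.
  have /dvr[[|k] [u [uu e1]]] : 1 - t * varpi != 0 by rewrite subr_eq0 nv.
    by rewrite e1 expr0 mulr1.
  by move/eqP: e1; rewrite exprSr mulrA subr_eq -mulrDl (negPf (nv _)).
move=> /(submoduleZ (varpi ^+ i / (1 - t * varpi)) hA).
by rewrite scalerA mulrA divrK // -exprD subnKC.
Qed.

(** The filtration by the vectors whose coordinates of index at least j are
    multiples of a has r steps, each isomorphic to O / a. *)
Lemma ilength_basis_mod T r (e : 'I_r -> X) a l : submodule T ->
  basis_mod T e setT -> ilength (multiples a) setT l ->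
  ilength [set x | exists n, T (x - a *: n)] setT (r * l).
Proof.
move=> hT [egen eind] la.
pose U j := [set x | exists c : 'I_r -> O,
   (forall i : 'I_r, (j <= i)%N -> multiples a (c i)) /\ T (x - \sum_i c i *: e i)].
have hm := multiples_submodule a.
have hU j : submodule (U j).
  split=> [|b x y [c [ca Tc]] [c' [ca' Tc']]].
    exists (fun=> 0); split=> [i _|]; first exact: (submodule0 hm).
    by rewrite big1 ?subr0 => [|i _]; rewrite ?scale0r //; apply: submodule0.
  exists (fun i => b * c i + c' i); split=> [i ji|].
    by have [_ hmm] := hm; apply: (hmm b); [apply: ca | apply: ca'].
  under eq_bigr do rewrite scalerDl -scalerA.
  rewrite big_split -scaler_sumr /= opprD addrACA -scalerBr.
  by case: hT => _; apply.
have U0 : [set x | exists n, T (x - a *: n)] = U 0%N.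
  rewrite eqEsubset; split=> x.
    move=> [n Tn]; have [c Tc] := egen n I; exists (fun i => c i * a); split.
      by move=> i _; exists (c i).
    apply: (submodule_subr hT (y := a *: (n - \sum_i c i *: e i))); last exact: submoduleZ.
    have -> : \sum_i (c i * a) *: e i = a *: \sum_i c i *: e i.
      by rewrite scaler_sumr; apply: eq_bigr => i _; rewrite mulrC scalerA.
    by congr T: Tn; rewrite scalerBr opprB addrA subrK.
  move=> [c [ca Tc]]; have /choice[q hq] : forall i, exists q, c i = q * a by move=> i; apply: ca.
  exists (\sum_i q i *: e i); congr T: Tc; rewrite scaler_sumr; congr (_ - _).
  by apply: eq_bigr => i _; rewrite hq mulrC scalerA.
have Ur : U r = setT.
  rewrite -subTset => x _; have [c Tc] := egen x I; exists c; split=> // i.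
  by rewrite leqNgt ltn_ord.
rewrite U0; suff h : forall k, (k <= r)%N -> ilength (U 0%N) (U k) (k * l) by rewrite -Ur; apply: h.
have UU j k : (j <= k)%N -> U j `<=` U k.
  move=> jk x [c [ca Tc]]; exists c; split=> // i ki; apply: ca; exact: leq_trans ki.
elim=> [_|j IH jr]; first exact: ilengthxx.
rewrite mulSn addnC; apply: ilength_add (IH (ltnW jr)) _ => //; try exact: UU.
pose i0 := Ordinal jr.
have delta (t : O) : \sum_i (if i == i0 then t else 0) *: e i = t *: e i0.
  by rewrite (bigD1 i0) //= eqxx big1 ?addr0 // => i /negPf->; rewrite scale0r.
have -> : U j.+1 = [set y | exists t : O, U j (y - t *: e i0)].
  rewrite eqEsubset; split=> x.
    move=> [c [ca Tc]]; exists (c i0), (fun i => if i == i0 then 0 else c i); split=> [i ji|].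
      case: eqP => [_|/eqP ii0]; first exact: (submodule0 hm).
      by apply: ca; rewrite ltn_neqAle ji andbT; apply: contraNneq ii0 => ji0; apply/eqP/val_inj.
    congr T: Tc; rewrite -addrA -opprD; congr (_ - _).
    rewrite (bigD1 i0) //= [in RHS](bigD1 i0) //= eqxx scale0r add0r; congr (_ + _).
    by apply: eq_bigr => i /negPf->.
  move=> [t [c [ca Tc]]]; exists (fun i => c i + (if i == i0 then t else 0)); split=> [i ji|].
    case: eqP => [ii0|_]; first by move: ji; rewrite ii0 ltnn.
    by rewrite addr0; apply/ca/ltnW.
  congr T: Tc; rewrite -addrA -opprD; congr (_ - _).
  by under [RHS]eq_bigr do rewrite scalerDl; rewrite big_split /= delta addrC.
apply: ilength_cyclic la _ => // t; split.
  move=> [c [ca]]; rewrite -delta -sumrB.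
  under eq_bigr do rewrite -scalerBl.
  move=> /eind/(_ i0); rewrite eqxx => /eqP; rewrite subr_eq0 => /eqP->.
  exact: ca.
move=> ta; exists (fun i => if i == i0 then t else 0); split=> [i _|].
  by case: eqP => // _; apply: (submodule0 hm).
by rewrite delta subrr; apply: submodule0.
Qed.
End Modules.
End ValuationRing.

(** * Exchanging one element of a regular sequence *)

Section Exchange.
Variables (O : idomainType) (R : comAlgType O).
Variables (lam : {lrmorphism R -> O | *%R}) (M : lmodType R).
Implicit Types (w y : seq R) (f g : R) (a b d : O).

Lemma lam_alg a : lam a%:A = a.
Proof. by rewrite linearZ /= rmorph1 mulr1. Qed.

Lemma lam_scalar (x : R) : lam (x - (lam x)%:A) = 0.
Proof. by rewrite rmorphB /= lam_alg subrr. Qed.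

Definition scalar_mod : lmodType O := restr (in_alg R) M.

Lemma scalarE (a : O) (x : M) : a *: (x : scalar_mod) = a%:A *: x :> M.
Proof. by []. Qed.

Lemma submodule_restr (A : set M) : submodule A -> submodule (A : set scalar_mod).
Proof. by move=> [A0 h]; split=> // a x y; apply: h. Qed.

Lemma submodule_alg (A : set R^o) : submodule A -> submodule (A : set R).
Proof.
move=> [A0 h]; split=> // a x y Ax Ay; rewrite -mulr_algl; exact: h.
Qed.

Definition aug_ideal : set R := [set x | lam x = 0].

Lemma aug_ideal_submodule : submodule (aug_ideal : set R^o).
Proof.
split=> [|a x y]; rewrite /aug_ideal /= ?rmorph0 // => x0 y0.
by rewrite rmorphD rmorphM /= x0 y0 mulr0 addr0.
Qed.

Definition aug_mul : set M :=
  [set x | x \in mod_span [set x *: n | x in aug_ideal & n in [set: M]]].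
(** The quotient of M by aug_sat is the torsion-free quotient of M / p M. *)
Definition aug_sat : set M := [set n | exists2 a : O, a != 0 & aug_mul (a%:A *: n)].
(** The quotient of p by cot_span y is the cotangent space of R / (y). *)
Definition cot_span y : set R :=
  [set x | x \in mod_span (M := R^o)
    ([set x * z | x in aug_ideal & z in aug_ideal] `|` [set` y])].
(** The quotient of aug_socle y by (y) M is Hom (O, M / (y) M). *)
Definition aug_socle y : set M := [set n | forall x, lam x = 0 -> smul M y (x *: n)].

Lemma aug_mul_submodule : submodule aug_mul.
Proof. exact: mod_span_submodule. Qed.

Lemma aug_mul_mem x n : lam x = 0 -> aug_mul (x *: n).
Proof. by move=> x0; apply: mod_span_sub; exists x => //; exists n. Qed.

Lemma aug_sat_submodule : submodule aug_sat.
Proof.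
have h := aug_mul_submodule; split.
  by exists 1; rewrite ?oner_neq0 // scaler0; apply: submodule0.
move=> c x y [a a0 ax] [b b0 bx]; exists (a * b); first by rewrite mulf_neq0.
have -> : (a * b)%:A *: (c *: x + y) =
    (b%:A * c) *: (a%:A *: x) + a%:A *: (b%:A *: y).
  rewrite scalerDr !scalerA; congr (_ *: _ + _ *: _); last first.
    by rewrite mulr_algl scalerA.
  by rewrite !mulr_algl -scalerAl mulr_algr !scalerA mulrC.
by apply: submoduleD => //; apply: submoduleZ.
Qed.

Lemma aug_mul_sat : aug_mul `<=` aug_sat.
Proof. by move=> x h; exists 1; rewrite ?oner_neq0 // !scale1r. Qed.

Lemma aug_sat_pure : pure (aug_sat : set scalar_mod).
Proof.
move=> a x a0 [b b0]; rewrite scalarE scalerA => h; exists (b * a).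
  by rewrite mulf_neq0.
by rewrite -scalerA -mulr_algl.
Qed.

Lemma aug_satB x n : aug_sat (x *: n - (lam x)%:A *: n).
Proof. by apply: aug_mul_sat; rewrite -scalerBl; apply: aug_mul_mem; apply: lam_scalar. Qed.

Lemma cot_span_submodule y : submodule (cot_span y : set R^o).
Proof. exact: mod_span_submodule. Qed.

Lemma cot_spanM y (r x : R) : cot_span y x -> cot_span y (r * x).
Proof. exact: (submoduleZ (r : R) (cot_span_submodule y)). Qed.

Lemma cot_spanZ y (t : O) (x : R) : cot_span y x -> cot_span y (t *: x).
Proof. by move=> h; rewrite -mulr_algl; apply: cot_spanM. Qed.

Lemma cot_span_subr y (x z : R) : cot_span y (x - z) -> cot_span y z -> cot_span y x.
Proof. exact: (@submodule_subr R R^o _ x z (cot_span_submodule y)). Qed.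

Lemma cot_span_mul y x z : lam x = 0 -> lam z = 0 -> cot_span y (x * z).
Proof. by move=> x0 z0; apply: mod_span_sub; left; exists x => //; exists z. Qed.

Lemma cot_span_mem y x : x \in y -> cot_span y x.
Proof. by move=> h; apply: mod_span_sub; right. Qed.

Lemma cot_span_min y (B : set R^o) : submodule B ->
  (forall x z, lam x = 0 -> lam z = 0 -> B (x * z)) ->
  (forall x, x \in y -> B x) -> cot_span y `<=` B.
Proof.
move=> hB h1 h2 x; apply: (mod_span_min hB) => v [[u hu [z hz <-]]|]; first exact: h1.
exact: h2 v.
Qed.

Lemma cot_span_sub y y' : {subset y <= y'} -> cot_span y `<=` cot_span y'.
Proof.
move=> yy; apply: cot_span_min; first exact: cot_span_submodule.
  exact: cot_span_mul.
by move=> x /yy; apply: cot_span_mem.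
Qed.

Lemma eq_cot_span y y' : y =i y' -> cot_span y = cot_span y'.
Proof.
by move=> e; rewrite eqEsubset; split; apply: cot_span_sub => x; rewrite e.
Qed.

Lemma cot_span_aug y : (forall x, x \in y -> lam x = 0) -> cot_span y `<=` aug_ideal.
Proof.
move=> hy; apply: cot_span_min => //; first exact: aug_ideal_submodule.
by move=> x z x0 z0; rewrite /aug_ideal /= rmorphM /= x0 mul0r.
Qed.

(** A scalar from O suffices since p f is contained in p ^ 2. *)
Lemma cot_span_rcons w f x : lam f = 0 ->
  cot_span (rcons w f) x <-> exists t : O, cot_span w (x - t *: f).
Proof.
move=> f0; have hw := cot_span_submodule w; split=> [|[t h]].
  move: x; apply: cot_span_min => [|x z x0 z0|x].
  - split; first by exists 0; rewrite scale0r subr0; apply: (submodule0 hw).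
    move=> a x z [t ht] [t' ht']; exists (lam a * t + t').
    have -> : a *: x + z - (lam a * t + t') *: f =
       a *: (x - t *: f) + (z - t' *: f) + t *: ((a - (lam a)%:A) * f) :> R.
      rewrite -[a *: x]/(a * x) -[a *: (x - _)]/(a * (x - t *: f)).
      rewrite -(mulr_algl (_ + _) f) -(mulr_algl t f) -(mulr_algl t' f) -(mulr_algl t (_ * f)).
      by rewrite scalerDl -[(lam a * t) *: 1]scalerA -(mulr_algl _ t%:A); ring.
    apply: (submoduleD hw); first by case: hw => _; apply.
    by apply: cot_spanZ; apply: cot_span_mul => //; apply: lam_scalar.
  - by exists 0; rewrite scale0r subr0; apply: cot_span_mul.
  rewrite mem_rcons inE => /orP[/eqP->|xw].
    by exists 1; rewrite scale1r subrr; apply: (submodule0 hw).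
  by exists 0; rewrite scale0r subr0; apply: cot_span_mem.
have hwf := cot_span_submodule (rcons w f).
apply: (@cot_span_subr _ _ (t *: f)).
  by apply: cot_span_sub h => z zw; rewrite mem_rcons inE zw orbT.
by apply: cot_spanZ; apply: cot_span_mem; rewrite mem_rcons mem_head.
Qed.

(** The cotangent space of R / (y) is annihilated by a nonzero scalar. *)
Definition cot_nondegenerate y :=
  exists2 d : O, d != 0 & forall x, lam x = 0 -> cot_span y (d *: x).

Hypotheses (R_noeth : noetherian R) (M_fg : finitely_generated M).

(** Nakayama over the localization: there (y) and p coincide. *)
Lemma nondegenerate_kills y : cot_nondegenerate y -> exists2 s, lam s != 0 &
  forall x, lam x = 0 -> s * x \in gen_ideal y.
Proof.
move=> [d d0 hd]; have hy := mod_span_submodule (M := R^o) [set` y].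
have [|x px|k [s [es hs]]] := @nakayama_det R R^o O lam [set` gen_ideal y] aug_ideal d%:A hy.
- exact: (fg_submodule R_noeth (finitely_generated_regular R) aug_ideal_submodule).
- move/hd: px; rewrite -mulr_algl -[d%:A * x]/(d%:A *: (x : R^o)); move: (_ *: _).
  apply: cot_span_min; first exact: mod_span_submodule.
    move=> u z u0 z0; apply: mod_span_sub; right; exists u => //.
    by exists z.
  by move=> u uy; apply: mod_span_sub; left; apply: mod_span_sub.
- exists s; last exact: hs.
  by rewrite es (_ : _ ^+ k = d ^+ k) ?expf_neq0 //; congr (_ ^+ _); apply: lam_alg.
Qed.

Lemma gen_ideal_smul y x n : x \in gen_ideal y -> smul M y (x *: n).
Proof. by move=> h; apply: mod_span_sub; exists x => //; exists n. Qed.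

Lemma smul_aug_mul y : (forall x, x \in y -> lam x = 0) -> smul M y `<=` aug_mul.
Proof.
move=> hy; apply: smul_min => [|a n /hy]; [exact: aug_mul_submodule|exact: aug_mul_mem].
Qed.

Hypothesis M_loc : exists x : M, forall s, lam s != 0 -> s *: x != 0.

(** If f were torsion modulo p ^ 2 + (w), then (w) and p would agree after
    localization, and the regularity of f would force M = p M there. *)
Lemma cot_span_torsion_free w f a :
  (forall x, x \in rcons w f -> lam x = 0) -> regular_mod (smul M w) f ->
  cot_nondegenerate (rcons w f) -> cot_span w (a *: f) -> a = 0.
Proof.
move=> hwf rf [d d0 hd] waf; apply: contrapT => /eqP a0.
have hw := cot_span_submodule w.
have f0 : lam f = 0 by apply: hwf; rewrite mem_rcons mem_head.
have w0 x : x \in w -> lam x = 0 by move=> xw; apply: hwf; rewrite mem_rcons inE xw orbT.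
have ndw : cot_nondegenerate w.
  exists (a * d) => [|x /hd/(cot_span_rcons _ _ f0)[t ht]]; first by rewrite mulf_neq0.
  apply: (@cot_span_subr _ _ (t *: (a *: f))).
    rewrite -scalerA [t *: _]scalerA [t * a]mulrC -[(a * t) *: f]scalerA -scalerBr.
    exact: cot_spanZ.
  exact: cot_spanZ.
have [s s0 hs] := nondegenerate_kills ndw.
have sM n : aug_mul (s *: n).
  apply: (smul_aug_mul w0); apply: rf; rewrite scalerA mulrC.
  by apply: gen_ideal_smul; apply: hs.
have [||x _|k [s' [es hs']]] := @nakayama_det R M O lam [set 0] setT s.
- exact: set0_submodule.
- by apply: fg_submodule => //; apply: setT_submodule.
- move: (s *: x) (sM x); apply: mod_span_min; first exact: mod_span_submodule.
  move=> y yp; apply: mod_span_sub; right; move: yp; by [].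
have [x hx] := M_loc; have s'0 : lam s' != 0 by rewrite es; apply: expf_neq0.
by move: (hx _ s'0); rewrite (hs' x I) eqxx.
Qed.

Section OneStep.
Variables (w : seq R) (f g : R) (a b : O).
Hypothesis w0 : forall x, x \in w -> lam x = 0.
Hypotheses (f0 : lam f = 0) (g0 : lam g = 0).
Hypothesis rf : regular_mod (smul M w) f.
Hypothesis hab : cot_span w (b *: g - a *: f).

(** If p n is contained in (w, f) M then g n = f n' modulo (w) M for some n';
    multiplication by g / f carries one socle into the other. *)
Lemma socle_exchange n : aug_socle (rcons w f) n ->
  exists2 n', aug_socle (rcons w g) n' & aug_mul (b%:A *: n' - a%:A *: n).
Proof.
move=> Ln; have hs := smul_submodule M w; have hp := aug_mul_submodule.
have /smul_rcons[n' hn'] := Ln g g0; exists n'.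
  move=> x x0; have /smul_rcons[k hk] := Ln x x0; apply/smul_rcons; exists k.
  apply: rf.
  have -> : f *: (x *: n' - g *: k) = g *: (x *: n - f *: k) - x *: (g *: n - f *: n').
    rewrite !scalerBr !scalerA opprB [g * x]mulrC [f * x]mulrC [f * g]mulrC.
    by rewrite [RHS]addrC addrA subrK.
  by apply: submoduleB => //; apply: submoduleZ.
(* elements of p ^ 2 + (w) carry n into f p M, modulo (w) M *)
have key h : cot_span w h -> exists2 k, aug_mul k & smul M w (h *: n - f *: k).
  move: h; apply: cot_span_min => [|x z x0 z0|x xw].
  - split; first by exists 0; rewrite ?scale0r ?scaler0 ?subrr; apply: submodule0.
    move=> c x z [k hk wk] [k' hk' wk']; exists (c *: k + k').
      by apply: submoduleD => //; apply: submoduleZ.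
    rewrite scalerDl -[(c *: x) *: n]scalerA [f *: _]scalerDr.
    rewrite [f *: (c *: k)]scalerA [f * c]mulrC -[(c * f) *: k]scalerA.
    by rewrite opprD addrACA -scalerBr; case: hs => _; apply.
  - have /smul_rcons[k hk] := Ln z z0; exists (x *: k); first exact: aug_mul_mem.
    by rewrite -scalerA [f *: _]scalerA [f * x]mulrC -scalerA -scalerBr; apply: submoduleZ.
  exists 0; first exact: submodule0.
  by rewrite scaler0 subr0; apply: smul_mem.
have [k pk wk] := key _ hab.
suff : smul M w (b%:A *: n' - a%:A *: n - k).
  by move/(smul_aug_mul w0) => h; apply: (submodule_subr hp h).
apply: rf.
have -> : f *: (b%:A *: n' - a%:A *: n - k) =
    ((b *: g - a *: f) *: n - f *: k) - b%:A *: (g *: n - f *: n').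
  rewrite !scalerBr !scalerBl !scalerA !mulr_algl !mulr_algr opprB.
  by rewrite [RHS]addrC [RHS]addrA; congr (_ - _); rewrite [RHS]addrA subrK.
by apply: submoduleB => //; apply: submoduleZ.
Qed.

Lemma scaled_socle_sub x :
  (exists2 l, aug_socle (rcons w f) l & aug_sat (x - a%:A *: l)) ->
  (exists2 l, aug_socle (rcons w g) l & aug_sat (x - b%:A *: l)).
Proof.
move=> [l /socle_exchange[l' Ll' /aug_mul_sat hl] Tx]; exists l' => //.
have hT := aug_sat_submodule.
apply: (submodule_subr hT (y := - (b%:A *: l' - a%:A *: l))); last exact: submoduleN.
by congr aug_sat: Tx; rewrite opprK addrA subrK.
Qed.
End OneStep.

Section Lengths.
Variable varpi : O.
Hypotheses (varpi0 : varpi != 0) (varpiN : varpi \isn't a GRing.unit).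
Hypothesis dvr : forall a : O, a != 0 ->
  exists k u, u \is a GRing.unit /\ a = u * varpi ^+ k.

Definition cot_length y n := ilength (cot_span y) aug_ideal n.
(** The quotient of M by cong_set y is the congruence module of M / (y) M. *)
Definition cong_set y : set scalar_mod := sumset (aug_socle y) aug_sat.
Definition cong_length y n := ilength (cong_set y) [set: scalar_mod] n.

Lemma aug_socle_submodule y : submodule (aug_socle y).
Proof.
have h := smul_submodule M y; split=> [x x0|a u v Lu Lv x x0].
  by rewrite scaler0; apply: submodule0.
rewrite scalerDr scalerA mulrC -scalerA.
by apply: (submoduleD h); [apply: (submoduleZ _ h); apply: Lu|apply: Lv].
Qed.

Lemma cong_set_submodule y : submodule (cong_set y).
Proof.
apply: submodule_restr; apply: sumset_submodule; first exact: aug_socle_submodule.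
exact: aug_sat_submodule.
Qed.

(** The colength of p ^ 2 + (w) + (a f) = p ^ 2 + (w) + (b g) in p, computed
    through f and through g. *)
Lemma cot_length_exchange w f g a b la lb n n' :
  (forall x, x \in rcons w f -> lam x = 0) -> (forall x, x \in rcons w g -> lam x = 0) ->
  regular_mod (smul M w) f -> regular_mod (smul M w) g ->
  cot_nondegenerate (rcons w f) -> cot_nondegenerate (rcons w g) ->
  a != 0 -> b != 0 -> cot_span w (b *: g - a *: f) ->
  ilength (multiples a) setT la -> ilength (multiples b) setT lb ->
  cot_length (rcons w f) n -> cot_length (rcons w g) n' -> (n + la = n' + lb)%N.
Proof.
move=> wf wg rf rg nf ng a0 b0 hab hla hlb hn hn'.
have hw := submodule_alg (cot_span_submodule w).
pose U c (h : R) : set R := [set x | exists t : O, cot_span w (x - (t * c) *: h)].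
have hU c h : submodule (U c h).
  split=> [|d x z [t ht] [t' ht']]; first by exists 0; rewrite mul0r scale0r subr0; apply: submodule0.
  exists (d * t + t'); rewrite mulrDl scalerDl -mulrA -scalerA opprD addrACA -scalerBr.
  by case: hw => _; apply.
suff key c h lc k : (forall x, x \in rcons w h -> lam x = 0) ->
    regular_mod (smul M w) h -> cot_nondegenerate (rcons w h) -> c != 0 ->
    ilength (multiples c) setT lc -> cot_length (rcons w h) k ->
    ilength (U c h) aug_ideal (lc + k).
  have := key _ _ _ _ wf rf nf a0 hla hn.
  suff -> : U a f = U b g.
    move=> /max_nat_unique h; have := h _ (key _ _ _ _ wg rg ng b0 hlb hn').
    by rewrite addnC [(lb + n')%N]addnC.
  rewrite eqEsubset; split=> x [t ht]; exists t.
    apply: (submodule_subr hw (y := - (t *: (b *: g - a *: f)))).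
      by congr (cot_span w): ht; rewrite opprK scalerBr !scalerA addrA subrK.
    by apply: submoduleN => //; apply: submoduleZ.
  apply: (submodule_subr hw (y := t *: (b *: g - a *: f))).
    by congr (cot_span w): ht; rewrite scalerBr !scalerA opprB addrA subrK.
  exact: submoduleZ.
move=> wh rh nh c0 hlc hk; have h0 : lam h = 0 by apply: wh; rewrite mem_rcons mem_head.
have tf t : cot_span w (t *: h) -> t = 0 by apply: cot_span_torsion_free.
have hwh := submodule_alg (cot_span_submodule (rcons w h)).
have haug := submodule_alg aug_ideal_submodule.
have E : cot_span (rcons w h) = [set y | exists t : O, U c h (y - t *: h)].
  rewrite eqEsubset; split=> x.
    move=> /(cot_span_rcons _ _ h0)[t ht]; exists t, 0; by rewrite mul0r scale0r subr0.
  move=> [t [t' ht']]; apply/(cot_span_rcons _ _ h0); exists (t + t' * c).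
  by rewrite scalerDl opprD addrA.
have Usub : U c h `<=` cot_span (rcons w h).
  by move=> x [t ht]; apply/(cot_span_rcons _ _ h0); exists (t * c).
apply: ilength_add hk => //; first exact: cot_span_aug.
rewrite E; apply: ilength_cyclic hlc _ => // t; split.
  move=> [t' ]; rewrite -scalerBl => /tf /eqP; rewrite subr_eq0 => /eqP->.
  by exists t'.
by move=> [t' ->]; exists t'; rewrite subrr; apply: submodule0.
Qed.

(** The colength of a L(w, f) + T = b L(w, g) + T in M, computed through
    a M + T and through b M + T. *)
Lemma cong_length_exchange w f g a b la lb r n n' (e : 'I_r -> scalar_mod) :
  (forall x, x \in rcons w f -> lam x = 0) -> (forall x, x \in rcons w g -> lam x = 0) ->
  regular_mod (smul M w) f -> regular_mod (smul M w) g ->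
  a != 0 -> b != 0 -> cot_span w (b *: g - a *: f) ->
  basis_mod (aug_sat : set scalar_mod) e setT ->
  ilength (multiples a) setT la -> ilength (multiples b) setT lb ->
  cong_length (rcons w f) n -> cong_length (rcons w g) n' ->
  (n + r * la = n' + r * lb)%N.
Proof.
move=> wf wg rf rg a0 b0 hab he hla hlb hn hn'.
have w0 x : x \in w -> lam x = 0 by move=> xw; apply: wf; rewrite mem_rcons inE xw orbT.
have f0 : lam f = 0 by apply: wf; rewrite mem_rcons mem_head.
have g0 : lam g = 0 by apply: wg; rewrite mem_rcons mem_head.
have hT := submodule_restr aug_sat_submodule.
pose V c (h : R) : set scalar_mod :=
  [set x | exists2 l, aug_socle (rcons w h) l & aug_sat (x - c%:A *: l)].
suff key c h lc k : c != 0 -> ilength (multiples c) setT lc ->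
    cong_length (rcons w h) k -> ilength (V c h) setT (k + r * lc).
  apply: max_nat_unique (key _ _ _ _ a0 hla hn) _.
  suff -> : V a f = V b g by apply: key.
  rewrite eqEsubset; split=> x; apply: scaled_socle_sub => //.
  by rewrite -opprB; apply: (submoduleN (submodule_alg (cot_span_submodule w))).
move=> c0 hlc hk.
pose U := [set x : scalar_mod | exists n : scalar_mod, aug_sat (x - c *: n)].
have hL := submodule_restr (aug_socle_submodule (rcons w h)).
have hV : submodule (V c h).
  split=> [|d x y [l Ll Tl] [l' Ll' Tl']].
    exists 0; first exact: submodule0 hL.
    by rewrite scaler0 subr0; apply: submodule0 hT.
  exists (d%:A *: l + l'); first by case: hL => _; apply.
  have := proj2 hT d _ _ Tl Tl'; congr aug_sat; rewrite scalerBr addrACA -opprD scalerDr.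
  by congr (_ - (_ + _)); rewrite scalarE !scalerA mulrC.
have hU : submodule U.
  split=> [|d x y [l Tl] [l' Tl']].
    by exists 0; rewrite scaler0 subr0; apply: submodule0 hT.
  exists (d *: l + l' : scalar_mod).
  rewrite scalerDr scalerA mulrC -scalerA opprD addrACA -scalerBr.
  by case: hT => _; apply.
apply: (ilength_add (B := U)) => //; first by move=> x [l _ Tl]; exists l.
  apply: (ilength_iso (f := fun x : scalar_mod => c *: x)) hk => //.
  - exact: cong_set_submodule.
  - by move=> x [l _ Tl]; exists l.
  - by move=> d x y _ _; rewrite scalerDr !scalerA mulrC.
  - by move=> x _; exists x; rewrite subrr; apply: submodule0.
  - move=> y [l Tl]; exists l => //; exists 0; first exact: submodule0 hL.
    by rewrite scaler0 subr0.
  - move=> x _; split=> -[l Ll Tl]; exists l => //.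
      by apply: (aug_sat_pure c0); rewrite scalerBr; exact: Tl.
    by have := submoduleZ c hT Tl; rewrite scalerBr.
exact: ilength_basis_mod he hlc.
Qed.

(** R acts on p / p ^ 2 through O, so generators of the ideal p generate this
    quotient over O. *)
Lemma cot_length_exists y : (forall x, x \in y -> lam x = 0) -> cot_nondegenerate y ->
  exists n, cot_length y n.
Proof.
move=> y0 [d d0 hd]; have hC := cot_span_submodule y.
have [s [sp ps]] := fg_submodule R_noeth (finitely_generated_regular R) aug_ideal_submodule.
apply: (ilength_torsion varpi0 varpiN dvr (s := s) (d := d)) => //.
- exact: submodule_alg.
- exact: submodule_alg aug_ideal_submodule.
- exact: cot_span_aug.
- by move=> x /sp px; split=> //; apply: hd.
move=> x /ps; set S := mod_span (_ `|` _).
have hS : submodule [set` S] by apply: mod_span_submodule.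
have CS z : cot_span y z -> z \in S by move=> h; apply: mod_span_sub; left.
suff H : x \in mod_span (M := R^o) [set` s] -> lam x = 0 /\ x \in S by move=> /H[].
move: x; apply: (@mod_span_min R R^o _ [set x | lam x = 0 /\ x \in S]) => [|x xs].
  split; first by split; [exact: rmorph0 | exact: rpred0].
  move=> a x z [x0 xS] [z0 zS]; split; first by rewrite rmorphD rmorphM /= x0 z0 mulr0 addr0.
  rewrite -[a](subrK (lam a)%:A) scalerDl -addrA.
  apply: (submoduleD hS).
    by apply: CS; apply: cot_span_mul => //; apply: lam_scalar.
  apply: (submoduleD hS) => //; rewrite -[_ *: _]/(_ * _) mulr_algl.
  exact: submoduleZ.
by split; [exact: sp | apply: mod_span_sub; right].
Qed.

(** An s outside p with s p contained in (y) maps M into L(y), and it acts on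
    M / p M as the nonzero scalar lam s. *)
Lemma cong_length_exists y : cot_nondegenerate y -> exists n, cong_length y n.
Proof.
move=> ndy; have [s s0 hs] := nondegenerate_kills ndy; have [l hl] := M_fg.
have hT := submodule_restr aug_sat_submodule.
have hC := cong_set_submodule y.
have TC : aug_sat `<=` cong_set y by apply: sumsetr; apply: aug_socle_submodule.
apply: (@ilength_torsion O varpi varpi0 varpiN dvr scalar_mod l (cong_set y) setT (lam s)) => //.
  move=> x _; split=> //; exists (s *: x).
    by move=> z z0; rewrite scalerA mulrC; apply: gen_ideal_smul; apply: hs.
  by rewrite scalarE -opprB; apply: (submoduleN hT); apply: aug_satB.
move=> x _; have := hl x; set S := mod_span (_ `|` _).
have hS : submodule [set` S] by apply: mod_span_submodule.
move: x; apply: (@mod_span_min R M _ [set` S]) => [|x xl]; last by apply: mod_span_sub; right.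
split; first exact: rpred0.
move=> a x z xS zS; apply: (submoduleD hS) => //.
apply: (submodule_subr hS (y := lam a *: (x : scalar_mod))); last exact: submoduleZ.
by apply: mod_span_sub; left; apply: TC; apply: aug_satB.
Qed.

Lemma nondegenerate_of_length y n : (forall x, x \in y -> lam x = 0) ->
  cot_length y n -> cot_nondegenerate y.
Proof.
move=> y0 hn; exists (varpi ^+ n); first exact: expf_neq0.
apply: (ilength_annihilated varpiN dvr _ _ _ hn).
- exact: submodule_alg (cot_span_submodule y).
- exact: submodule_alg aug_ideal_submodule.
- exact: cot_span_aug.
Qed.

Lemma rank_basis : exists r (e : 'I_r -> scalar_mod),
  basis_mod (aug_sat : set scalar_mod) e setT.
Proof.
have [l hl] := M_fg; have hT := submodule_restr aug_sat_submodule.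
have [r [e [egen eind]]] := @basis_mod_exists O varpi dvr scalar_mod aug_sat l hT aug_sat_pure.
exists r, e; split=> // x _.
pose G : set M := [set x | exists2 z : scalar_mod,
  z \in mod_span [set` (l : seq scalar_mod)] & aug_sat (x - z)].
have [z zl Txz] : G x.
  move: x (hl x); apply: (@mod_span_min R M _ G) => [|x xl]; last first.
    exists x; first exact: (@mod_span_sub O scalar_mod _ x xl).
    by rewrite subrr; apply: (submodule0 aug_sat_submodule).
  split; first by exists 0; [exact: rpred0 | rewrite subr0; apply: (submodule0 aug_sat_submodule)].
  move=> a x y [u ul Tu] [v vl Tv]; exists (lam a *: u + v).
    by rewrite rpredD ?rpredZ.
  rewrite opprD addrACA; apply: (submoduleD hT) => //.
  have -> : a *: x - (lam a)%:A *: (u : M) = a *: (x - u) + (a *: (u : M) - (lam a)%:A *: (u : M)).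
    by rewrite scalerBr addrA subrK.
  apply: (submoduleD hT); last exact: aug_satB.
  exact: (submoduleZ a aug_sat_submodule Tu).
have [c Tc] := egen z zl.
exists c; apply: (@submodule_subr O scalar_mod aug_sat _ (z - \sum_i c i *: e i) hT) => //.
by congr aug_sat: Txz; rewrite opprB addrA subrK.
Qed.

End Lengths.
End Exchange.
Arguments cot_nondegenerate {O R} lam y.
Arguments cot_span {O R} lam y.
Arguments cot_length {O R} lam y n.
Arguments aug_ideal {O R} lam.
Arguments aug_mul {O R} lam M.
Arguments aug_sat {O R} lam M.
Arguments aug_socle {O R} lam M y.
Arguments cong_set {O R} lam M y.
Arguments cong_length {O R} lam M y n.
Arguments scalar_mod {O R} M.

(** * Independence of the regular sequence *)

Section Independence.
Variables (O : idomainType) (R : comAlgType O).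
Variables (lam : {lrmorphism R -> O | *%R}) (M : lmodType R).
Variable m : idealr R.
Hypotheses (R_local : local_ring m) (R_noeth : noetherian R).
Hypothesis M_fg : finitely_generated M.
Hypothesis M_loc : exists x : M, forall s, lam s != 0 -> s *: x != 0.
Variable varpi : O.
Hypotheses (varpi0 : varpi != 0) (varpiN : varpi \isn't a GRing.unit).
Hypothesis dvr : forall a : O, a != 0 ->
  exists k u, u \is a GRing.unit /\ a = u * varpi ^+ k.
Implicit Types (w y u v : seq R).

Lemma aug_local x : lam x = 0 -> x \in m.
Proof.
move=> x0; apply/negPn/negP => /(notin_local_unit R_noeth R_local)[t].
by move=> /(congr1 lam)/eqP; rewrite rmorphM rmorph1 /= x0 mulr0 eq_sym oner_eq0.
Qed.

Lemma varpi_local : varpi%:A \in m.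
Proof.
apply/negPn/negP => /(notin_local_unit R_noeth R_local)[t].
move=> /(congr1 lam); rewrite rmorphM rmorph1 /= lam_alg => tv.
by move/negP: varpiN; apply; apply/unitrP; exists (lam t); rewrite [varpi * _]mulrC.
Qed.

Definition admissible y := [/\ forall x, x \in y -> lam x = 0,
  weakly_regular M [::] (rcons y varpi%:A) & cot_nondegenerate lam y].

Lemma admissible_rcons w f : admissible (rcons w f) ->
  [/\ lam f = 0, forall x, x \in w -> lam x = 0, regular_mod (smul M w) f &
      regular_mod (smul M (rcons w f)) varpi%:A].
Proof.
move=> [wf reg _]; split.
- by apply: wf; rewrite mem_rcons mem_head.
- by move=> x xw; apply: wf; rewrite mem_rcons inE xw orbT.
- by move: reg; rewrite -!cats1 -catA => /weakly_regular_cat[_ []].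
by move: reg; rewrite -cats1 => /weakly_regular_cat[_ []].
Qed.

(** The class of f in the cotangent space of R / (w) is not a torsion element. *)
Definition torsion_free_mod w f := forall t : O, cot_span lam w (t *: f) -> t = 0.

Lemma admissible_torsion_free w f : admissible (rcons w f) -> torsion_free_mod w f.
Proof.
move=> adm; have [f0 w0 rf _] := admissible_rcons adm; case: adm => wf _ nf t.
exact: (cot_span_torsion_free R_noeth M_fg M_loc).
Qed.

Lemma nondegenerate_relation w f g : lam f = 0 -> lam g = 0 ->
  cot_nondegenerate lam (rcons w f) -> torsion_free_mod w g ->
  exists a b : O, [/\ a != 0, b != 0 & cot_span lam w (b *: g - a *: f)].
Proof.
move=> f0 g0 [d d0 hd] tg; have /(cot_span_rcons _ _ f0)[t ht] := hd g g0.
exists t, d; split=> //; apply/eqP => t0; move: ht; rewrite t0 scale0r subr0.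
by move=> /tg/eqP; apply/negP.
Qed.

Lemma nondegenerate_exchange w f g : lam f = 0 -> lam g = 0 ->
  cot_nondegenerate lam (rcons w f) -> torsion_free_mod w g ->
  cot_nondegenerate lam (rcons w g).
Proof.
move=> f0 g0 nf tg; have [a [b [a0 b0 hab]]] := nondegenerate_relation f0 g0 nf tg.
have hw := submodule_alg (cot_span_submodule lam w).
case: nf => d d0 hd; exists (a * d) => [|x /hd/(cot_span_rcons _ _ f0)[t ht]].
  by rewrite mulf_neq0.
apply/(cot_span_rcons _ _ g0); exists (t * b).
apply: (submodule_subr hw (y := - (t *: (b *: g - a *: f)))); last first.
  by apply: submoduleN => //; apply: submoduleZ.
have := submoduleZ a hw ht; congr (cot_span lam w).
by rewrite !scalerBr !scalerA opprK addrA subrK [t * a]mulrC.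
Qed.

Section Rank.
Variables (r : nat) (e : 'I_r -> scalar_mod M).
Hypothesis he : basis_mod (aug_sat lam M : set (scalar_mod M)) e setT.

(** A relation, because the two lengths exist only for suitable y. *)
Definition has_defect y (delta : int) := exists n k,
  [/\ cot_length lam y n, cong_length lam M y k & delta = (r * n)%:Z - k%:Z].

Lemma eq_has_defect y y' delta : y =i y' -> has_defect y delta -> has_defect y' delta.
Proof.
move=> yy [n [k [hn hk ->]]]; exists n, k; split=> //.
  by rewrite /cot_length -(eq_cot_span lam yy).
suff e0 : cong_set lam M y = cong_set lam M y' by rewrite /cong_length -e0.
by congr (sumset _ _); rewrite /aug_socle (eq_smul M yy).
Qed.

Lemma has_defect_exchange w f g delta : admissible (rcons w f) -> admissible (rcons w g) ->
  has_defect (rcons w f) delta -> has_defect (rcons w g) delta.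
Proof.
move=> af ag [n [k [hn hk ->]]].
have [f0 w0 rf _] := admissible_rcons af; have [g0 _ rg _] := admissible_rcons ag.
have tg := admissible_torsion_free ag; case: af ag => wf _ nf [wg _ ng].
have [a [b [a0 b0 hab]]] := nondegenerate_relation f0 g0 nf tg.
have [la hla] := ilength_multiples varpi0 varpiN dvr a0.
have [lb hlb] := ilength_multiples varpi0 varpiN dvr b0.
have [n' hn'] := cot_length_exists R_noeth varpi0 varpiN dvr wg ng.
have [k' hk'] := cong_length_exists R_noeth M_fg varpi0 varpiN dvr ng.
exists n', k'; split=> //.
have e1 := cot_length_exchange R_noeth M_fg M_loc wf wg rf rg nf ng a0 b0 hab hla hlb hn hn'.
have e2 := cong_length_exchange wf wg rf rg a0 b0 hab he hla hlb hk hk'.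
have : (r * n + r * la = r * n' + r * lb)%N by rewrite -!mulnDr e1.
by move: e2; move: (r * la)%N (r * lb)%N (r * n)%N (r * n')%N => *; lia.
Qed.

Lemma admissible_replace w f g : admissible (rcons w f) -> lam g = 0 ->
  regular_mod (smul M (rcons w varpi%:A)) g -> torsion_free_mod w g ->
  admissible (rcons w g).
Proof.
move=> adm g0 rg tg; have [f0 w0 rf rv] := admissible_rcons adm.
case: adm => wf reg nf.
have [rv' _] := regular_swap R_local R_noeth M_fg (aug_local f0) rf rv.
have [rg' rv2] := regular_swap R_local R_noeth M_fg varpi_local rv' rg.
split; first by move=> x; rewrite mem_rcons inE => /orP[/eqP->|/w0].
  move: reg; rewrite -!cats1 -!catA => /weakly_regular_cat[regw _].
  by apply/weakly_regular_cat; split=> //=; rewrite cats1.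
exact: nondegenerate_exchange nf tg.
Qed.

(** The new element is al + be ^+ n.+1 with n > 0. It agrees with al modulo
    p ^ 2, so al decides whether its class is torsion, and n is free to make the
    element regular. One may take al among f, f' and f + f', depending on which
    of f and f' is torsion with respect to the other sequence. *)
Lemma common_replacement w w' f f' :
  admissible (rcons w f) -> admissible (rcons w' f') ->
  exists g, admissible (rcons w g) /\ admissible (rcons w' g).
Proof.
move=> adm adm'; have [f0 w0 rf rv] := admissible_rcons adm.
have [f'0 w'0 rf' rv'] := admissible_rcons adm'.
have tf := admissible_torsion_free adm; have tf' := admissible_torsion_free adm'.
have [rv1 rf1] := regular_swap R_local R_noeth M_fg (aug_local f0) rf rv.
have [rv2 rf2] := regular_swap R_local R_noeth M_fg (aug_local f'0) rf' rv'.
have smulB s : submodule (smul M s) := smul_submodule M s.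
have hC s := submodule_alg (cot_span_submodule lam s).
suff [al [be [al0 be0 [tal tal'] [h1 h2]]]] : exists al be, [/\ lam al = 0, lam be = 0,
    torsion_free_mod w al /\ torsion_free_mod w' al &
    (forall x : M, smul M (rcons w varpi%:A) (al *: x) ->
       smul M (rcons w varpi%:A) (be *: x) -> smul M (rcons w varpi%:A) x) /\
    (forall x : M, smul M (rcons w' varpi%:A) (al *: x) ->
       smul M (rcons w' varpi%:A) (be *: x) -> smul M (rcons w' varpi%:A) x)].
  have [n1 hn1] := regular_mod_generic R_local R_noeth M_fg (smulB _) (aug_local be0) h1.
  have [n2 hn2] := regular_mod_generic R_local R_noeth M_fg (smulB _) (aug_local be0) h2.
  pose n := (maxn n1 n2).+1; exists (al + be ^+ n.+1).
  have bn0 k : lam (be ^+ k.+1) = 0 by rewrite rmorphXn /= be0 expr0n.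
  have g0 : lam (al + be ^+ n.+1) = 0 by rewrite rmorphD /= bn0 al0 addr0.
  have tg s : torsion_free_mod s al -> torsion_free_mod s (al + be ^+ n.+1).
    move=> ts t; rewrite scalerDr => h; apply: ts.
    apply: (submodule_subr (hC s) (y := - (t *: be ^+ n.+1))).
      by rewrite opprK.
    apply: submoduleN => //; apply: cot_spanZ; rewrite exprS; exact: (cot_span_mul _ be0 (bn0 _)).
  split; [apply: (admissible_replace adm) | apply: (admissible_replace adm')] => //.
  - by apply: hn1; apply: leqW; apply: leq_maxl.
  - exact: tg.
  - by apply: hn2; apply: leqW; apply: leq_maxr.
  - exact: tg.
have [tff'|ntff'] := pselect (torsion_free_mod w' f).
  exists f, f'; split=> //; split=> x; [move=> h _; exact: rf1 | move=> _; exact: rf2].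
have [tf'f|ntf'f] := pselect (torsion_free_mod w f').
  exists f', f; split=> //; split=> x; [move=> _; exact: rf1 | move=> h _; exact: rf2].
have ex s (h : R) : ~ torsion_free_mod s h -> exists2 t : O, t != 0 & cot_span lam s (t *: h).
  move=> nt; apply: contrapT => ne; apply: nt => t ht; apply: contrapT => /eqP t0.
  by apply: ne; exists t.
have [t t0 ht] := ex _ _ ntff'; have [t' t'0 ht'] := ex _ _ ntf'f.
have tsum s (h h' : R) k : k != 0 -> torsion_free_mod s h -> cot_span lam s (k *: h') ->
    torsion_free_mod s (h + h').
  move=> k0 th hk c; rewrite scalerDr => hc; apply: (mulfI k0); rewrite mulr0.
  apply: th; apply: (submodule_subr (hC s) (y := - (c *: (k *: h')))).
    have := submoduleZ k (hC s) hc; congr (cot_span lam s).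
    by rewrite opprK scalerDr !scalerA [c * k]mulrC.
  by apply: submoduleN => //; apply: submoduleZ.
exists (f + f'), f'; split=> //; first by rewrite rmorphD /= f0 f'0 addr0.
  split; first exact: tsum t'0 _ ht'.
  by rewrite addrC; apply: tsum t0 _ ht.
split=> x; last by move=> _; exact: rf2.
move=> h h'; apply: rf1; apply: (submodule_subr (smulB _) (y := - (f' *: x))).
  by rewrite opprK -scalerDl.
exact: submoduleN.
Qed.

Lemma admissible_move u v z : admissible (rcons (u ++ v) z) -> admissible (rcons u z ++ v).
Proof.
move=> [h1 h2 [d d0 hd]].
have e0 : rcons (u ++ v) z =i rcons u z ++ v.
  by move=> x; rewrite mem_rcons inE !mem_cat mem_rcons inE orbA.
split; first by move=> x; rewrite -e0; apply: h1.
  move: h2; rewrite -!cats1 -!catA => /weakly_regular_cat[regu regv].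
  apply/weakly_regular_cat; split=> //.
  apply: (weakly_regular_move R_local R_noeth M_fg _ regv) => a av.
  by apply: aug_local; apply: h1; rewrite mem_rcons inE mem_cat av !orbT.
by exists d => // x /hd; rewrite (eq_cot_span lam e0).
Qed.

Lemma has_defect_independent k u v v' delta : size v = k -> size v' = k ->
  admissible (u ++ v) -> admissible (u ++ v') ->
  has_defect (u ++ v) delta -> has_defect (u ++ v') delta.
Proof.
elim: k u v v' => [|k IH] u v v'; first by move=> /size0nil-> /size0nil->.
case/lastP: v => [//|v f]; case/lastP: v' => [//|v' f'].
rewrite !size_rcons => -[sv] -[sv']; rewrite -!rcons_cat => adm adm' hdef.
have [g [ag ag']] := common_replacement adm adm'.
have e0 s : rcons (u ++ s) g =i rcons u g ++ s.
  by move=> x; rewrite mem_rcons inE !mem_cat mem_rcons inE orbA.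
apply: (has_defect_exchange ag' adm').
apply: (@eq_has_defect (rcons u g ++ v')); first by move=> x; rewrite e0.
apply: (IH _ v) => //; try exact: admissible_move.
apply: eq_has_defect (e0 v) _; exact: has_defect_exchange hdef.
Qed.

End Rank.
End Independence.

(** * Cotangent space and congruence module as quotients of submodules *)

Section Invariants.
Variables (O : idomainType) (R : comAlgType O).
Variables (lam : {lrmorphism R -> O | *%R}) (M : lmodType R).

Lemma augkerE (x : R) : (x \in augker lam) = (lam x == 0). Proof. by []. Qed.

Lemma augkerP (x : R) : x \in augker lam <-> lam x = 0.
Proof. by rewrite augkerE; split=> [/eqP|->]. Qed.

Lemma ideal_smul_aug_mul (N : lmodType R) (x : N) :
  x \in ideal_smul (augker lam) N <-> aug_mul lam N x.
Proof.
split; move: x; apply: mod_span_min; try exact: mod_span_submodule.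
  move=> _ [a /augkerP a0 [n _ <-]]; exact: aug_mul_mem.
move=> _ [a /augkerP a0 [n _ <-]]; apply: mod_span_sub; exists a => //.
by exists n.
Qed.

Section Cotangent.
Local Notation pmod := (submod (augker_mod lam)).
Local Notation Q := (restr (in_alg R) (cotangent lam)).

Lemma augker_modP (x : R^o) : x \in augker_mod lam <-> lam x = 0.
Proof. exact: augkerP. Qed.

(** The default value 0 is taken outside p only. *)
Definition to_pmod (x : R) : pmod := insubd (0 : pmod) (x : R^o).

Lemma val_to_pmod x : lam x = 0 -> val (to_pmod x) = x.
Proof. by move=> x0; rewrite insubdK //; apply/augker_modP. Qed.

Lemma to_pmod_linear a x z : lam x = 0 -> lam z = 0 ->
  to_pmod (a * x + z) = a *: to_pmod x + to_pmod z.
Proof.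
move=> x0 z0; apply: val_inj; rewrite /= !val_to_pmod //.
by rewrite rmorphD rmorphM /= x0 z0 mulr0 addr0.
Qed.

Definition to_cotangent (x : R) : Q := qproj _ (to_pmod x).

Lemma to_cotangent_ker x : lam x = 0 -> to_cotangent x = 0 <-> cot_span lam [::] x.
Proof.
move=> x0; rewrite /to_cotangent; split=> [/qproj0P h|].
  suff : cot_span lam [::] (val (to_pmod x)) by rewrite val_to_pmod.
  move: (to_pmod x) h; apply: (@mod_span_min R pmod _ [set u | cot_span lam [::] (val u)]).
    have [h0 h] := cot_span_submodule lam [::].
    by split=> [|a u v hu hv]; [exact: h0 | exact: h].
  move=> _ [a /augkerP a0 [n _ <-]]; apply: cot_span_mul => //.
  exact/augker_modP/(valP n).
move=> h; apply/qproj0P.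
suff : [set x | lam x = 0 /\ to_pmod x \in ideal_smul (augker lam) pmod] x by case.
move: x h {x0}; apply: cot_span_min => //.
  split=> [|a x z [x0 hx] [z0 hz]].
    split; first exact: rmorph0.
    suff -> : to_pmod 0 = 0 by apply: rpred0.
    by apply: val_inj; rewrite val_to_pmod ?rmorph0.
  split; first by rewrite rmorphD rmorphM /= x0 z0 mulr0 addr0.
  by rewrite to_pmod_linear // rpredD ?rpredZ.
move=> x z x0 z0; split; first by rewrite rmorphM /= x0 mul0r.
have -> : to_pmod (x * z) = x *: to_pmod z.
  by apply: val_inj; rewrite /= !val_to_pmod // rmorphM /= x0 mul0r.
apply: mod_span_sub; exists x; [exact/augkerP | by exists (to_pmod z)].
Qed.

Lemma submod_chain_cotangent n : submod_chain Q n <->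
  interval_chain (cot_span lam [::]) (aug_ideal lam) n.
Proof.
have hp := submodule_alg (aug_ideal_submodule lam).
apply: (submod_chain_iso (f := to_cotangent)) => //.
- exact: submodule_alg (cot_span_submodule lam [::]).
- exact: cot_span_aug.
- move=> a x z x0 z0; rewrite -mulr_algl /to_cotangent to_pmod_linear //.
  exact: (linearP (qproj _)).
- move=> q; exists (val (qrepr (q : cotangent lam)) : R).
    exact/augker_modP/(valP (qrepr (q : cotangent lam))).
  by rewrite -[RHS](qreprK (q : cotangent lam)) /to_cotangent /to_pmod valKd.
- exact: to_cotangent_ker.
Qed.
End Cotangent.

Section Congruence.
Local Notation OR := (restr lam O^o).
Local Notation Mp := (quotmod (ideal_smul (augker lam) M)).

(** The two sides of linearity differ by an element of p, which kills n. *)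
Lemma hom_of_subproof (N : lmodType R) (n : N) : (forall x, lam x = 0 -> x *: n = 0) ->
  (fun t : OR => (t : O)%:A *: n) \in is_linear OR N.
Proof.
move=> hn; apply/asboolP => a t u; rewrite scalerA mulr_algr.
rewrite -[a *: t]/(lam a * t : O) !scalerDl; congr (_ + _).
apply/eqP; rewrite -subr_eq0 -scalerBl; apply/eqP/hn.
by rewrite rmorphB /= !linearZ /= rmorph1 mulr1 mulrC subrr.
Qed.

Definition hom_of (N : lmodType R) (n : N) (hn : forall x, lam x = 0 -> x *: n = 0) :
  Defs.Hom OR N :=
  exist (fun h => h \in is_linear OR N) _ (hom_of_subproof hn).

Lemma hom_one (N : lmodType R) (h : Defs.Hom OR N) (t : O) :
  val h (t : OR) = t%:A *: val h (1 : O).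
Proof.
have /asboolP lh := valP h.
have := lh t%:A (1 : O) 0; rewrite !addr0.
have -> : val h 0 = 0 by have := lh (-1) 0 0; rewrite scaleN1r oppr0 addr0 scaleN1r addNr.
rewrite addr0 => <-; congr (val h _); rewrite -[LHS]mulr1 -{1}(lam_alg lam t).
by [].
Qed.

Lemma Hom_eq (N : lmodType R) (h h' : Defs.Hom OR N) :
  val h (1 : O) = val h' (1 : O) -> h = h'.
Proof.
by move=> e; apply: val_inj; apply/funext => t; rewrite (hom_one h t) (hom_one h' t) e.
Qed.

Lemma hom_killed (N : lmodType R) (h : Defs.Hom OR N) x :
  lam x = 0 -> x *: val h (1 : O) = 0.
Proof.
have /asboolP lh := valP h; have h0 : val h (0 : O) = 0 by rewrite hom_one !scale0r.
move=> x0; pose u : OR := (1 : O); have := lh x u 0.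
have -> : x *: u + 0 = 0 by rewrite addr0; change (lam x * 1 = 0); rewrite x0 mul0r.
by rewrite h0 addr0.
Qed.

Lemma Mp_killed (n : Mp) x : lam x = 0 -> x *: n = 0.
Proof.
move=> x0; rewrite -[n]qreprK -linearZ; apply/qproj0P/ideal_smul_aug_mul.
exact: aug_mul_mem.
Qed.

Local Notation homs := (restr (in_alg R) (Defs.Hom OR M)).
Local Notation homs_mod := (restr (in_alg R) (Defs.Hom OR Mp)).

Definition cong_map : {linear tf homs -> tf homs_mod} := @congruence_map O R lam M.

Definition hom_of_mod (n : scalar_mod M) : homs_mod :=
  hom_of (Mp_killed (qproj (ideal_smul (augker lam) M) n)).

Definition to_congruence (n : scalar_mod M) : coker cong_map :=
  qproj (mod_image cong_map) (qproj (torsion homs_mod) (hom_of_mod n)).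

Lemma hom_of_mod_linear (a : O) (x z : scalar_mod M) :
  hom_of_mod (a *: x + z) = a *: hom_of_mod x + hom_of_mod z.
Proof.
apply: Hom_eq; pose q := qproj (ideal_smul (augker lam) M).
change (1%:A *: q (a%:A *: (x : M) + z) = a%:A *: (1%:A *: q x) + 1%:A *: q z).
by rewrite !scale1r; exact: linearP.
Qed.

Lemma to_congruence_linear (a : O) (x z : scalar_mod M) :
  to_congruence (a *: x + z) = a *: to_congruence x + to_congruence z.
Proof.
rewrite /to_congruence hom_of_mod_linear.
apply: etrans (@qproj_is_linear O _ (mod_image cong_map) a _ _).
by congr (qproj _ _); apply: (@qproj_is_linear O _ (torsion homs_mod) a).
Qed.

(** A homomorphism from O to M is determined by the image l of 1, which is any
    element killed by p. *)
Lemma to_congruence_ker x : to_congruence x = 0 <-> cong_set lam M [::] x.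
Proof.
rewrite /to_congruence; split=> [/qproj0P/asboolP[u]|[l Ll [a a0 hl]]].
  rewrite -[u]qreprK [LHS]tf_mapE => /qproj_eq/asboolP[a a0].
  move: (qrepr u) => g /(congr1 val)/(congr1 (fun h => h (1 : O))).
  pose q := qproj (ideal_smul (augker lam) M); pose l := val g (1 : O) : M.
  move=> hg; have {}hg : a%:A *: (q l - 1%:A *: q x) = 0 by exact: hg.
  exists l.
    move=> z z0; rewrite (hom_killed g z0); exact: submodule0 (smul_submodule M [::]).
  exists a => //; rewrite -opprB scalerN; apply: (submoduleN (aug_mul_submodule lam M)).
  by apply/ideal_smul_aug_mul/qproj0P; move: hg; rewrite !scale1r qprojZ qprojB.
have hl' z : lam z = 0 -> z *: l = 0 by move=> /Ll; apply: smul_nil.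
apply/qproj0P/asboolP; exists (qproj (torsion homs) (hom_of hl')).
rewrite [LHS]tf_mapE; apply/qproj_eq/asboolP; exists a => //; apply: Hom_eq.
pose q := qproj (ideal_smul (augker lam) M).
change (a%:A *: (q (1%:A *: l) - 1%:A *: q x) = 0); rewrite !scale1r -qprojB -qprojZ.
apply/qproj0P/ideal_smul_aug_mul.
by rewrite -opprB scalerN; apply: (submoduleN (aug_mul_submodule lam M)).
Qed.

Lemma to_congruence_surj (q : coker cong_map) : exists x, to_congruence x = q.
Proof.
have [q1 ->] : exists q1, q = qproj (mod_image cong_map) q1.
  by exists (@qrepr O _ (mod_image cong_map) q); exact/esym/(@qreprK O _ (mod_image cong_map)).
have [h ->] : exists h, q1 = qproj (torsion homs_mod) h.
  by exists (@qrepr O _ (torsion homs_mod) q1); exact/esym/(@qreprK O _ (torsion homs_mod)).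
exists (qrepr (val (h : Defs.Hom OR Mp) (1 : O))); rewrite /to_congruence.
congr (qproj _ (qproj _ _)); apply: Hom_eq.
by rewrite /= !scale1r qreprK.
Qed.

Lemma cong_length_congruence n : cong_length lam M [::] n ->
  mod_length (congruence_module lam M) = n.
Proof.
change (cong_length lam M [::] n -> mod_length (coker cong_map) = n).
apply: (@mod_length_interval O (coker cong_map) (scalar_mod M) _ _ to_congruence) => //.
- exact: cong_set_submodule.
- by move=> a x z _ _; apply: to_congruence_linear.
- by move=> q; have [x] := to_congruence_surj q; exists x.
- by move=> x _; apply: to_congruence_ker.
Qed.
End Congruence.
End Invariants.

(** * The rank as a rank over O *)

Section FreeRank.
Variables (R : comNzRingType) (M : lmodType R).

(** The matrices of a change of basis are inverse to each other. *)
Lemma is_basis_le n k (e : 'I_n -> M) (e' : 'I_k -> M) :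
  is_basis e -> is_basis e' -> (n <= k)%N.
Proof.
move=> be be'.
have /choice[a ha] : forall i, exists a : {ffun 'I_k -> R}, e i = \sum_j a j *: e' j.
  by move=> i; have [a [ha _]] := be' (e i); exists a.
have /choice[b hb] : forall i, exists b : {ffun 'I_n -> R}, e' i = \sum_j b j *: e j.
  by move=> i; have [b [hb _]] := be (e' i); exists b.
apply: (@mulmx1_min R n k (\matrix_(i, j) a i j) (\matrix_(i, j) b i j)).
apply/matrixP => i j; have [c [_ uc]] := be (e i).
have e1 : c = [ffun l => ((\matrix_(i, j) a i j) *m (\matrix_(i, j) b i j)) i l].
  apply: uc; rewrite ha; under eq_bigr do rewrite hb scaler_sumr.
  rewrite exchange_big; apply: eq_bigr => l _ /=; rewrite ffunE mxE scaler_suml.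
  by apply: eq_bigr => t _; rewrite !mxE scalerA.
have e2 : c = [ffun l => (i == l)%:R].
  apply: uc; rewrite (bigD1 i) //= ffunE eqxx scale1r big1 ?addr0 // => l li.
  by rewrite ffunE eq_sym (negPf li) scale0r.
have := congr1 (fun f : {ffun 'I_n -> R} => f j) e1; rewrite e2 !ffunE => <-.
by rewrite mxE.
Qed.

Lemma free_rank_basis n (e : 'I_n -> M) : is_basis e -> free_rank M = n.
Proof.
move=> be; apply: xget_unique; first by exists e.
by move=> k [e' be']; apply/eqP; rewrite eqn_leq (is_basis_le be be') (is_basis_le be' be).
Qed.
End FreeRank.

Section LocalRank.
Variables (R : comNzRingType) (P : prime_idealr R) (M : lmodType R).

Lemma frac_add (x y : M) (t : denominator P) : Defs.frac (x + y) t = Defs.frac x t + Defs.frac y t.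
Proof.
rewrite fracD; apply/frac_eq; exists (den1 P).
by rewrite denME -[den t *: x + _]scalerDr scalerA subrr scaler0.
Qed.

Lemma frac_sum I (s : seq I) (F : I -> M) (t : denominator P) :
  Defs.frac (\sum_(i <- s) F i) t = \sum_(i <- s) Defs.frac (F i) t.
Proof.
elim: s => [|i s IH]; last by rewrite !big_cons frac_add IH.
rewrite !big_nil; apply/frac_eq; exists (den1 P).
by rewrite !scaler0 subrr scaler0.
Qed.

Lemma frac0P (x : M) (t : denominator P) : Defs.frac x t = 0 <->
  exists u : denominator P, den u *: x = 0.
Proof.
split=> [/frac_eq[u]|[u ux]].
  by rewrite den1E scale1r scaler0 subr0; exists u.
by apply/frac_eq; exists u; rewrite den1E scale1r scaler0 subr0.
Qed.

Lemma scale_frac (a : R) (s t : denominator P) (x : M) :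
  (Defs.frac (a : R^o) s : locring P) *: (Defs.frac x t) = Defs.frac (a *: x) (denM s t).
Proof. exact: loc_scaleE. Qed.

(** The product of the denominators serves for all fractions. *)
Lemma common_denominator n (b : 'I_n -> locring P) :
  exists (t : denominator P) (a : 'I_n -> R), forall i, b i = Defs.frac (a i : R^o) t.
Proof.
have dP : \prod_(i < n) den (@denom R P R^o (b i)) \notin P.
  elim/big_ind: _ => [|x y xP yP|i _]; first by rewrite idealr1.
    by rewrite prime_idealrM negb_or xP yP.
  exact: (valP (@denom R P R^o (b i))).
exists (exist (fun s : R => s \notin P) _ dP).
exists (fun i => (@numer R P R^o (b i) : R) * \prod_(j < n | j != i) den (@denom R P R^o (b j))) => i.
rewrite -[LHS]fracK; apply/frac_eq; exists (den1 P); rewrite den1E scale1r.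
apply/eqP; rewrite subr_eq0; apply/eqP.
rewrite [den (exist _ _ _)]/den /= (bigD1 i) //= -[LHS]/(_ * _ : R) -[RHS]/(_ * _ : R).
by rewrite -mulrA [X in _ * X]mulrC.
Qed.
End LocalRank.

Section Rank.
Variables (O : idomainType) (R : comAlgType O).
Variables (lam : {lrmorphism R -> O | *%R}) (M : lmodType R).
Local Notation P := (augker lam).

Lemma denominatorP (t : denominator P) : lam (den t) != 0.
Proof. by have := valP t; rewrite augkerE. Qed.

(** When p vanishes after localization, the localization of M is a vector space
    over the fraction field of O, of dimension the rank of M / p M. *)
Lemma free_rank_basis_mod r (e : 'I_r -> scalar_mod M) (s : R) : lam s != 0 ->
  (forall x, lam x = 0 -> s * x = 0) ->
  basis_mod (aug_sat lam M : set (scalar_mod M)) e setT ->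
  free_rank (locmod P M) = r.
Proof.
move=> s0 hs [egen eind].
have sM x : aug_mul lam M x -> s *: x = 0.
  move: x; apply: (@mod_span_min R M _ [set x | s *: x = 0]) => [|_ [x x0 [n _ <-]]].
    split=> [|a x y /= sx sy]; first by rewrite /= scaler0.
    by rewrite scalerDr scalerA mulrC -scalerA sx sy scaler0 addr0.
  by rewrite /= scalerA hs // scale0r.
have dP (a : R) : lam a != 0 -> a \notin P by [].
pose D (a : R) (a0 : lam a != 0) : denominator P := exist (fun s : R => s \notin P) a a0.
pose E i : locmod P M := Defs.frac (e i : M) (den1 P).
apply: (@free_rank_basis (locring P) _ r E) => z.
have loc_sum (a : 'I_r -> R) (t : denominator P) :
    \sum_i (Defs.frac (a i : R^o) t : locring P) *: E i = Defs.frac (\sum_i a i *: (e i : M)) t.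
  rewrite frac_sum; apply: eq_bigr => i _; rewrite /E scale_frac.
  by congr Defs.frac; apply: val_inj; rewrite /= mulr1.
have [n [t ->]] := fracP z; have [c [a a0 Tc]] := egen n I.
pose A0 : {ffun 'I_r -> locring P} := [ffun i => Defs.frac ((c i)%:A : R^o) t].
have A0E : Defs.frac n t = \sum_i A0 i *: E i.
  under eq_bigr do rewrite ffunE.
  rewrite loc_sum; apply/eqP; rewrite -subr_eq0; apply/eqP.
  have -> : Defs.frac n t - Defs.frac (\sum_i (c i)%:A *: (e i : M)) t =
     Defs.frac (n - \sum_i (c i)%:A *: (e i : M)) t.
    apply/eqP; rewrite subr_eq -frac_add subrK; by [].
  have sa0 : lam (s * a%:A) != 0 by rewrite rmorphM /= lam_alg mulf_neq0.
  apply/frac0P; exists (D _ sa0); rewrite /den /= -scalerA; exact: sM.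
exists A0; split=> // B hB; apply/ffunP => i; apply/eqP; rewrite -subr_eq0; apply/eqP.
pose b i := A0 i - B i; rewrite -/(b i).
have hb : \sum_i b i *: E i = 0.
  by under eq_bigr do rewrite scalerBl; rewrite sumrB -A0E -hB subrr.
have [d [be hbe]] := common_denominator b; rewrite hbe.
move: hb; under eq_bigr do rewrite hbe; rewrite loc_sum => /frac0P[u].
rewrite scaler_sumr => hu.
have /eind/(_ i) : aug_sat lam M (\sum_i lam (den u * be i) *: e i).
  have hT := aug_sat_submodule lam M.
  have -> : \sum_i lam (den u * be i) *: e i =
    - \sum_i ((den u * be i) *: (e i : M) - (lam (den u * be i))%:A *: (e i : M)).
    rewrite sumrB; under [X in - (X - _)]eq_bigr do rewrite -scalerA.
    by rewrite hu sub0r opprK.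
  by apply: submoduleN => //; apply: submodule_sum => // j _; apply: aug_satB.
rewrite rmorphM => /eqP; rewrite mulf_eq0 (negPf (denominatorP u)) /= => /eqP bi0.
by apply/frac0P; exists (D _ s0); rewrite /den /=; apply: hs.
Qed.
End Rank.

(** * Passing to the quotient by a sequence *)

Section Quotient.
Variables (O : idomainType) (R : comAlgType O).
Variables (lam : {lrmorphism R -> O | *%R}) (M : lmodType R).
Variables (y : seq R) (yp : all (mem (augker lam)) y).
Local Notation A := {ideal_quot (seq_ideal yp)}.
Local Notation N := (redmod (seq_ideal yp) M).
Local Notation lamA := (aug_quot yp : {lrmorphism A -> O | *%R}).

Definition ring_proj (x : R) : A := (\pi_A x)%qT.
Definition mod_proj (n : M) : N := qproj (ideal_smul (seq_ideal yp) M) n.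

Lemma ring_proj_surj (u : A) : exists x, u = ring_proj x.
Proof. by exists (repr u); rewrite /ring_proj reprK. Qed.

Lemma mod_proj_surj (v : N) : exists n, v = mod_proj n.
Proof. by exists (qrepr (v : quotmod (ideal_smul (seq_ideal yp) M))); rewrite /mod_proj qreprK. Qed.

Lemma aug_ring_proj x : lamA (ring_proj x) = lam x.
Proof. exact: aug_quotE. Qed.

Lemma ring_proj_linear a x z : ring_proj (a * x + z) = ring_proj a * ring_proj x + ring_proj z.
Proof. by rewrite /ring_proj rmorphD rmorphM. Qed.

Lemma ring_projM x z : ring_proj (x * z) = ring_proj x * ring_proj z.
Proof. by rewrite /ring_proj rmorphM. Qed.

Lemma ring_proj_alg (a : O) : ring_proj a%:A = a%:A.
Proof.
by rewrite -[RHS]/(qalg_scale a 1) -(rmorph1 \pi_A%qT) qalg_scaleE.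
Qed.

Lemma ring_proj_eq x z : ring_proj x = ring_proj z <-> x - z \in gen_ideal y.
Proof.
rewrite -[_ \in _]/(x - z \in seq_ideal yp) Quotient.idealrBE.
by split=> [e|/eqP//]; apply/eqP.
Qed.

Lemma ring_proj0 x : x \in gen_ideal y -> ring_proj x = 0.
Proof.
move=> h; rewrite -[RHS](rmorph0 \pi_A%qT); apply/ring_proj_eq; by rewrite subr0.
Qed.

Lemma mod_projZ x n : mod_proj (x *: n) = ring_proj x *: mod_proj n.
Proof. by rewrite -[RHS]/(red_scale _ _) red_scaleE /mod_proj qprojZ. Qed.

Lemma mod_projD n k : mod_proj (n + k) = mod_proj n + mod_proj k.
Proof. exact: Defs.qprojD. Qed.

Lemma mod_projB n k : mod_proj (n - k) = mod_proj n - mod_proj k.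
Proof. exact: qprojB. Qed.

Lemma mod_proj0P n : mod_proj n = 0 <-> smul M y n.
Proof. exact: qproj0P. Qed.

Lemma mod_proj0 : mod_proj 0 = 0.
Proof. exact: linear0. Qed.

Lemma mod_proj_scalar (a : O) n :
  mod_proj (a%:A *: n) = a *: (mod_proj n : scalar_mod N).
Proof. by rewrite mod_projZ ring_proj_alg. Qed.

Lemma y_aug x : x \in y -> lam x = 0.
Proof. by move=> xy; apply/augkerP; exact: (allP yp). Qed.

Lemma gen_ideal_cot_span x : x \in gen_ideal y -> cot_span lam y x.
Proof.
move: x; apply: (@mod_span_min R R^o _ (cot_span lam y)).
  exact: cot_span_submodule.
by move=> x; apply: cot_span_mem.
Qed.

Lemma cot_span_proj x : cot_span lamA [::] (ring_proj x) <-> cot_span lam y x.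
Proof.
split.
  suff H : cot_span lamA [::] `<=` [set u | exists2 z, u = ring_proj z & cot_span lam y z].
    move=> /H[z /ring_proj_eq/gen_ideal_cot_span xz hz].
    exact: cot_span_subr xz hz.
  apply: cot_span_min => [|u v u0 v0|//].
    have [h0 h] := cot_span_submodule lam y; split.
      exists 0; [by rewrite /ring_proj rmorph0 | exact: h0].
    move=> a u v [x' -> hx] [z -> hz]; have [a' ->] := ring_proj_surj a.
    by exists (a' * x' + z); [rewrite ring_proj_linear | exact: h].
  have [x' e] := ring_proj_surj u; have [z e'] := ring_proj_surj v.
  exists (x' * z); first by rewrite e e' ring_projM.
  by apply: cot_span_mul; rewrite -aug_ring_proj -?e -?e'.
move: x; apply: cot_span_min => [|x z x0 z0|x xy].
- have [h0 h] := cot_span_submodule lamA [::]; split=> /=.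
    by rewrite /ring_proj rmorph0.
  by move=> a x z hx hz; rewrite ring_proj_linear; apply: h.
- by rewrite /= ring_projM; apply: cot_span_mul; rewrite aug_ring_proj.
rewrite /= ring_proj0; first exact: submodule0 (cot_span_submodule lamA [::]).
exact: mod_span_sub.
Qed.

Lemma interval_chain_cot_span n :
  interval_chain (cot_span lam y) (aug_ideal lam) n <->
  interval_chain (cot_span lamA [::]) (aug_ideal lamA) n.
Proof.
apply: (interval_chain_iso (f := ring_proj)).
- exact: submodule_alg (cot_span_submodule lam y).
- exact: submodule_alg (aug_ideal_submodule lam).
- exact: submodule_alg (cot_span_submodule lamA [::]).
- exact: submodule_alg (aug_ideal_submodule lamA).
- by apply: cot_span_aug; apply: y_aug.
- exact: cot_span_aug.
- move=> a x z _ _; rewrite -mulr_algl ring_proj_linear ring_proj_alg.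
  by rewrite mulr_algl.
- by move=> x x0; rewrite /aug_ideal /= aug_ring_proj.
- move=> u; have [x ->] := ring_proj_surj u => x0; exists x.
    by rewrite /aug_ideal /= -aug_ring_proj.
  by rewrite subrr; apply: (submodule0 (submodule_alg (cot_span_submodule lamA [::]))).
by move=> x _; apply: cot_span_proj.
Qed.

Lemma submod_chain_cotangent_quot n :
  submod_chain (restr (in_alg A) (cotangent lamA)) n <->
  interval_chain (cot_span lam y) (aug_ideal lam) n.
Proof. by rewrite submod_chain_cotangent interval_chain_cot_span. Qed.

Lemma aug_mul_proj n : aug_mul lamA N (mod_proj n) <-> aug_mul lam M n.
Proof.
have hM := aug_mul_submodule lam M; have hN := aug_mul_submodule lamA N.
split.
  suff H : aug_mul lamA N `<=` [set v | exists2 k, v = mod_proj k & aug_mul lam M k].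
    move=> /H[k e hk]; apply: (submodule_subr hM _ hk).
    by apply: (smul_aug_mul y_aug); apply/mod_proj0P; rewrite mod_projB e subrr.
  apply: mod_span_min => [|_ [u u0 [v _ <-]]].
    split; first by exists 0; [rewrite mod_proj0 | exact: submodule0].
    move=> a u v [k -> hk] [l -> hl]; have [a' ->] := ring_proj_surj a.
    exists (a' *: k + l); first by rewrite mod_projD mod_projZ.
    by apply: submoduleD => //; apply: submoduleZ.
  have [x e] := ring_proj_surj u; have [k ->] := mod_proj_surj v.
  exists (x *: k); first by rewrite e mod_projZ.
  by apply: aug_mul_mem; rewrite -aug_ring_proj -e.
move: n; apply: (@mod_span_min R M _ [set n | aug_mul lamA N (mod_proj n)]).
  split; first by rewrite /= mod_proj0; apply: submodule0.
  move=> a n k hn hk; rewrite /= mod_projD mod_projZ.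
  by apply: submoduleD => //; apply: submoduleZ.
move=> _ [x x0 [n _ <-]]; rewrite /= mod_projZ; apply: aug_mul_mem.
by rewrite aug_ring_proj.
Qed.

Lemma aug_sat_proj n : aug_sat lamA N (mod_proj n) <-> aug_sat lam M n.
Proof.
have e a : aug_mul lamA N (a%:A *: mod_proj n) <-> aug_mul lam M (a%:A *: n).
  by rewrite -aug_mul_proj mod_projZ ring_proj_alg.
by split=> -[a a0 ha]; exists a => //; apply/e.
Qed.

Lemma aug_socle_proj n : aug_socle lamA N [::] (mod_proj n) <-> aug_socle lam M y n.
Proof.
split=> h x x0.
  apply/mod_proj0P; rewrite mod_projZ; apply: smul_nil; apply: h.
  by rewrite aug_ring_proj.
have [z e] := ring_proj_surj x; rewrite e -mod_projZ (_ : mod_proj _ = 0).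
  exact: submodule0 (smul_submodule N [::]).
by apply/mod_proj0P/h; rewrite -aug_ring_proj -e.
Qed.

Lemma cong_set_proj n : cong_set lamA N [::] (mod_proj n) <-> cong_set lam M y n.
Proof.
split=> -[l Ll Tl].
  have [k e] := mod_proj_surj l; rewrite e in Ll Tl.
  by exists k; [apply/aug_socle_proj | apply/aug_sat_proj; rewrite mod_projB].
by exists (mod_proj l); [apply/aug_socle_proj | rewrite -mod_projB; apply/aug_sat_proj].
Qed.

Lemma cong_length_proj n : cong_length lam M y n -> cong_length lamA N [::] n.
Proof.
apply: (@ilength_iso O (scalar_mod M) (scalar_mod N) _ _ _ _ mod_proj) => //.
- exact: cong_set_submodule.
- exact: cong_set_submodule.
- by move=> a x z _ _; rewrite mod_projD mod_proj_scalar.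
- move=> v _; have [k ->] := mod_proj_surj v; exists k => //.
  by rewrite subrr; apply: submodule0 (cong_set_submodule lamA N [::]).
by move=> x _; apply: cong_set_proj.
Qed.

Lemma basis_mod_proj r (e : 'I_r -> scalar_mod M) :
  basis_mod (aug_sat lam M : set (scalar_mod M)) e setT ->
  basis_mod (aug_sat lamA N : set (scalar_mod N)) (fun i => mod_proj (e i) : scalar_mod N) setT.
Proof.
move=> [egen eind].
have sumE (c : 'I_r -> O) : \sum_i c i *: (mod_proj (e i) : scalar_mod N) =
    mod_proj (\sum_i c i *: e i).
  elim/big_rec2: _ => [|i u v _ ->]; first by rewrite mod_proj0.
  by rewrite mod_projD mod_proj_scalar.
split=> [v _|c].
  have [n ->] := mod_proj_surj v; have [c Tc] := egen n I; exists c.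
  rewrite sumE -mod_projB; exact/aug_sat_proj.
by rewrite sumE => /aug_sat_proj/eind.
Qed.

Section Defect.
Hypothesis R_noeth : noetherian R.
Variables (r : nat) (e : 'I_r -> scalar_mod M).
Hypothesis he : basis_mod (aug_sat lam M : set (scalar_mod M)) e setT.

Lemma wiles_defect_has_defect delta : cot_nondegenerate lam y ->
  has_defect lam M r y delta -> wiles_defect lamA N = delta.
Proof.
move=> ndy [n [k [hn hk ->]]]; rewrite /wiles_defect.
have [s s0 hs] := nondegenerate_kills R_noeth ndy.
have -> : free_rank (locmod (augker lamA) N) = r.
  apply: (free_rank_basis_mod (s := ring_proj s) _ _ (basis_mod_proj he)).
    by rewrite aug_ring_proj.
  move=> u u0; have [x ex] := ring_proj_surj u; rewrite ex -ring_projM.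
  by apply/ring_proj0/hs; rewrite -aug_ring_proj -ex.
rewrite (cong_length_congruence (cong_length_proj hk)).
suff -> : mod_length (restr (in_alg A) (cotangent lamA)) = n by [].
apply: xget_unique.
  case: hn => ch ub; split; first exact/submod_chain_cotangent_quot.
  by move=> l /submod_chain_cotangent_quot/ub.
move=> l [ch ub]; apply: max_nat_unique hn; split; first exact/submod_chain_cotangent_quot.
by move=> i /submod_chain_cotangent_quot/ub.
Qed.

Lemma cot_length_finite : finite_length (restr (in_alg A) (cotangent lamA)) ->
  exists n, cot_length lam y n.
Proof.
move=> [n [ch ub]]; exists n; split; first exact/submod_chain_cotangent_quot.
by move=> l /submod_chain_cotangent_quot/ub.
Qed.
End Defect.
End Quotient.

(** * Torsion-free modules are flat *)

Section Tensor.
Variable D : comNzRingType.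

Section Bilinear.
Variables (U V W : lmodType D) (b : U -> V -> W).
Hypothesis hb : bilinear_map b.

Lemma bilinear_suml I (s : seq I) (F : I -> U) v :
  b (\sum_(i <- s) F i) v = \sum_(i <- s) b (F i) v.
Proof.
have b0 : b 0 v = 0.
  by have := hb.2 v (-1) 0 0; rewrite /= scaleN1r oppr0 addr0 scaleN1r addNr.
elim: s => [|i s IH]; first by rewrite !big_nil.
by rewrite !big_cons -IH; have := hb.2 v 1 (F i) (\sum_(j <- s) F j); rewrite /= !scale1r.
Qed.

Lemma bilinear_sumr I (s : seq I) (F : I -> V) u :
  b u (\sum_(i <- s) F i) = \sum_(i <- s) b u (F i).
Proof.
have b0 : b u 0 = 0.
  by have := hb.1 u (-1) 0 0; rewrite /= scaleN1r oppr0 addr0 scaleN1r addNr.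
elim: s => [|i s IH]; first by rewrite !big_nil.
by rewrite !big_cons -IH; have := hb.1 u 1 (F i) (\sum_(j <- s) F j); rewrite /= !scale1r.
Qed.

Lemma bilinearZ a u v : b (a *: u) v = a *: b u v.
Proof.
have b0 : b 0 v = 0.
  by have := hb.2 v (-1) 0 0; rewrite /= scaleN1r oppr0 addr0 scaleN1r addNr.
by have := hb.2 v a u 0; rewrite /= b0 !addr0.
Qed.

Lemma bilinearZr a u v : b u (a *: v) = a *: b u v.
Proof.
have b0 : b u 0 = 0.
  by have := hb.1 u (-1) 0 0; rewrite /= scaleN1r oppr0 addr0 scaleN1r addNr.
by have := hb.1 u a v 0; rewrite /= b0 !addr0.
Qed.
End Bilinear.

(** The projection of T modulo the span of the pure tensors and the zero map
    agree on pure tensors, hence everywhere. *)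
Lemma tensor_span (U V T : lmodType D) (t : U -> V -> T) : is_tensor t ->
  forall x, exists n (u : 'I_n -> U) (v : 'I_n -> V), x = \sum_i t (u i) (v i).
Proof.
move=> [tb tuniv] x.
pose S : set T := [set x | exists u v, x = t u v].
have zb : bilinear_map (fun (_ : U) (_ : V) => 0 : quotmod (mod_span S)).
  by split=> w a z z'; rewrite scaler0 addr0.
have [h [_ hu]] := tuniv _ _ zb.
have e1 : h = qproj (mod_span S).
  apply: hu; split; first exact: linearP.
  by move=> u v; apply/qproj0P; apply: mod_span_sub; exists u, v.
have e2 : h = (fun=> 0).
  by apply: hu; split=> // a z z'; rewrite scaler0 addr0.
have : x \in mod_span S by apply/qproj0P; rewrite -e1 e2.
move=> /asboolP[n [a [w [wS ->]]]].
have /choice[u /choice[v huv]] : forall i, exists u v, w i = t u v by move=> i; apply: wS.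
exists n, (fun i => a i *: u i), v; apply: eq_bigr => i _.
by rewrite huv (bilinearZ tb).
Qed.

(** The universal property maps T to the quotient of the functions on V * N by
    the bilinearity relations. There a vanishing sum is a combination of finitely
    many relations, and l collects the elements of N that occur in them. *)
Lemma tensor_vanish (V N T : lmodType D) (t : V -> N -> T) n
    (v : 'I_n -> V) (x : 'I_n -> N) :
  is_tensor t -> \sum_i t (v i) (x i) = 0 ->
  exists l : seq N, (forall i, x i \in l) /\ forall chi : N -> D,
    (forall a y z, y \in mod_span [set` l] -> z \in mod_span [set` l] ->
       chi (a *: y + z) = a * chi y + chi z) ->
    \sum_i chi (x i) *: v i = 0.
Proof.
move=> [tb tuniv] t0.
pose X : lmodType D := V * N -> D^o.
pose delta (p : V * N) : X := fun q => (q == p)%:R.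
pose Rel : set X :=
  [set phi | exists a v v' x, phi = delta (a *: v + v', x) - a *: delta (v, x) - delta (v', x)] `|`
  [set phi | exists v a x x', phi = delta (v, a *: x + x') - a *: delta (v, x) - delta (v, x')].
pose b v x : quotmod (mod_span Rel) := qproj (mod_span Rel) (delta (v, x)).
have bb : bilinear_map b.
  split=> [v0|x0] a y z; apply/eqP; rewrite -subr_eq0 opprD addrA /b.
    rewrite -qprojZ -!qprojB; apply/eqP/qproj0P; apply: mod_span_sub.
    by right; exists v0, a, y, z.
  rewrite -qprojZ -!qprojB; apply/eqP/qproj0P; apply: mod_span_sub.
  by left; exists a, y, z, x0.
have [h [[hl ht] _]] := tuniv _ _ bb.
pose hL : {linear T -> quotmod (mod_span Rel)} :=
  HB.pack h (GRing.isLinear.Build D T (quotmod (mod_span Rel)) _ h hl).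
have phiR : \sum_i delta (v i, x i) \in mod_span Rel.
  apply/qproj0P; rewrite linear_sum /=.
  transitivity (hL (\sum_i t (v i) (x i))); last by rewrite t0 linear0.
  by rewrite linear_sum; apply: eq_bigr => i _; rewrite /= ht.
(* The functional chi turns a formal sum of pairs into an element of V; the sum
   runs over a finite S because the elements of X need not have finite support. *)
pose ev (S : seq (V * N)) (chi : N -> D) (phi : X) : V :=
  \sum_(s <- S) (phi s : D) *: (chi s.2 *: s.1).
have ev_lin S chi a phi psi : ev S chi (a *: phi + psi) = a *: ev S chi phi + ev S chi psi.
  rewrite /ev scaler_sumr -big_split; apply: eq_bigr => s _ /=.
  by rewrite -[(a *: phi + psi) s]/(a * phi s + psi s) scalerDl -scalerA.
have evB S chi a phi1 phi2 phi3 : ev S chi (phi1 - a *: phi2 - phi3) =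
    ev S chi phi1 - a *: ev S chi phi2 - ev S chi phi3.
  rewrite (_ : phi1 - _ - _ = (-1) *: (a *: phi2 + phi3) + phi1).
    by rewrite !ev_lin scaleN1r opprD [LHS]addrC addrA.
  by rewrite scaleN1r opprD [RHS]addrC addrA.
have ev_delta S chi p : uniq S -> p \in S -> ev S chi (delta p) = chi p.2 *: p.1.
  move=> uS pS; rewrite /ev (bigD1_seq p) //= /delta eqxx scale1r big1 ?addr0 // => q.
  by move=> /negPf->; rewrite scale0r.
pose good (phi : X) := exists S0 : seq (V * N), forall S chi, uniq S -> {subset S0 <= S} ->
  (forall a y z, y \in mod_span [set` [seq s.2 | s <- S]] ->
     z \in mod_span [set` [seq s.2 | s <- S]] -> chi (a *: y + z) = a * chi y + chi z) ->
  ev S chi phi = 0.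
have goodR : good (\sum_i delta (v i, x i)).
  move: phiR; apply: (@mod_span_min D X _ good).
    split.
      exists [::] => S chi _ _ _; rewrite /ev big1 // => s _.
      by rewrite -[(0 : X) s]/0 scale0r.
    move=> a phi psi [S1 h1] [S2 h2]; exists (S1 ++ S2) => S chi uS sS hchi.
    rewrite ev_lin h1 ?h2 ?scaler0 ?addr0 // => s sS'; apply: sS; rewrite mem_cat sS' ?orbT //.
  move=> phi; case.
    move=> [a [v0 [v1 [x0 ->]]]].
    exists [:: (a *: v0 + v1, x0); (v0, x0); (v1, x0)] => S chi uS sS _.
    rewrite evB !ev_delta ?sS ?inE ?eqxx ?orbT //= scalerDr !scalerA.
    by rewrite [a * _]mulrC addrAC addrK subrr.
  move=> [v0 [a [x0 [x1 ->]]]].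
  exists [:: (v0, a *: x0 + x1); (v0, x0); (v0, x1)] => S chi uS sS hchi.
  rewrite evB !ev_delta ?sS ?inE ?eqxx ?orbT //= hchi.
  - by rewrite scalerDl -scalerA addrAC addrK subrr.
  - by apply: mod_span_sub; apply/mapP; exists (v0, x0); rewrite ?sS ?inE ?eqxx ?orbT.
  - by apply: mod_span_sub; apply/mapP; exists (v0, x1); rewrite ?sS ?inE ?eqxx ?orbT.
have [S0 hS0] := goodR.
pose S := undup (S0 ++ [seq (v i, x i) | i <- enum 'I_n]).
have inS i : (v i, x i) \in S.
  by rewrite mem_undup mem_cat (map_f (fun i => (v i, x i))) ?orbT ?mem_enum.
exists [seq s.2 | s <- S]; split=> [i|chi hchi].
  by apply/mapP; exists (v i, x i).
have ev0 : ev S chi (\sum_i delta (v i, x i)) = 0 :> V.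
  by apply: hS0 hchi; [exact: undup_uniq | move=> s sS; rewrite mem_undup mem_cat sS].
have ev_sum (I : Type) (r : seq I) (F : I -> X) :
    ev S chi (\sum_(i <- r) F i) = \sum_(i <- r) ev S chi (F i).
  elim: r => [|i r IH]; last by rewrite !big_cons -IH -[F i]scale1r ev_lin !scale1r.
  rewrite !big_nil /ev big1 // => s _; by rewrite -[(0 : X) s]/0 scale0r.
rewrite -[RHS]ev0 ev_sum; apply: eq_bigr => i _.
by rewrite ev_delta // undup_uniq.
Qed.
End Tensor.

Section Flat.
Variables (O : idomainType) (varpi : O).
Hypothesis dvr : forall a : O, a != 0 ->
  exists k u, u \is a GRing.unit /\ a = u * varpi ^+ k.

(** A relation in V (x) N takes place in V (x) F for a finitely generated, hence
    free, submodule F of N. *)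
Lemma torsion_free_flat (N : lmodType O) :
  (forall (a : O) (x : N), a != 0 -> a *: x = 0 -> x = 0) -> flat N.
Proof.
move=> tfN U V T T' f t t' g finj ht ht' gt z z' gz.
apply/eqP; rewrite -subr_eq0; apply/eqP.
have : g (z - z') = 0 by rewrite linearB gz subrr.
move: (z - z') => {gz z'} {}z; have [n [u [x ->]]] := tensor_span ht z.
rewrite linear_sum; under eq_bigr do rewrite gt.
move=> /(tensor_vanish ht')[l [xl hl]].
have [r [e [egen eind]]] := basis_mod_exists dvr l (set0_submodule N) tfN.
have /choice[c hc] : forall y, exists c : 'I_r -> O, y \in mod_span [set` l] ->
    y = \sum_j c j *: e j.
  move=> y; have [yl|yl] := boolP (y \in mod_span [set` l]); last by exists (fun=> 0).
  have [c hc] := egen y yl; exists c => _; apply/eqP; rewrite -subr_eq0; exact/eqP.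
have clin j a y y' : y \in mod_span [set` l] -> y' \in mod_span [set` l] ->
    c (a *: y + y') j = a * c y j + c y' j.
  move=> yl y'l; apply/eqP; rewrite -subr_eq0; apply/eqP.
  apply: (eind (fun j => c (a *: y + y') j - (a * c y j + c y' j))).
  under eq_bigr do rewrite scalerBl scalerDl -scalerA.
  rewrite sumrB big_split -scaler_sumr /= -!hc ?subrr //.
  by rewrite rpredD ?rpredZ.
have xspan i : x i \in mod_span [set` l] by apply: mod_span_sub; apply: xl.
have cu j : \sum_i c (x i) j *: u i = 0.
  apply: finj; rewrite linear0 linear_sum -[RHS](hl (fun y => c y j) (clin j)).
  by apply: eq_bigr => i _; rewrite linearZ.
have tb := ht.1.
transitivity (\sum_i \sum_j t (c (x i) j *: u i) (e j)).
  apply: eq_bigr => i _; rewrite {1}(hc _ (xspan i)) (bilinear_sumr tb).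
  by apply: eq_bigr => j _; rewrite (bilinearZr tb) (bilinearZ tb).
rewrite exchange_big big1 // => j _; rewrite -(bilinear_suml tb) cu.
have := bilinearZ tb 0 0 (e j); by rewrite !scale0r.
Qed.
End Flat.

(** * The theorem *)

Lemma regular_mod_exp (R : comNzRingType) (M : lmodType R) (A : set M) a k :
  regular_mod A a -> regular_mod A (a ^+ k).
Proof.
move=> ra; elim: k => [|k IH] n; first by rewrite expr0 scale1r.
by rewrite exprS -scalerA => /ra/IH.
Qed.

Lemma localization_neq0 (R : comNzRingType) (P : prime_idealr R) (M : lmodType R) :
  (exists x : locmod P M, x != 0) -> exists n : M, forall s, s \notin P -> s *: n != 0.
Proof.
move=> [x x0]; have [n [t e]] := fracP x; exists n => s sP.
apply: contraNneq x0 => sn; apply/eqP; rewrite e; apply/frac0P.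
by exists (exist (fun s : R => s \notin P) s sP).
Qed.

Section Flatness.
Variables (O : idomainType) (R : comAlgType O).
Variables (lam : {lrmorphism R -> O | *%R}) (M : lmodType R).
Variables (y : seq R) (yp : all (mem (augker lam)) y).
Variable varpi : O.
Hypothesis dvr : forall a : O, a != 0 ->
  exists k u, u \is a GRing.unit /\ a = u * varpi ^+ k.

Lemma redmod_torsion_free (a : O) (x : scalar_mod (redmod (seq_ideal yp) M)) :
  regular_mod (smul M y) varpi%:A -> a != 0 -> a *: x = 0 -> x = 0.
Proof.
move=> reg /dvr[k [u [uu ->]]]; have [n ->] := mod_proj_surj x.
rewrite -mod_proj_scalar => /mod_proj0P h; apply/mod_proj0P.
apply: (regular_mod_exp (k := k) reg).
have := submoduleZ (u^-1)%:A (smul_submodule M y) h.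
rewrite scalerA mulr_algl scalerA mulKr //.
by rewrite -[(varpi ^+ k) *: 1]/(in_alg R (varpi ^+ k)) rmorphXn.
Qed.
End Flatness.

Local Close Scope classical_set_scope.

Theorem theorem10
    (ell : nat) (ell_prime : prime ell)
    (O : idomainType) (O_int : padic_integer_ring ell O)
    (varpi : O) (varpi_unif : uniformizer varpi)
    (R : comAlgType O) (m : idealr R)
    (R_local : local_ring m) (R_noeth : noetherian R)
    (R_complete : adically_complete m)
    (lam : {lrmorphism R -> O | *%R}) (lam_surj : forall a, exists x, lam x = a)
    (c : nat) (R_reg : regular_local_ring (locring (augker lam)) c)
    (M : lmodType R) (M_fg : finitely_generated M)
    (M_depth : depth_ge M m c.+1)
    (M_loc : exists x : locmod (augker lam) M, x != 0) :
  (forall (y : c.-tuple R) (yp : all (mem (augker lam)) y),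
     regular_seq M (rcons y varpi%:A) ->
     flat (restr (in_alg {ideal_quot (seq_ideal yp)}) (redmod (seq_ideal yp) M)))
  /\
  (forall (y y' : c.-tuple R)
          (yp : all (mem (augker lam)) y) (y'p : all (mem (augker lam)) y'),
     regular_seq M (rcons y varpi%:A) -> regular_seq M (rcons y' varpi%:A) ->
     finite_length (restr (in_alg {ideal_quot (seq_ideal yp)})
                          (cotangent (aug_quot yp))) ->
     finite_length (restr (in_alg {ideal_quot (seq_ideal y'p)})
                          (cotangent (aug_quot y'p))) ->
     wiles_defect (aug_quot yp) (redmod (seq_ideal yp) M) =
     wiles_defect (aug_quot y'p) (redmod (seq_ideal y'p) M)).
Proof.
have [varpi0 dvr] := padic_integer_ring_dvr ell_prime O_int varpi_unif.
have varpiN : varpi \isn't a GRing.unit by apply/varpi_unif; exists 1; rewrite mul1r.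
split=> [y yp reg|y y' yp y'p reg reg' fin fin'].
  apply: (torsion_free_flat dvr) => a x; apply: (redmod_torsion_free dvr).
  move: (regular_seq_weakly reg); rewrite -cats1.
  by move=> /weakly_regular_cat[_ []].
have [x hx] := localization_neq0 M_loc.
have {hx} M_loc' : exists x : M, forall s, lam s != 0 -> s *: x != 0.
  by exists x => s s0; apply: hx; rewrite augkerE.
have [r [e he]] := rank_basis lam M_fg dvr.
have adm z (zp : all (mem (augker lam)) z) : regular_seq M (rcons z varpi%:A) ->
    finite_length (restr (in_alg {ideal_quot (seq_ideal zp)}) (cotangent (aug_quot zp))) ->
    admissible lam M varpi z.
  move=> zreg /cot_length_finite[n hn]; split; first exact: y_aug.
    exact: regular_seq_weakly.
  exact: (nondegenerate_of_length varpi0 varpiN dvr (y_aug zp) hn).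
have ay := adm _ _ reg fin; have ay' := adm _ _ reg' fin'.
have [ny wy ndy] := ay; have [_ _ ndy'] := ay'.
have [n hn] := cot_length_exists R_noeth varpi0 varpiN dvr ny ndy.
have [k hk] := cong_length_exists R_noeth M_fg varpi0 varpiN dvr ndy.
have hd : has_defect lam M r ([::] ++ y) ((r * n)%:Z - k%:Z) by exists n, k.
have hd' : has_defect lam M r ([::] ++ y') ((r * n)%:Z - k%:Z).
  exact: (has_defect_independent (u := [::]) R_local R_noeth M_fg M_loc' varpi0 varpiN dvr he
    (size_tuple y) (size_tuple y') ay ay' hd).
rewrite (wiles_defect_has_defect yp R_noeth he ndy hd).
by rewrite (wiles_defect_has_defect y'p R_noeth he ndy' hd').
Qed.
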